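(* Let $m,n\ge 1$. The following closed subgroups are parabolically connected: (i) $\mathrm{SL}(m)\times\mathrm{SL}(n)\subset\mathrm{SL}(m+n)$ for all $m,n$; (ii) $\mathrm{S}(\mathrm{GL}(m)\times\mathrm{GL}(n))\subset\mathrm{SL}(m+n)$ for $m\neq n$; (iii) $\mathrm{Sp}(2n)\subset\mathrm{SL}(2n)$; (iv) $\mathrm{Sp}(2n)\subset\mathrm{SL}(2n+1)$; (v) $\mathrm{Sp}(2n)\times\mathrm{T}^1\subset\mathrm{SL}(2n+1)$. On the other hand, the following subgroups are not parabolically connected: (vi) $\mathrm{SO}(n)\subset\mathrm{SL}(n)$ for $n\ge 2$; (vii) $\mathrm{S}(\mathrm{GL}(n)\times\mathrm{GL}(n))\subset\mathrm{SL}(2n)$.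
   Context: All groups are linear algebraic groups over $\mathbb{C}$ with the Zariski topology. A closed subgroup $H$ of a reductive group $G$ is called parabolically connected if for every parabolic subgroup $P\subseteq G$ the intersection $P\cap H$ is connected. Embeddings: $\mathrm{SL}(m)\times\mathrm{SL}(n)$ and $\mathrm{S}(\mathrm{GL}(m)\times\mathrm{GL}(n))$ denote the subgroups of $\mathrm{SL}(m+n)$ of block-diagonal matrices $\mathrm{diag}(A,B)$ with $A$ of size $m$, $B$ of size $n$, where respectively $\det A=\det B=1$, or $\det A\cdot\det B=1$. $\mathrm{Sp}(2n)\subset\mathrm{SL}(2n)$ is the group preserving a nondegenerate skew-symmetric bilinear form on $\mathbb{C}^{2n}$. $\mathrm{Sp}(2n)\subset\mathrm{SL}(2n+1)$: writing $\mathbb{C}^{2n+1}=U\oplus\langle e_{2n+1}\rangle$ with $\dim U=2n$, it is the group of matrices acting on $U$ as an element of $\mathrm{Sp}(U)$ (for a fixed nondegenerate skew form on $U$) and fixing $e_{2n+1}$. $\mathrm{T}^1=\{t(\lambda)=\mathrm{diag}(\lambda,\dots,\lambda,\lambda^{-2n}):\lambda\in\mathbb{C}^\times\}\subset\mathrm{SL}(2n+1)$ (acting by $\lambda$ on $U$ and by $\lambda^{-2n}$ on $e_{2n+1}$), and $\mathrm{Sp}(2n)\times\mathrm{T}^1$ is the subgroup generated by these two commuting subgroups. $\mathrm{SO}(n)\subset\mathrm{SL}(n)$ is the special orthogonal group of a nondegenerate symmetric bilinear form on $\mathbb{C}^n$. *)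

(* Defs.v *)
From HB Require Import structures.
From mathcomp Require Import all_boot all_order all_algebra.
Set Implicit Arguments. Unset Strict Implicit. Unset Printing Implicit Defensive.
Import Order.TTheory GRing.Theory Num.Theory.
Local Open Scope ring_scope.

Definition mxset (F : fieldType) (N : nat) := 'M[F]_N -> Prop.

Inductive pexpr (F : Type) : Type :=
| PVar of nat
| PConst of F
| PAdd of pexpr F & pexpr F
| PMul of pexpr F & pexpr F.

Fixpoint peval (F : fieldType) (e : nat -> F) (p : pexpr F) : F :=
  match p with
  | PVar k => e k
  | PConst c => c
  | PAdd p q => peval e p + peval e q
  | PMul p q => peval e p * peval e q
  end.

(* The coordinates of a matrix, listed row by row (variable X_k is the
   k-th entry; out-of-range variables evaluate to 0). *)
Definition mx_coord (F : fieldType) (N : nat) (A : 'M[F]_N) (k : nat) : F :=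
  nth 0 [seq A i j | i <- enum 'I_N, j <- enum 'I_N] k.

Definition zclosed (F : fieldType) (N : nat) (Z : mxset F N) : Prop :=
  exists S : pexpr F -> Prop,
    forall A, Z A <-> (forall p, S p -> peval (mx_coord A) p = 0).

Definition zconnected (F : fieldType) (N : nat) (X : mxset F N) : Prop :=
  forall Z1 Z2 : mxset F N, zclosed Z1 -> zclosed Z2 ->
    (forall A, X A -> Z1 A \/ Z2 A) ->
    (forall A, X A -> Z1 A -> Z2 A -> False) ->
    (forall A, X A -> Z1 A) \/ (forall A, X A -> Z2 A).

Definition SLset (F : fieldType) (N : nat) : mxset F N := fun A => \det A = 1.

Definition is_group (F : fieldType) (N : nat) (H : mxset F N) : Prop :=
  [/\ H 1%:M, (forall A B, H A -> H B -> H (A *m B)) &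
      (forall A, H A -> H (invmx A))].

Definition closed_subgroup (F : fieldType) (N : nat) (H : mxset F N) : Prop :=
  [/\ (forall A, H A -> SLset A), is_group H & zclosed H].

Definition gen_group (F : fieldType) (N : nat) (S : mxset F N) : mxset F N :=
  fun A => forall K : mxset F N, is_group K -> (forall B, S B -> K B) -> K A.

Definition commutator (F : fieldType) (N : nat) (A B : 'M[F]_N) : 'M[F]_N :=
  invmx A *m invmx B *m A *m B.

Definition derived (F : fieldType) (N : nat) (H : mxset F N) : mxset F N :=
  gen_group (fun C => exists A B, [/\ H A, H B & C = commutator A B]).

Fixpoint dseries (F : fieldType) (N : nat) (k : nat) (H : mxset F N) : mxset F N :=
  match k with
  | 0 => H
  | k'.+1 => derived (dseries k' H)
  end.

Definition solvable_set (F : fieldType) (N : nat) (H : mxset F N) : Prop :=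
  exists k, forall A, dseries k H A -> A = 1%:M.

Definition borel (F : fieldType) (N : nat) (B : mxset F N) : Prop :=
  [/\ closed_subgroup B, zconnected B, solvable_set B &
      forall B' : mxset F N, closed_subgroup B' -> zconnected B' -> solvable_set B' ->
        (forall A, B A -> B' A) -> forall A, B' A -> B A].

Definition parabolic (F : fieldType) (N : nat) (P : mxset F N) : Prop :=
  closed_subgroup P /\ exists B, borel B /\ (forall A, B A -> P A).

Definition parabolically_connected (F : fieldType) (N : nat) (H : mxset F N) : Prop :=
  forall P : mxset F N, parabolic P -> zconnected (fun A => P A /\ H A).

Definition SLxSL (F : fieldType) (m n : nat) : mxset F (m + n) :=
  fun X => exists (A : 'M[F]_m) (B : 'M[F]_n),
    [/\ X = block_mx A 0 0 B, \det A = 1 & \det B = 1].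

Definition SGLxGL (F : fieldType) (m n : nat) : mxset F (m + n) :=
  fun X => exists (A : 'M[F]_m) (B : 'M[F]_n),
    X = block_mx A 0 0 B /\ \det A * \det B = 1.

Definition Sp_set (F : fieldType) (n : nat) (J : 'M[F]_(2 * n)) : mxset F (2 * n) :=
  fun X => X^T *m J *m X = J.

Definition Sp_set1 (F : fieldType) (n : nat) (J : 'M[F]_(2 * n)) : mxset F (2 * n + 1) :=
  fun X => exists S : 'M[F]_(2 * n), Sp_set J S /\ X = block_mx S 0 0 1%:M.

(* Sp(2n) x T^1 in SL(2n+1), T^1 = { diag(l,...,l, l^(-2n)) } *)
Definition SpT_set (F : fieldType) (n : nat) (J : 'M[F]_(2 * n)) : mxset F (2 * n + 1) :=
  fun X => exists (S : 'M[F]_(2 * n)) (l : F),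
    [/\ Sp_set J S, l != 0 & X = block_mx (l *: S) 0 0 (l ^- (2 * n))%:M].

Definition SO_set (F : fieldType) (n : nat) (Q : 'M[F]_n) : mxset F n :=
  fun X => X^T *m Q *m X = Q /\ \det X = 1.

(* Main.v *)
(** By the Lie-Kolchin theorem the Borel subgroups of SL(N) are the conjugates of
    the group T of lower triangular matrices of determinant 1, and a parabolic
    subgroup P is the union of the Borel subgroups it contains.  Hence the
    intersection of P and H is connected as soon as, for all g in GL(N), every u in
    the intersection of T and g H g^-1 can be joined to 1 by rational curves there.

    For (i) and (ii), g H g^-1 is defined by commutation with an involution th and
    by determinants.  The segment from 1 to u commutes with th, and its two partial
    determinants are brought back to 1 by one-parameter subgroups attached to a
    decomposition of 1 into triangular idempotents, which either have rank 1 or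
    come in pairs exchanged by th.  If there are only pairs, then m = n and the two
    partial determinants agree.

    For (iii) and (iv), a Cayley transform joins 1 to any isometry h such that
    h + 1 is invertible.  In general let E be the Fitting idempotent of h for the
    eigenvalue -1, and P a triangular idempotent that splits it into two isotropic
    halves: 1 - E + t P + t^-1 (E - P) lets t go from 1 to -1 and moves h to
    (1 - 2E) h, to which the Cayley transform applies.  For (v), a one-parameter
    subgroup built in the same way from E = 1 reduces to (iv).

    For (vi) and (vii), one intersects with the stabiliser of a nonisotropic line
    and of the diagonal n-dimensional subspace, where an eigenvalue, respectively a
    determinant, takes both values 1 and -1. *)
Require Import Defs.
From Stdlib Require Import Classical.
From HB Require Import structures.
From mathcomp Require Import all_boot all_order all_algebra.
From mathcomp Require Import perm ring.
Set Implicit Arguments. Unset Strict Implicit. Unset Printing Implicit Defensive.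
Import Order.TTheory GRing.Theory Num.Theory.
Local Open Scope ring_scope.

(** Connectedness is handled through [joined]: a line with finitely many points removed is
    irreducible, so a curve whose entries are polynomials divided by powers of [g] cannot be split
    by two disjoint closed sets. Determinants and Cayley denominators may therefore be inverted
    freely along a path. The obstacle is that every path must stay lower triangular and in g H g^-1
    at the same time, for an arbitrary g. A triangular idempotent R yields the triangular matrices 1
    + (s - 1) R, so the tori that are needed come from idempotents split without leaving the
    triangular matrices. This is done by peeling: the last nonzero column of a triangular
    idempotent, with its partner under the involution or the form, spans a piece whose subtraction
    makes that column vanish. That a parabolic subgroup is the union of its Borel subgroups is
    obtained by triangularising an element one row at a time by conjugations inside the group,
    without flag varieties or fixed point theorems. *)

Ltac mxabel :=
  repeat match goal with
  | |- context [?A *m ?B] => let X := fresh "X" in move: (A *m B) => X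
  end;
  apply/matrixP => ? ?; rewrite !mxE; ring.

(** * Zariski closed sets and rational curves *)

Section Polynomial.
Variable F : fieldType.
Implicit Types N M : nat.

Definition polyfun N (f : 'M[F]_N -> F) : Prop :=
  exists p, forall A, f A = peval (mx_coord A) p.

Definition polymap N M L (f : 'M[F]_N -> 'M[F]_(M, L)) : Prop :=
  forall i j, polyfun (fun A => f A i j).

Lemma eq_polyfun N (f g : 'M[F]_N -> F) : f =1 g -> polyfun f -> polyfun g.
Proof. by move=> fg [p Hp]; exists p => A; rewrite -fg. Qed.

Lemma polyfun_const N (c : F) : polyfun (fun _ : 'M_N => c).
Proof. by exists (PConst c). Qed.

Lemma polyfunD N (f g : 'M[F]_N -> F) :
  polyfun f -> polyfun g -> polyfun (fun A => f A + g A).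
Proof. by move=> [p Hp] [q Hq]; exists (PAdd p q) => A /=; rewrite Hp Hq. Qed.

Lemma polyfunM N (f g : 'M[F]_N -> F) :
  polyfun f -> polyfun g -> polyfun (fun A => f A * g A).
Proof. by move=> [p Hp] [q Hq]; exists (PMul p q) => A /=; rewrite Hp Hq. Qed.

Lemma polyfunN N (f : 'M[F]_N -> F) : polyfun f -> polyfun (fun A => - f A).
Proof.
move=> Hf; apply: (eq_polyfun _ (polyfunM (polyfun_const N (-1)) Hf)) => A.
by rewrite mulN1r.
Qed.

Lemma polyfunB N (f g : 'M[F]_N -> F) :
  polyfun f -> polyfun g -> polyfun (fun A => f A - g A).
Proof. by move=> Hf Hg; apply: polyfunD => //; apply: polyfunN. Qed.

Lemma polyfun_sum N I (r : seq I) (P : pred I) (f : I -> 'M[F]_N -> F) :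
  (forall i, polyfun (f i)) -> polyfun (fun A => \sum_(i <- r | P i) f i A).
Proof.
move=> Hf; elim: r => [|i r IH].
  by apply: (eq_polyfun _ (polyfun_const N 0)) => A; rewrite big_nil.
case Pi: (P i); last by apply: (eq_polyfun _ IH) => A; rewrite big_cons Pi.
by apply: (eq_polyfun _ (polyfunD (Hf i) IH)) => A; rewrite big_cons Pi.
Qed.

Lemma polyfun_prod N I (r : seq I) (P : pred I) (f : I -> 'M[F]_N -> F) :
  (forall i, polyfun (f i)) -> polyfun (fun A => \prod_(i <- r | P i) f i A).
Proof.
move=> Hf; elim: r => [|i r IH].
  by apply: (eq_polyfun _ (polyfun_const N 1)) => A; rewrite big_nil.
case Pi: (P i); last by apply: (eq_polyfun _ IH) => A; rewrite big_cons Pi.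
by apply: (eq_polyfun _ (polyfunM (Hf i) IH)) => A; rewrite big_cons Pi.
Qed.

Lemma polyfun_entry N (i j : 'I_N) : polyfun (fun A : 'M[F]_N => A i j).
Proof.
pose s := [seq (i, j) | i <- enum 'I_N, j <- enum 'I_N].
have ijs : (i, j) \in s by apply/allpairsP; exists (i, j); rewrite !mem_enum.
exists (PVar F (index (i, j) s)) => A /=; rewrite /mx_coord.
have -> : [seq A i0 j0 | i0 <- enum 'I_N, j0 <- enum 'I_N]
          = [seq A p.1 p.2 | p <- s] by rewrite map_allpairs.
by rewrite (nth_map (i, j)) ?index_mem // nth_index.
Qed.

Lemma polymap_id N : polymap (fun A : 'M[F]_N => A).
Proof. by move=> i j; apply: polyfun_entry. Qed.

Lemma polymap_const N M L (B : 'M[F]_(M, L)) : polymap (fun _ : 'M[F]_N => B).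
Proof. by move=> i j; apply: polyfun_const. Qed.

Lemma polymapM N M K L (f : 'M[F]_N -> 'M[F]_(M, K)) (g : 'M[F]_N -> 'M[F]_(K, L)) :
  polymap f -> polymap g -> polymap (fun A => f A *m g A).
Proof.
move=> Hf Hg i j.
have H : polyfun (fun A => \sum_k f A i k * g A k j).
  by apply: polyfun_sum => k; apply: polyfunM.
by apply: (eq_polyfun _ H) => A; rewrite mxE.
Qed.

Lemma polyfun_comp N M (h : 'M[F]_M -> F) (f : 'M[F]_N -> 'M[F]_M) :
  polyfun h -> polymap f -> polyfun (fun A => h (f A)).
Proof.
move=> [p Hp] Hf.
suff H : polyfun (fun A => peval (mx_coord (f A)) p).
  by apply: (eq_polyfun _ H) => A; rewrite Hp.
elim: p {Hp h} => [k|c|p IHp q IHq|p IHp q IHq] /=.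
- rewrite /mx_coord.
  pose s := [seq (i, j) | i <- enum 'I_M, j <- enum 'I_M].
  have E A : [seq f A i j | i <- enum 'I_M, j <- enum 'I_M]
             = [seq f A q.1 q.2 | q <- s] by rewrite map_allpairs.
  have [sk|ks] := leqP (size s) k.
    apply: (eq_polyfun _ (polyfun_const N 0)) => A.
    by rewrite E nth_default // size_map.
  case Es: s => [|x0 s']; first by rewrite Es in ks.
  apply: (eq_polyfun _ (Hf (nth x0 s k).1 (nth x0 s k).2)) => A.
  by rewrite E (nth_map x0).
- exact: polyfun_const.
- exact: polyfunD.
- exact: polyfunM.
Qed.

Lemma polymap_comp N M K L (h : 'M[F]_M -> 'M[F]_(K, L)) (f : 'M[F]_N -> 'M[F]_M) :
  polymap h -> polymap f -> polymap (fun A => h (f A)).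
Proof. by move=> Hh Hf i j; apply: (polyfun_comp (Hh i j)). Qed.

Lemma polyfun_det_gen N M (f : 'M[F]_N -> 'M[F]_M) :
  polymap f -> polyfun (fun A => \det (f A)).
Proof.
move=> Hf.
have H : polyfun (fun A => \sum_(s : 'S_M) (-1) ^+ s * \prod_i f A i (s i)).
  apply: polyfun_sum => s; apply: polyfunM; first exact: polyfun_const.
  by apply: polyfun_prod => i; apply: Hf.
exact: (eq_polyfun _ H).
Qed.

Lemma polyfun_det N : polyfun (fun A : 'M[F]_N => \det A).
Proof. exact: polyfun_det_gen (@polymap_id N). Qed.

Lemma polymap_adj N : polymap (fun A : 'M[F]_N => \adj A).
Proof.
move=> i j.
have H : polyfun (fun A : 'M[F]_N => (-1) ^+ (j + i) * \det (row' j (col' i A))).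
  apply: polyfunM; first exact: polyfun_const.
  apply: polyfun_det_gen => k l.
  by apply: (eq_polyfun _ (polyfun_entry (lift j k) (lift i l))) => A; rewrite !mxE.
by apply: (eq_polyfun _ H) => A; rewrite mxE.
Qed.

Lemma polymap_linear N M L (f : {linear 'M[F]_N -> 'M[F]_(M, L)}) : polymap f.
Proof.
move=> i j.
have H : polyfun (fun A : 'M[F]_N => \sum_k \sum_l A k l * f (delta_mx k l) i j).
  apply: polyfun_sum => k; apply: polyfun_sum => l; apply: polyfunM.
    exact: polyfun_entry.
  exact: polyfun_const.
apply: (eq_polyfun _ H) => A; rewrite {2}(matrix_sum_delta A) linear_sum summxE.
apply: eq_bigr => k _; rewrite linear_sum summxE; apply: eq_bigr => l _.
by rewrite linearZ mxE.
Qed.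

Lemma zclosed_zeros N I (f : I -> 'M[F]_N -> F) :
  (forall i, polyfun (f i)) -> zclosed (fun A => forall i, f i A = 0).
Proof.
move=> Hf; exists (fun p => exists i, forall A, f i A = peval (mx_coord A) p) => A.
split=> [HA p [i <-] //|HA i]; have [p Hp] := Hf i.
by rewrite Hp; apply: HA; exists i.
Qed.

Lemma zclosedE N (Z : mxset F N) : zclosed Z ->
  exists S : ('M[F]_N -> F) -> Prop, (forall f, S f -> polyfun f) /\
    forall A, Z A <-> forall f, S f -> f A = 0.
Proof.
move=> [S HS].
exists (fun f => exists2 p, S p & f = fun A => peval (mx_coord A) p); split.
  by move=> f [p _ ->]; exists p.
move=> A; split=> [/HS H f [p Sp ->]|H]; first exact: H.
by apply/HS => p Sp; apply: (H (fun A => peval (mx_coord A) p)); exists p.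
Qed.

Lemma eq_zclosed N (Z Z' : mxset F N) :
  (forall A, Z A <-> Z' A) -> zclosed Z -> zclosed Z'.
Proof.
by move=> ZZ' [S HS]; exists S => A; split=> [/ZZ'/HS //|H]; apply/ZZ'/HS.
Qed.

Lemma zclosed_zero N (f : 'M[F]_N -> F) : polyfun f -> zclosed (fun A => f A = 0).
Proof.
move=> Hf; apply: (eq_zclosed _ (@zclosed_zeros N unit (fun _ => f) _)) => // A.
by split=> [/(_ tt)|].
Qed.

(** Taking as equations all polynomials that vanish on some [Z i] avoids choosing a defining system
    for each [i]. *)
Lemma zclosed_forall N I (Z : I -> mxset F N) :
  (forall i, zclosed (Z i)) -> zclosed (fun A => forall i, Z i A).
Proof.
move=> HZ.
pose S (p : pexpr F) := exists i, forall A, Z i A -> peval (mx_coord A) p = 0.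
exists S => A; split=> [HA p [i Hi]|HA i]; first exact: Hi.
have [Si HSi] := HZ i; apply/HSi => p Sp; apply: HA; exists i => B /HSi; exact.
Qed.

Lemma zclosedI N (Z1 Z2 : mxset F N) :
  zclosed Z1 -> zclosed Z2 -> zclosed (fun A => Z1 A /\ Z2 A).
Proof.
move=> H1 H2.
apply: (eq_zclosed _ (@zclosed_forall N bool (fun b => if b then Z1 else Z2) _)).
  by move=> A; split=> [H|[? ?] []//]; split; [apply: (H true) | apply: (H false)].
by case.
Qed.

Lemma zclosedU N (Z1 Z2 : mxset F N) :
  zclosed Z1 -> zclosed Z2 -> zclosed (fun A => Z1 A \/ Z2 A).
Proof.
move=> [S1 H1] [S2 H2].
exists (fun p => exists p1 p2, [/\ S1 p1, S2 p2 & p = PMul p1 p2]) => A; split.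
  move=> [/H1 H|/H2 H] p [p1 [p2 [Sp1 Sp2 ->]]] /=.
    by rewrite H // mul0r.
  by rewrite [X in _ * X]H // mulr0.
move=> H; case: (classic (Z1 A)) => [|nZ1]; first by left.
right; apply/H2 => p2 Sp2; case: (classic (peval (mx_coord A) p2 = 0)) => // n2.
case: nZ1; apply/H1 => p1 Sp1.
have /eqP := H _ (ex_intro _ p1 (ex_intro _ p2 (And3 Sp1 Sp2 erefl))).
by rewrite /= mulf_eq0 => /orP[/eqP //|/eqP].
Qed.

Lemma zclosed_preim N M (f : 'M[F]_N -> 'M[F]_M) (Z : mxset F M) :
  polymap f -> zclosed Z -> zclosed (fun A => Z (f A)).
Proof.
move=> Hf /zclosedE [S [SP HS]].
apply: (eq_zclosed _ (@zclosed_zeros N {h | S h} (fun h A => sval h (f A)) _)).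
  by move=> A; split=> [H|/HS H [h Sh] /=]; [apply/HS => h Sh; apply: (H (exist _ h Sh)) | apply: H].
by case=> h Sh /=; apply: polyfun_comp => //; apply: SP.
Qed.

Lemma zclosed_mxeq N M L (f g : 'M[F]_N -> 'M[F]_(M, L)) :
  polymap f -> polymap g -> zclosed (fun A => f A = g A).
Proof.
move=> Hf Hg.
pose h (ij : 'I_M * 'I_L) A := f A ij.1 ij.2 - g A ij.1 ij.2.
apply: (eq_zclosed _ (@zclosed_zeros N _ h _)) => [A|ij]; last exact: polyfunB.
split=> [H|fg [i j]]; last by rewrite /h fg subrr.
by apply/matrixP => i j; apply/eqP; rewrite -subr_eq0; apply/eqP/(H (i, j)).
Qed.

Lemma zclosed_SL N : zclosed (@SLset F N).
Proof.
apply: (eq_zclosed _ (@zclosed_zero N (fun A => \det A - 1) _)).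
  by move=> A; rewrite /SLset; split=> [/eqP|->]; rewrite ?subrr // subr_eq0 => /eqP.
by apply: polyfunB; [apply: polyfun_det | apply: polyfun_const].
Qed.

(** A parameter with finitely many values and closed level sets is constant on a connected set. In
    the Lie-Kolchin argument the parameter is an eigenvalue or a root of unity. *)
Lemma zconnected_partition N (X : mxset F N) (T : eqType) (s : seq T)
    (Z : T -> mxset F N) (A0 : 'M[F]_N) (i0 : T) :
  zconnected X -> (forall i, zclosed (Z i)) ->
  (forall A, X A -> exists2 i, i \in s & Z i A) ->
  (forall A i j, X A -> Z i A -> Z j A -> i = j) ->
  X A0 -> Z i0 A0 -> forall A, X A -> Z i0 A.
Proof.
move=> cX cZ cov disj XA0 ZA0.
pose U (r : seq T) A := exists2 i, i \in r & Z i A.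
have cU r : zclosed (U r).
  elim: r => [|i r IH].
    apply: (eq_zclosed _ (@zclosed_zero N (fun=> 1) (polyfun_const N 1))) => A.
    by split=> [/eqP|[i]]; rewrite ?oner_eq0.
  apply: (eq_zclosed _ (zclosedU (cZ i) IH)) => A; split.
    move=> [ZiA|[j jr ZjA]]; first by exists i; rewrite ?mem_head.
    by exists j => //; rewrite inE jr orbT.
  move=> [j]; rewrite inE => /orP[/eqP -> ?|jr ZjA]; first by left.
  by right; exists j.
pose r := [seq i <- s | i != i0].
have [] := cX _ _ (cZ i0) (cU r).
- move=> A XA; have [i si ZiA] := cov A XA; case: (eqVneq i i0) => [<-|ii0].
    by left.
  by right; exists i; rewrite // mem_filter ii0.
- move=> A XA Z0A [i]; rewrite mem_filter => /andP[/eqP ni0 _] ZiA.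
  by apply: ni0; apply: (disj A).
- by [].
- move/(_ A0 XA0) => [i]; rewrite mem_filter => /andP[/eqP ni0 _] ZiA.
  by case: ni0; apply: (disj A0).
Qed.

(* [B] lies in the quasi-component of [A] in [X]. *)
Definition joined N (X : mxset F N) (A B : 'M[F]_N) : Prop :=
  [/\ X A, X B & forall Z1 Z2 : mxset F N, zclosed Z1 -> zclosed Z2 ->
    (forall C, X C -> Z1 C \/ Z2 C) -> (forall C, X C -> Z1 C -> Z2 C -> False) ->
    Z1 A -> Z1 B].

(** Inside [X] the two closed sets are complementary, so their roles can be exchanged. *)
Lemma joined_sym N (X : mxset F N) A B : joined X A B -> joined X B A.
Proof.
move=> [XA XB H]; split=> // Z1 Z2 c1 c2 cov disj Z1B.
have [//|Z2A] := cov A XA; case: (disj B XB Z1B).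
by apply: (H Z2 Z1) => // [C /cov [] | C XC ZC2 ZC1]; [right|left|exact: (disj C)].
Qed.

Lemma joined_trans N (X : mxset F N) B A C :
  joined X A B -> joined X B C -> joined X A C.
Proof.
move=> [XA XB H] [_ XC H']; split=> // Z1 Z2 c1 c2 cov disj Z1A.
exact/(H' Z1 Z2)/(H Z1 Z2).
Qed.

Lemma joined_polymap N M (X : mxset F N) (Y : mxset F M) f A B :
  polymap f -> (forall C, X C -> Y (f C)) -> joined X A B -> joined Y (f A) (f B).
Proof.
move=> Hf XY [XA XB H]; split; [exact: XY|exact: XY|] => Z1 Z2 c1 c2 cov disj Z1A.
apply: (H (fun C => Z1 (f C)) (fun C => Z2 (f C))) => //; try exact: zclosed_preim.
  by move=> C /XY /cov.
by move=> C /XY; apply: disj.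
Qed.

Lemma joined_sub N (X Y : mxset F N) A B :
  (forall C, X C -> Y C) -> joined X A B -> joined Y A B.
Proof. by move=> XY; apply: (joined_polymap (@polymap_id N)). Qed.

Lemma zconnected_joined N (X : mxset F N) A0 :
  (forall A, X A -> joined X A0 A) -> zconnected X.
Proof.
move=> H Z1 Z2 c1 c2 cov disj.
case: (classic (X A0)) => [XA0|nX]; last first.
  by left=> A /H [].
case: (cov _ XA0) => ZA0; [left|right] => A XA; have [_ _ J] := H A XA.
  exact: (J Z1 Z2).
by apply: (J Z2 Z1) => // [C /cov [] | C XC ZC2 ZC1]; [right|left|exact: (disj C)].
Qed.

(* Away from the zeros of [g], [f] is a polynomial divided by a power of [g]. *)
Definition ratl (g : {poly F}) (f : F -> F) : Prop :=
  exists k (p : {poly F}), forall t, g.[t] != 0 -> f t * g.[t] ^+ k = p.[t].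

Definition mxratl N (g : {poly F}) (c : F -> 'M[F]_N) : Prop :=
  forall i j, ratl g (fun t => c t i j).

Lemma eq_ratl g (f f' : F -> F) : f =1 f' -> ratl g f -> ratl g f'.
Proof. by move=> ff' [k [p H]]; exists k, p => t gt; rewrite -ff' H. Qed.

Lemma ratl_horner g (p : {poly F}) : ratl g (fun t => p.[t]).
Proof. by exists 0, p => t _; rewrite expr0 mulr1. Qed.

Lemma ratl_const g (c : F) : ratl g (fun=> c).
Proof. by exists 0, c%:P => t _; rewrite expr0 mulr1 hornerC. Qed.

Lemma ratl_var g : ratl g id.
Proof. by apply: (eq_ratl _ (ratl_horner g 'X)) => t; rewrite hornerX. Qed.

Lemma ratlD g (f f' : F -> F) : ratl g f -> ratl g f' -> ratl g (fun t => f t + f' t).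
Proof.
move=> [k [p H]] [k' [p' H']]; exists (k + k')%N, (p * g ^+ k' + p' * g ^+ k) => t gt.
by rewrite !hornerE -H // -H' // exprD; ring.
Qed.

Lemma ratlM g (f f' : F -> F) : ratl g f -> ratl g f' -> ratl g (fun t => f t * f' t).
Proof.
move=> [k [p H]] [k' [p' H']]; exists (k + k')%N, (p * p') => t gt.
by rewrite !hornerE -H // -H' // exprD; ring.
Qed.

Lemma ratlX g (f : F -> F) n : ratl g f -> ratl g (fun t => f t ^+ n).
Proof.
move=> Hf; elim: n => [|n IH]; first exact: (eq_ratl _ (ratl_const g 1)).
by apply: (eq_ratl _ (ratlM Hf IH)) => t; rewrite exprS.
Qed.

Lemma ratl_sum g I (r : seq I) (f : I -> F -> F) :
  (forall i, ratl g (f i)) -> ratl g (fun t => \sum_(i <- r) f i t).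
Proof.
move=> Hf; elim: r => [|i r IH].
  by apply: (eq_ratl _ (ratl_const g 0)) => t; rewrite big_nil.
by apply: (eq_ratl _ (ratlD (Hf i) IH)) => t; rewrite big_cons.
Qed.

(** Divisors of [g] are allowed so that a curve with several denominators can use their product as
    [g]. *)
Lemma ratl_inv g (q : {poly F}) : q %| g -> ratl g (fun t => q.[t]^-1).
Proof.
move=> qg; exists 1, (g %/ q) => t; rewrite -{1 2}(divpK qg) hornerM mulf_eq0 negb_or.
by move=> /andP[_ q0]; rewrite expr1 mulrCA mulVf // mulr1.
Qed.

Lemma mxratl_const N g (A : 'M[F]_N) : mxratl g (fun=> A).
Proof. by move=> i j; apply: ratl_const. Qed.

Lemma mxratlD N g (c c' : F -> 'M[F]_N) :
  mxratl g c -> mxratl g c' -> mxratl g (fun t => c t + c' t).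
Proof.
by move=> H H' i j; apply: (eq_ratl _ (ratlD (H i j) (H' i j))) => t; rewrite mxE.
Qed.

Lemma mxratlZ N g f (c : F -> 'M[F]_N) :
  ratl g f -> mxratl g c -> mxratl g (fun t => f t *: c t).
Proof. by move=> H H' i j; apply: (eq_ratl _ (ratlM H (H' i j))) => t; rewrite mxE. Qed.

Lemma mxratlM N g (c c' : F -> 'M[F]_N) :
  mxratl g c -> mxratl g c' -> mxratl g (fun t => c t *m c' t).
Proof.
move=> H H' i j.
have R := @ratl_sum g 'I_N (index_enum _) _ (fun k => ratlM (H i k) (H' k j)).
by apply: (eq_ratl _ R) => t; rewrite mxE.
Qed.

Lemma ratl_polyfun N g (h : 'M[F]_N -> F) (c : F -> 'M[F]_N) :
  polyfun h -> mxratl g c -> ratl g (fun t => h (c t)).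
Proof.
move=> [p Hp] Hc.
suff H : ratl g (fun t => peval (mx_coord (c t)) p).
  by apply: (eq_ratl _ H) => t; rewrite Hp.
elim: p {Hp h} => [k|a|p IHp q IHq|p IHp q IHq] /=.
- rewrite /mx_coord.
  pose s := [seq (i, j) | i <- enum 'I_N, j <- enum 'I_N].
  have E t : [seq c t i j | i <- enum 'I_N, j <- enum 'I_N]
             = [seq c t q.1 q.2 | q <- s] by rewrite map_allpairs.
  have [sk|ks] := leqP (size s) k.
    apply: (eq_ratl _ (ratl_const g 0)) => t.
    by rewrite E nth_default // size_map.
  case Es: s => [|x0 s']; first by rewrite Es in ks.
  apply: (eq_ratl _ (Hc (nth x0 s k).1 (nth x0 s k).2)) => t.
  by rewrite E (nth_map x0).
- exact: ratl_const.
- exact: ratlD.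
- exact: ratlM.
Qed.

Lemma mxratl_polymap N M g (h : 'M[F]_N -> 'M[F]_M) (c : F -> 'M[F]_N) :
  polymap h -> mxratl g c -> mxratl g (fun t => h (c t)).
Proof. by move=> Hh Hc i j; apply: (ratl_polyfun (Hh i j)). Qed.

Lemma ratl1_poly (f : F -> F) : ratl 1 f -> exists p : {poly F}, forall t, f t = p.[t].
Proof.
move=> [k [p H]]; exists p => t.
by rewrite -H ?hornerC ?oner_eq0 // expr1n mulr1.
Qed.

End Polynomial.

(** * Irreducibility of the line minus finitely many points *)

Section Curve.
Variable F : closedFieldType.

Lemma horner_eq0 (p : {poly F}) : (forall t, p.[t] = 0) -> p = 0.
Proof.
move=> H; apply/eqP/negP => /negP p0.
(* If [p] is nonzero, this polynomial is not constant and has a root, but it takes the value 1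
   wherever [p] vanishes. *)
have /closed_rootP [t] : size (p * 'X + 1) != 1.
  rewrite size_polyDl ?size_mulX ?size_poly1 ?ltnS ?size_poly_gt0 //.
  by rewrite eqSS size_poly_eq0.
by rewrite /root !hornerE H mul0r add0r oner_eq0.
Qed.

Lemma ratl_mul_eq0 (g : {poly F}) (f f' : F -> F) : g != 0 -> ratl g f -> ratl g f' ->
  (forall t, g.[t] != 0 -> f t * f' t = 0) ->
  (forall t, g.[t] != 0 -> f t = 0) \/ (forall t, g.[t] != 0 -> f' t = 0).
Proof.
move=> g0 [k [p H]] [k' [p' H']] ff'.
(* The factor [g] takes care of the points where nothing is known about [f] and [f']. *)
have : p * p' * g == 0.
  apply/eqP/horner_eq0 => t; rewrite !hornerE.
  have [->|gt] := eqVneq g.[t] 0; first by rewrite mulr0.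
  rewrite -H // -H' //.
  have -> : f t * g.[t] ^+ k * (f' t * g.[t] ^+ k') * g.[t]
    = f t * f' t * (g.[t] ^+ k * g.[t] ^+ k' * g.[t]) by ring.
  by rewrite ff' // mul0r.
rewrite mulf_eq0 (negPf g0) orbF mulf_eq0 => /orP[] /eqP p0; [left|right] => t gt.
  by have /eqP := H t gt; rewrite p0 horner0 mulf_eq0 expf_eq0 (negPf gt) andbF orbF => /eqP.
by have /eqP := H' t gt; rewrite p0 horner0 mulf_eq0 expf_eq0 (negPf gt) andbF orbF => /eqP.
Qed.

(** If an equation [h1] of [Z1] fails at [c t], then for every equation [h2] of [Z2] the product of
    [h1] and [h2] vanishes along the curve; by irreducibility [h2] vanishes along it, so [c s] lies
    in both sets. *)
Lemma joined_curve N (X : mxset F N) (g : {poly F}) (c : F -> 'M[F]_N) s t :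
  mxratl g c -> (forall u, g.[u] != 0 -> X (c u)) ->
  g.[s] != 0 -> g.[t] != 0 -> joined X (c s) (c t).
Proof.
move=> Hc Xc gs gt; split; [exact: Xc|exact: Xc|] => Z1 Z2 c1 c2 cov disj Z1s.
have [//|Z2t] := cov _ (Xc _ gt).
have [S1 [P1 E1]] := zclosedE c1; have [S2 [P2 E2]] := zclosedE c2.
apply/E1 => h1 Sh1; case: (classic (h1 (c t) = 0)) => // h1t.
case: (disj _ (Xc _ gs)) => //; apply/E2 => h2 Sh2.
have g0 : g != 0 by apply: contraNneq gs => ->; rewrite horner0.
have R1 := ratl_polyfun (P1 _ Sh1) Hc; have R2 := ratl_polyfun (P2 _ Sh2) Hc.
have [u gu||] := ratl_mul_eq0 g0 R1 R2; last by move/(_ s gs).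
- have [/E1 -> //|/E2 H] := cov _ (Xc _ gu); first by rewrite mul0r.
  by rewrite [X in _ * X]H ?mulr0.
- by move/(_ t gt).
Qed.

End Curve.

(** * Lower triangular matrices *)

Section Triangular.
Variable F : fieldType.

(** Two block triangular factorisations of the same matrix have the same determinant. *)
Lemma det_rank1 N (v : 'cV[F]_N) (w : 'rV[F]_N) :
  \det (1%:M + v *m w) = 1 + (w *m v) 0 0.
Proof.
have E1 : block_mx 1%:M (- v) w (1%:M : 'M_1) =
    block_mx 1%:M 0 w 1%:M *m block_mx 1%:M (- v) 0 (1%:M + w *m v).
  rewrite mulmx_block !(mul1mx, mul0mx, mulmx0, mulmx1, addr0) mulmxN.
  by rewrite addrC addrK.
have E2 : block_mx 1%:M (- v) w (1%:M : 'M_1) =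
    block_mx (1%:M + v *m w) (- v) 0 1%:M *m block_mx 1%:M 0 w 1%:M.
  rewrite mulmx_block !(mul1mx, mul0mx, mulmx0, mulmx1, add0r) mulNmx.
  by rewrite addrK.
have := E1; rewrite E2 => /(congr1 determinant).
rewrite !det_mulmx !det_ublock !det_lblock !det1 !mulr1 !mul1r => ->.
by rewrite det_mx11 !mxE eqxx.
Qed.

(** Interpolates between no condition ([k = 0]) and lower triangular ([k = N]), for the row by row
    triangularisation in a parabolic subgroup. *)
Definition lowk N k (A : 'M[F]_N) : Prop :=
  forall i j : 'I_N, (i < k)%N -> (i < j)%N -> A i j = 0.

Definition low N := @lowk N N.

Lemma lowP N (A : 'M[F]_N) : low A <-> forall i j : 'I_N, (i < j)%N -> A i j = 0.
Proof. by split=> H i j; [apply: H | move=> _; apply: H]. Qed.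

Section Algebra.
Variables N k : nat.
Implicit Types A B : 'M[F]_N.

Lemma lowk_scalar (c : F) : lowk k (c%:M : 'M_N).
Proof. by move=> i j _ ij; rewrite mxE -val_eqE /= ltn_eqF // mulr0n. Qed.

Lemma lowkD A B : lowk k A -> lowk k B -> lowk k (A + B).
Proof. by move=> HA HB i j ik ij; rewrite mxE HA ?HB ?addr0. Qed.

Lemma lowkZ c A : lowk k A -> lowk k (c *: A).
Proof. by move=> HA i j ik ij; rewrite mxE HA ?mulr0. Qed.

Lemma lowkN A : lowk k A -> lowk k (- A).
Proof. by move=> HA; rewrite -scaleN1r; apply: lowkZ. Qed.

Lemma lowkB A B : lowk k A -> lowk k B -> lowk k (A - B).
Proof. by move=> HA HB; apply: lowkD => //; apply: lowkN. Qed.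

Lemma lowkM A B : lowk k A -> lowk k B -> lowk k (A *m B).
Proof.
move=> HA HB i j ik ij; rewrite mxE big1 // => l _.
have [il|li] := ltnP i l; first by rewrite HA ?mul0r.
by rewrite HB ?mulr0 ?(leq_ltn_trans li).
Qed.

Lemma lowk_inv A : A \in unitmx -> lowk k A -> lowk k (invmx A).
Proof.
move=> uA HA; set B := invmx A.
suff H n : forall i j : 'I_N, i = n :> nat -> (i < k)%N -> (i < j)%N -> B i j = 0.
  by move=> i j; apply: (H i).
elim/ltn_ind: n => n IH i j Ei ik ij.
(* Terms after the diagonal vanish by triangularity of row [i] of [A], terms before it by induction
   on the rows of [B]. At [l = i] this shows that the diagonal entry of [A] is nonzero. *)
have E (l : 'I_N) : (i <= l)%N -> (A *m B) i l = A i i * B i l.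
  move=> il; rewrite mxE (bigD1 i) //= big1 ?addr0 // => m mi.
  have [im|im|/val_inj Em] := ltngtP i m; last by rewrite Em eqxx in mi.
    by rewrite HA ?mul0r.
  by rewrite (IH m) ?mulr0 ?(leq_trans im il) ?(ltn_trans im ik) -?Ei.
have := E i (leqnn _); have := E j (ltnW ij); rewrite mulmxV // !mxE eqxx.
rewrite -val_eqE /= (ltn_eqF ij) => H0 H1.
have /eqP := esym H0; rewrite mulf_eq0 => /orP[/eqP A0|/eqP //].
by move/eqP: H1; rewrite A0 mul0r oner_eq0.
Qed.

End Algebra.

Lemma low_lowk N k (A : 'M[F]_N) : low A -> lowk k A.
Proof. by move=> /lowP HA i j _; apply: HA. Qed.

Lemma low_det N (A : 'M[F]_N) : low A -> \det A = \prod_i A i i.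
Proof. by move=> /lowP HA; apply: det_trig; apply/is_trig_mxP. Qed.

Lemma low_mul_diag N (A B : 'M[F]_N) i : low A -> low B -> (A *m B) i i = A i i * B i i.
Proof.
move=> /lowP HA /lowP HB; rewrite mxE (bigD1 i) //= big1 ?addr0 // => m mi.
have [im|im|/val_inj Em] := ltngtP i m; last by rewrite Em eqxx in mi.
  by rewrite HA ?mul0r.
by rewrite HB ?mulr0.
Qed.

Definition lowSL N : mxset F N := fun A => low A /\ \det A = 1.

Definition conjset N (g : 'M[F]_N) (X : mxset F N) : mxset F N :=
  fun A => X (g *m A *m invmx g).

Lemma unitmx_neq0 N (A : 'M[F]_N) : (0 < N)%N -> A \in unitmx -> A != 0.
Proof.
by case: N A => // N A _; apply: contraTneq => ->; rewrite unitmxE det0 unitr0.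
Qed.

Lemma det1_unit N (A : 'M[F]_N) : \det A = 1 -> A \in unitmx.
Proof. by move=> dA; rewrite unitmxE dA unitr1. Qed.

Lemma det1_invE N (A : 'M[F]_N) : \det A = 1 -> invmx A = \adj A.
Proof. by move=> dA; rewrite /invmx det1_unit // dA invr1 scale1r. Qed.

Lemma invmxM N (A B : 'M[F]_N) : A \in unitmx -> B \in unitmx ->
  invmx (A *m B) = invmx B *m invmx A.
Proof.
move=> uA uB; have uAB : A *m B \in unitmx by rewrite unitmx_mul uA.
apply: (can_inj (mulKmx uAB)); rewrite mulmxV // mulmxA -[A *m B *m _]mulmxA.
by rewrite mulmxV // mulmx1 mulmxV.
Qed.

Lemma conj_mul N (g A B : 'M[F]_N) : g \in unitmx ->
  g *m (A *m B) *m invmx g = g *m A *m invmx g *m (g *m B *m invmx g).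
Proof. by move=> ug; rewrite !mulmxA mulmxKV. Qed.

Lemma conj1 N (g : 'M[F]_N) : g \in unitmx -> g *m 1%:M *m invmx g = 1%:M.
Proof. by move=> ug; rewrite mulmx1 mulmxV. Qed.

Lemma conj_inv N (g A : 'M[F]_N) : g \in unitmx ->
  g *m invmx A *m invmx g = invmx (g *m A *m invmx g).
Proof.
move=> ug; case uA : (A \in unitmx).
  by rewrite !invmxM ?unitmx_inv ?unitmx_mul ?ug // invmxK mulmxA.
rewrite [invmx A]invmx_out ?inE ?uA // [RHS]invmx_out //.
by rewrite inE !unitmx_mul uA andbF.
Qed.

Lemma conj_det N (g A : 'M[F]_N) : g \in unitmx -> \det (g *m A *m invmx g) = \det A.
Proof.
move=> ug; rewrite !det_mulmx det_inv mulrAC mulfV ?mul1r //.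
by rewrite -unitfE -unitmxE.
Qed.

Lemma conjV_det N (g A : 'M[F]_N) : g \in unitmx -> \det (invmx g *m A *m g) = \det A.
Proof. by move=> ug; rewrite -{2}(invmxK g) conj_det // unitmx_inv. Qed.

Lemma conjK N (g A : 'M[F]_N) : g \in unitmx ->
  g *m (invmx g *m A *m g) *m invmx g = A.
Proof. by move=> ug; rewrite !mulmxA mulmxV // mul1mx mulmxK. Qed.

Lemma conjVK N (g A : 'M[F]_N) : g \in unitmx ->
  invmx g *m (g *m A *m invmx g) *m g = A.
Proof. by move=> ug; rewrite !mulmxA mulVmx // mul1mx mulmxKV. Qed.

Lemma polymap_conj N (g h : 'M[F]_N) : polymap (fun A : 'M[F]_N => g *m A *m h).
Proof.
apply: polymapM; last exact: polymap_const.
by apply: polymapM; [exact: polymap_const | exact: polymap_id].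
Qed.

Lemma lowSL_group N : is_group (@lowSL N).
Proof.
split.
- by split; [exact: lowk_scalar | rewrite det1].
- move=> A B [lA dA] [lB dB]; split; first exact: lowkM.
  by rewrite det_mulmx dA dB mulr1.
- move=> A [lA dA]; split; first by apply: lowk_inv => //; apply: det1_unit.
  by rewrite det_inv dA invr1.
Qed.

Lemma zclosed_lowk N k : zclosed (@lowk N k).
Proof.
apply: zclosed_forall => i; apply: zclosed_forall => j.
apply: zclosed_forall => _; apply: zclosed_forall => _.
exact/zclosed_zero/polyfun_entry.
Qed.

Lemma zclosed_lowSL N : zclosed (@lowSL N).
Proof. by apply: zclosedI; [apply: zclosed_lowk | apply: zclosed_SL]. Qed.

Lemma conjset_closed_subgroup N g (X : mxset F N) : g \in unitmx ->
  closed_subgroup X -> closed_subgroup (conjset g X).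
Proof.
move=> ug [XSL [X1 XM XV] cX]; split.
- by move=> A /XSL; rewrite /SLset conj_det.
- rewrite /conjset; split; first by rewrite conj1.
    by move=> A B XA XB; rewrite conj_mul //; apply: XM.
  by move=> A XA; rewrite conj_inv //; apply: XV.
- apply: zclosed_preim => //; exact: polymap_conj.
Qed.

Lemma lowSL_closed_subgroup N : closed_subgroup (@lowSL N).
Proof. by split; [move=> A [] | exact: lowSL_group | exact: zclosed_lowSL]. Qed.

(* [lowdist 0] is the group of lower triangular matrices; for [k > 0] the
   matrix agrees with the identity above its [k]-th subdiagonal. *)
Definition lowdist N k (A : 'M[F]_N) : Prop :=
  [/\ A \in unitmx, low A &
    (0 < k)%N -> forall i j : 'I_N, (i < j + k)%N -> A i j = (i == j)%:R].

Lemma lowdist_group N k : is_group (@lowdist N k).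
Proof.
split.
- split; [exact: unitmx1 | exact: lowk_scalar | by move=> _ i j _; rewrite mxE].
- move=> A B [uA lA dA] [uB lB dB].
  split; [by rewrite unitmx_mul uA | exact: lowkM|] => k0 i j ijk.
  rewrite mxE (bigD1 i) //= dB // big1 ?addr0.
    by rewrite dA ?eqxx ?mul1r // -[X in (X < _)%N]addn0 ltn_add2l.
  move=> l li; have [il|il] := ltnP i (l + k); first by rewrite dA // eq_sym (negPf li) mul0r.
  have lj : (l < j)%N by rewrite -(ltn_add2r k) (leq_ltn_trans il).
  by rewrite (low_lowk lB (k := N)) ?mulr0.
- move=> A [uA lA dA].
  split; [by rewrite unitmx_inv | exact: lowk_inv|] => k0 i j ijk.
  have lV := lowk_inv uA lA.
  have : (invmx A *m (A - 1%:M)) i j = 0.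
    rewrite mxE big1 // => l _; have [il|li] := ltnP i l; first by rewrite lV ?mul0r.
    by rewrite !mxE dA ?subrr ?mulr0 // (leq_ltn_trans li).
  rewrite mulmxBr mulVmx // mulmx1 !mxE => /eqP.
  by rewrite subr_eq0 => /eqP <-.
Qed.

(** The commutator minus 1 is A^-1 B^-1 (AB - BA). For [k = 0] the diagonals of AB and BA agree; for
    [k > 0], AB - BA is the bracket of A - 1 and B - 1, which starts at subdiagonal 2k. *)
Lemma lowdist_commutator N k (A B : 'M[F]_N) :
  lowdist k A -> lowdist k B -> lowdist k.+1 (commutator A B).
Proof.
move=> [uA lA dA] [uB lB dB]; rewrite /commutator.
have lAV := lowk_inv uA lA; have lBV := lowk_inv uB lB.
split.
- by rewrite !unitmx_mul !unitmx_inv uA uB.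
- by apply: lowkM => //; apply: lowkM => //; apply: lowkM.
move=> _ i j ijk.
have D (l : 'I_N) : (l < j + k.+1)%N -> (A *m B - B *m A) l j = 0.
  case: k => [|k] in dA dB ijk *.
    rewrite addn1 ltnS leq_eqVlt => /orP[/eqP/val_inj ->|lj].
      by rewrite mxE [X in _ + X]mxE !low_mul_diag // mulrC subrr.
    by rewrite (lowkB (lowkM lA lB) (lowkM lB lA)).
  move=> lk.
  have -> : A *m B - B *m A =
      (A - 1%:M) *m (B - 1%:M) - (B - 1%:M) *m (A - 1%:M).
    rewrite !mulmxBl !mulmxBr !mulmx1 !mul1mx !opprB.
    by mxabel.
  have Z (C D : 'M[F]_N) :
      (forall i j : 'I_N, (i < j + k.+1)%N -> C i j = (i == j)%:R) ->
      (forall i j : 'I_N, (i < j + k.+1)%N -> D i j = (i == j)%:R) ->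
      ((C - 1%:M) *m (D - 1%:M)) l j = 0.
    move=> HC HD; rewrite mxE big1 // => m _; rewrite !mxE.
    have [lm|ml] := ltnP l (m + k.+1); first by rewrite HC ?subrr ?mul0r.
    have mj : (m < j + k.+1)%N.
      rewrite -(ltn_add2r k.+1) (leq_ltn_trans ml) // (leq_trans lk) //.
      by rewrite -addnA leq_add2l addSn addnS !ltnS leq_addl.
    by rewrite HD ?subrr ?mulr0.
  by rewrite mxE [X in _ + X]mxE !Z ?subrr //; [exact: dB|exact: dA|exact: dA|exact: dB].
have : (invmx A *m invmx B *m (A *m B - B *m A)) i j = 0.
  rewrite mxE big1 // => l _; have [il|li] := ltnP i l.
    by rewrite (lowkM lAV lBV) ?mul0r.
  by rewrite D ?mulr0 // (leq_ltn_trans li).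
rewrite mulmxBr !mulmxA -[_ *m invmx B *m B]mulmxA mulVmx // mulmx1 mulVmx //.
by rewrite !mxE => /eqP; rewrite subr_eq0 => /eqP.
Qed.

Lemma conj_commutator N (g A B : 'M[F]_N) : g \in unitmx ->
  g *m commutator A B *m invmx g =
  commutator (g *m A *m invmx g) (g *m B *m invmx g).
Proof. by move=> ug; rewrite /commutator -!conj_inv // !conj_mul. Qed.

Lemma lowSL_solvable N (g : 'M[F]_N) : g \in unitmx -> solvable_set (conjset g (@lowSL N)).
Proof.
(* At depth [N.+1] the range [i < j + N.+1] prescribed by [lowdist] contains all entries. *)
move=> ug; exists N.+1 => A.
have H k : forall A, dseries k (conjset g (@lowSL N)) A -> lowdist k (g *m A *m invmx g).
  elim: k => [|k IH] {}A /=; first by move=> [lA dA]; split=> //; apply: det1_unit.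
  move/(_ (fun A => lowdist k.+1 (g *m A *m invmx g))); apply.
    have [H1 HM HV] := lowdist_group N k.+1; split.
    - by rewrite conj1.
    - by move=> B C HB HC; rewrite conj_mul //; apply: HM.
    - by move=> B HB; rewrite conj_inv //; apply: HV.
  by move=> _ [B [C [/IH HB /IH HC ->]]]; rewrite conj_commutator //; apply: lowdist_commutator.
move=> /H [_ _ /(_ isT) HA].
have E : g *m A *m invmx g = 1%:M.
  apply/matrixP => i j; rewrite HA ?mxE //.
  by rewrite (leq_trans (ltn_ord i)) // addnS ltnW // ltnS leq_addl.
by rewrite -(conjVK A ug) E mulmx1 mulVmx.
Qed.

Lemma low_transvection N (i j : 'I_N) (c : F) : (j < i)%N ->
  lowSL (1%:M + c *: delta_mx i j).
Proof.
move=> ji; split.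
  apply: lowkD; first exact: lowk_scalar.
  apply: lowkZ => a b _ ab; rewrite mxE.
  case: eqP => [Ea|//]; case: eqP => [Eb|] //=; rewrite Ea Eb in ab.
  by move: (ltn_trans ab ji); rewrite ltnn.
have -> : c *: delta_mx i j = (c *: delta_mx i 0) *m (delta_mx 0 j : 'M_(1, N)).
  by rewrite -scalemxAl mul_delta_mx.
rewrite det_rank1 -scalemxAr mul_delta_mx_cond.
by rewrite (ltn_eqF ji : (j == i) = false) mulr0n scaler0 mxE addr0.
Qed.

Lemma pid_mulE N k (A : 'M[F]_N) i j :
  ((pid_mx k : 'M_N) *m A) i j = if (i < k)%N then A i j else 0.
Proof.
rewrite mxE (bigD1 i) //= big1 ?addr0.
  by rewrite mxE eqxx /=; case: ifP; rewrite ?mul1r ?mul0r.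
by move=> l li; rewrite mxE val_eqE eq_sym (negPf li) mul0r.
Qed.

Lemma mul_pidE m N k (A : 'M[F]_(m, N)) i j :
  (A *m (pid_mx k : 'M_N)) i j = if (j < k)%N then A i j else 0.
Proof.
rewrite mxE (bigD1 j) //= big1 ?addr0.
  by rewrite mxE eqxx /=; case: ifP; rewrite ?mulr1 ?mulr0.
by move=> l lj; rewrite mxE val_eqE (negPf lj) mulr0.
Qed.

Lemma sub_pidP m N k (A : 'M[F]_(m, N)) :
  (A <= (pid_mx k : 'M_N))%MS <-> forall i (j : 'I_N), (k <= j)%N -> A i j = 0.
Proof.
split=> [/submxP[D ->] i j kj|H]; first by rewrite mul_pidE ltnNge kj.
apply/submxP; exists A; apply/matrixP => i j; rewrite mul_pidE.
by case: ltnP => // kj; rewrite H.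
Qed.

(** Matrices act on row vectors from the right, so lower triangular matrices stabilise the spans V_k
    of the first [k] basis vectors. *)
Lemma low_stable N k (A : 'M[F]_N) : low A -> stablemx (pid_mx k : 'M_N) A.
Proof.
move=> /lowP lA; apply/sub_pidP => i j kj; rewrite pid_mulE.
by case: ltnP => // ik; rewrite lA // (leq_trans ik).
Qed.

Lemma stable_transvection m N (W : 'M[F]_(m, N)) (v : 'rV_N) (j k : 'I_N) :
  (forall t, lowSL t -> stablemx W t) -> (v <= W)%MS -> v 0 j != 0 -> (k < j)%N ->
  ((delta_mx 0 k : 'rV_N) <= W)%MS.
Proof.
move=> sW vW vj kj.
have vt : (v *m (1%:M + 1 *: delta_mx j k) <= W)%MS.
  exact: submx_trans (submxMr _ vW) (sW _ (low_transvection 1 kj)).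
have : (v *m (1%:M + 1 *: delta_mx j k) - v <= W)%MS.
  by rewrite addmx_sub // eqmx_opp.
have -> : v *m (1%:M + 1 *: delta_mx j k) - v = v 0 j *: delta_mx 0 k.
  rewrite scale1r mulmxDr mulmx1 addrC addKr; apply/rowP => l; rewrite !mxE.
  rewrite (bigD1 j) //= big1 ?addr0 => [|i ij]; first by rewrite !mxE eqxx.
  by rewrite !mxE (negPf ij) mulr0.
by rewrite eqmx_scale.
Qed.

Lemma last_nz N (v : 'rV[F]_N) : v != 0 ->
  exists2 j : 'I_N, v 0 j != 0 & forall l : 'I_N, (j < l)%N -> v 0 l = 0.
Proof.
move=> v0; have [j0 vj0] : exists j, v 0 j != 0.
  by apply/existsP; apply: contraNT v0 => /existsPn H; apply/eqP/rowP => j; rewrite mxE; have /negbNE/eqP := H j.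
case: (@arg_maxnP _ j0 (fun j => v 0 j != 0) (@nat_of_ord N) vj0) => j vj jmax.
by exists j => // l jl; apply/eqP/negP => /negP /jmax lj; move: (leq_ltn_trans lj jl); rewrite ltnn.
Qed.

(** Transvections applied to [v] produce the basis vectors before [j]; removing them from [v] leaves
    a nonzero multiple of the [j]-th one. *)
Lemma stable_contains_flag m N (W : 'M[F]_(m, N)) (v : 'rV_N) (j : 'I_N) :
  (forall t, lowSL t -> stablemx W t) -> (v <= W)%MS -> v 0 j != 0 ->
  (forall l : 'I_N, (j < l)%N -> v 0 l = 0) -> ((pid_mx j.+1 : 'M_N) <= W)%MS.
Proof.
move=> sW vW vj vl; have ek (k : 'I_N) : (k < j)%N -> ((delta_mx 0 k : 'rV_N) <= W)%MS.
  exact: stable_transvection vW vj.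
have ej : ((delta_mx 0 j : 'rV_N) <= W)%MS.
  rewrite -(eqmx_scale _ vj).
  have -> : v 0 j *: delta_mx 0 j = v - \sum_(k | k != j) v 0 k *: delta_mx 0 k.
    by rewrite {2}(row_sum_delta v) (bigD1 j) //= addrK.
  rewrite addmx_sub // eqmx_opp summx_sub // => k kj.
  have [jk|kj'|/val_inj Ek] := ltngtP j k; last by rewrite Ek eqxx in kj.
    by rewrite vl // scale0r sub0mx.
  by rewrite scalemx_sub ?ek.
apply/row_subP => i; have [ij|ji] := leqP i j.
  have -> : row i (pid_mx j.+1 : 'M_N) = delta_mx 0 i :> 'rV[F]_N.
    by apply/rowP => l; rewrite !mxE ltnS ij andbT eqxx eq_sym val_eqE.
  by move: ij; rewrite leq_eqVlt => /orP[/eqP/val_inj ->|/ek].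
have -> : row i (pid_mx j.+1 : 'M_N) = 0 :> 'rV[F]_N.
  by apply/rowP => l; rewrite !mxE ltnS leqNgt ji andbF.
exact: sub0mx.
Qed.

(** A row whose last nonzero coordinate is [j] forces V_(j+1) into [W], hence [j] is less than the
    rank. So the stable subspaces are the members of the standard flag. *)
Lemma stable_rank_flag m N (W : 'M[F]_(m, N)) :
  (forall t, lowSL t -> stablemx W t) -> (W <= (pid_mx (\rank W) : 'M_N))%MS.
Proof.
move=> sW; apply/row_subP => i.
have [->|r0] := eqVneq (row i W) 0; first exact: sub0mx.
have [j vj vl] := last_nz r0.
have jW := stable_contains_flag sW (row_sub i W) vj vl.
have jr : (j < \rank W)%N.
  by have := mxrankS jW; rewrite rank_pid_mx.
apply/sub_pidP => a l rl; rewrite ord1 vl //; exact: leq_trans jr rl.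
Qed.

(** The image of a member of the flag under [x] is again stable and has the same dimension, hence is
    the same member. This gives the maximality of the triangular group among connected solvable
    groups. *)
Lemma lowSL_normalizer N (x : 'M[F]_N) : x \in unitmx ->
  (forall t, lowSL t -> lowSL (x *m t *m invmx x)) -> low x.
Proof.
move=> ux Hx; apply/lowP => i j ij.
pose W := (pid_mx i.+1 : 'M_N) *m x.
have sW t : lowSL t -> stablemx W t.
  move=> Tt; rewrite /W -mulmxA.
  have -> : x *m t = x *m t *m invmx x *m x by rewrite mulmxKV.
  rewrite mulmxA submxMr //; apply: low_stable; by case: (Hx _ Tt).
have rW : \rank W = i.+1.
  by rewrite mxrankMfree ?row_free_unit // rank_pid_mx.
have /sub_pidP/(_ i j) := stable_rank_flag sW.
by rewrite rW => /(_ ij); rewrite pid_mulE ltnSn.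
Qed.

End Triangular.

Section TriangularConnected.
Variable F : closedFieldType.

Lemma affine_det N (A B : 'M[F]_N) : exists q : {poly F}, forall t,
  \det (A + t *: B) = q.[t].
Proof.
apply: ratl1_poly; apply: ratl_polyfun (@polyfun_det F N) _.
by apply: mxratlD; [exact: mxratl_const | apply: mxratlZ; [exact: ratl_var | exact: mxratl_const]].
Qed.

Lemma lowSL_joined N (A : 'M[F]_N) : lowSL A -> joined (@lowSL F N) 1%:M A.
Proof.
move=> TA; case: N A TA => [|N] A TA.
  have E : A = 1%:M by rewrite [LHS]flatmx0 [RHS]flatmx0.
  by rewrite E in TA *; split.
have [q Hq] := affine_det 1%:M (A - 1%:M).
pose L t := 1%:M + t *: (A - 1%:M).
(* The segment from 1 to [A], with its first row divided by the determinant. *)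
pose c t := (1%:M + (q.[t]^-1 - 1) *: delta_mx 0 0) *m L t.
have q0 : q.[0] = 1 by rewrite -Hq scale0r addr0 det1.
have q1 : q.[1] = 1 by rewrite -Hq scale1r addrC subrK; case: TA.
have -> : 1%:M = c 0 by rewrite /c /L q0 invr1 subrr !scale0r !addr0 mulmx1.
have -> : A = c 1.
  by rewrite /c /L q1 invr1 subrr scale0r addr0 scale1r mul1mx addrC subrK.
apply: (@joined_curve _ _ _ q); rewrite ?q0 ?q1 ?oner_eq0 //.
  apply: mxratlM; apply: mxratlD; try exact: mxratl_const.
    apply: mxratlZ; last exact: mxratl_const.
    by apply: ratlD; [exact/ratl_inv/dvdpp | exact: ratl_const].
  by apply: mxratlZ; [exact: ratl_var | exact: mxratl_const].
move=> t qt; split.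
  apply: lowkM; apply: lowkD; try exact: lowk_scalar.
    apply: lowkZ => i j _ ij; rewrite mxE.
    by case: eqP => // Ei; case: eqP => // Ej; rewrite Ei Ej in ij.
  by apply: lowkZ; apply: lowkB; [case: TA | exact: lowk_scalar].
rewrite det_mulmx Hq.
have -> : (q.[t]^-1 - 1) *: delta_mx 0 0 =
    ((q.[t]^-1 - 1) *: delta_mx 0 0 : 'cV_N.+1) *m (delta_mx 0 0 : 'rV_N.+1).
  by rewrite -scalemxAl mul_delta_mx.
by rewrite det_rank1 -scalemxAr mul_delta_mx !mxE !eqxx mulr1 addrC subrK mulVf.
Qed.

Lemma lowSL_zconnected N (g : 'M[F]_N) : g \in unitmx -> zconnected (conjset g (@lowSL F N)).
Proof.
move=> ug; apply: (@zconnected_joined _ _ _ 1%:M) => A /lowSL_joined J.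
have := joined_polymap (polymap_conj (invmx g) g) _ J.
rewrite conjVK // mulmx1 mulVmx //; apply=> C TC.
by rewrite /conjset conjK.
Qed.

End TriangularConnected.

(** * The Lie-Kolchin theorem and Borel subgroups *)

Section LieKolchin.
Variable F : closedFieldType.

Lemma root_list (p : {poly F}) : p != 0 -> exists s : seq F, forall x, root p x -> x \in s.
Proof.
move=> p0; have [s Ep] := closed_field_poly_normal p; exists s => x.
by rewrite Ep rootZ ?lead_coef_eq0 // root_prod_XsubC.
Qed.

Lemma eigenvectorP n (A : 'M[F]_n) : (0 < n)%N ->
  exists (a : F) (v : 'rV_n), v != 0 /\ v *m A = a *: v.
Proof.
move=> n0; have /closed_rootP [a] : size (char_poly A) != 1.
  by rewrite size_char_poly eqSS -lt0n.
rewrite -eigenvalue_root_char => /eigenvalueP [v vA v0].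
by exists a, v.
Qed.

Lemma stable_eigenvector m n (U : 'M[F]_(m, n)) (A : 'M_n) : stablemx U A -> U != 0 ->
  exists (a : F) (v : 'rV_n), [/\ v != 0, (v <= U)%MS & v *m A = a *: v].
Proof.
move=> sU U0; have [] := eigenvectorP (restrictmx U A); first by rewrite lt0n mxrank_eq0.
move=> a [v [v0 vA]]; exists a, (v *m row_base U); split.
- apply: contraNneq v0 => E; apply/eqP/(row_free_inj (row_base_free U)).
  by rewrite /= E mul0mx.
- by rewrite -(eq_row_base U) submxMl.
- rewrite -mulmxA -(mulmxKpV (_ : (row_base U *m A <= row_base U)%MS)).
    by rewrite mulmxA -[_ *m pinvmx _]/(restrictmx U A) vA scalemxAl.
  by rewrite stablemx_row_base.
Qed.

Lemma common_eigenvector_comm n (S : 'M[F]_n -> Prop) : (0 < n)%N ->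
  (forall A B, S A -> S B -> A *m B = B *m A) ->
  exists2 v : 'rV_n, v != 0 & forall A, S A -> exists a, v *m A = a *: v.
Proof.
move=> n0 cS.
suff H k (U : 'M_n) : (\rank U <= k)%N -> U != 0 -> (forall A, S A -> stablemx U A) ->
    exists2 v : 'rV_n, v != 0 & forall A, S A -> exists a, v *m A = a *: v.
  apply: (H n 1%:M); first by rewrite mxrank1.
    by rewrite -mxrank_eq0 mxrank1 -lt0n.
  by move=> A _; rewrite submx1.
elim: k U => [|k IH] U rU U0 sU.
  by rewrite -mxrank_eq0 -leqn0 rU in U0.
case: (classic (forall A, S A -> exists a, U *m A = a *: U)) => [H|].
  have [i Ui] : exists i, row i U != 0.
    apply/existsP; apply: contraNT U0 => /existsPn H0; apply/eqP/row_matrixP => i.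
    by rewrite row0; apply/eqP/negbNE/H0.
  exists (row i U) => // A /H [a UA]; exists a.
  by rewrite -row_mul UA linearZ.
move=> nS; have [A nSA] := not_all_ex_not _ _ nS.
have [SA nA] := imply_to_and _ _ nSA.
have [a [v [v0 vU vA]]] := stable_eigenvector (sU _ SA) U0.
pose E := eigenspace A a.
apply: (IH (U :&: E)%MS).
- rewrite -ltnS (leq_trans _ rU) // ltn_neqAle mxrankS ?capmxSl // andbT.
  apply/negP => rE; apply: nA; exists a; apply/eigenspaceP.
  by have := mxrank_leqif_sup (capmxSl U E) => [[_]]; rewrite rE => /esym; rewrite sub_capmx => /andP[].
- apply: contraNneq v0 => E0; rewrite -submx0 -E0 sub_capmx vU.
  exact/eigenspaceP.
- move=> B SB; rewrite sub_capmx (submx_trans (submxMr _ (capmxSl _ _)) (sU _ SB)) /=.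
  apply/eigenspaceP; rewrite -mulmxA (cS B A) // mulmxA.
  by rewrite (eigenspaceP (capmxSr U E)) scalemxAl.
Qed.

(** Turns a subspace given by a condition quantified over a group into a row space: vectors are
    adjoined until none is missing, which takes at most [n] steps. *)
Lemma subspace_mx n (P : 'rV[F]_n -> Prop) :
  P 0 -> (forall a u v, P u -> P v -> P (a *: u + v)) ->
  exists U : 'M_n, forall v, P v <-> (v <= U)%MS.
Proof.
move=> P0 PD.
have Psub (U : 'M_n) v : (forall w, (w <= U)%MS -> P w) -> P v ->
    forall w, (w <= U + v)%MS -> P w.
  move=> PU Pv w /sub_addsmxP [[u1 u2] /= ->].
  have -> : u2 *m v = u2 0 0 *: v by rewrite (mx11_scalar u2) mul_scalar_mx mxE eqxx mulr1n.
  by rewrite addrC; apply: PD => //; apply/PU/submxMl.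
suff H k (U : 'M_n) : (n - \rank U <= k)%N -> (forall w, (w <= U)%MS -> P w) ->
    exists U : 'M_n, forall v, P v <-> (v <= U)%MS.
  by apply: (H n 0); rewrite ?leq_subr // => w; rewrite submx0 => /eqP ->.
elim: k U => [|k IH] U rU PU.
  exists U => v; split=> [_|/PU //].
  have : row_full U by rewrite /row_full eqn_leq rank_leq_col -subn_eq0 -leqn0.
  by rewrite -sub1mx; apply: submx_trans (submx1 v).
case: (classic (forall v, P v -> (v <= U)%MS)) => [H|].
  by exists U => v; split=> [/H|/PU].
move=> nP; have [v nPv] := not_all_ex_not _ _ nP.
have [Pv /negP nv] := imply_to_and _ _ nPv.
apply: (IH (U + v)%MS); last exact: Psub.
rewrite leq_subLR in rU; rewrite leq_subLR (leq_trans rU) // addnS -addSn leq_add2r.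
rewrite ltn_neqAle mxrankS ?addsmxSl // andbT; apply: contra nv => rE.
have := mxrank_leqif_sup (addsmxSl U v) => [[_]]; rewrite rE => /esym.
by rewrite addsmx_sub => /andP[].
Qed.

Section Group.
Variables (N : nat) (G : mxset F N).
Hypothesis (GSL : forall A, G A -> SLset A) (gG : is_group G).

Let uG A : G A -> A \in unitmx. Proof. by move/GSL/det1_unit. Qed.
Let G1 : G 1%:M. Proof. by case: gG. Qed.
Let GM A B : G A -> G B -> G (A *m B). Proof. by case: gG => _ H _; apply: H. Qed.
Let GV A : G A -> G (invmx A). Proof. by case: gG => _ _; apply. Qed.

Lemma gen_group_group (S : mxset F N) : is_group (gen_group S).
Proof.
split.
- by move=> K [].
- move=> A B HA HB K gK SK; case: (gK) => _ KM _; apply: KM; [exact: HA | exact: HB].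
- by move=> A HA K gK SK; case: (gK) => _ _; apply; apply: HA.
Qed.

Lemma dseries_group k : is_group (dseries k G).
Proof. by case: k => [|k] //=; apply: gen_group_group. Qed.

Lemma dseries_sub k A : dseries k G A -> G A.
Proof.
elim: k A => [//|k IH] A /= /(_ G gG); apply => _ [B [C [/IH GB /IH GC ->]]].
by do 2?[apply: GM => //]; apply: GM; apply: GV.
Qed.

Lemma dseries_normal k g A : G g -> dseries k G A -> dseries k G (g *m A *m invmx g).
Proof.
move=> Gg; elim: k A => [|k IH] A /=.
  by move=> GA; do 2?[apply: GM => //]; apply: GV.
have ug := uG Gg; have [D1 DM DV] := dseries_group k.+1.
move/(_ (fun A => dseries k.+1 G (g *m A *m invmx g))); apply.
  split; first by rewrite conj1.
    by move=> B C HB HC; rewrite conj_mul //; apply: DM.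
  by move=> B HB; rewrite conj_inv //; apply: DV.
move=> _ [B [C [/IH DB /IH DC ->]]] K gK; apply; exists (g *m B *m invmx g), (g *m C *m invmx g).
by rewrite conj_commutator.
Qed.

Section Representation.
Variables (M : nat) (phi : 'M[F]_N -> 'M[F]_M).
Hypothesis cG : zconnected G.
Hypothesis pphi : polymap phi.
Hypothesis phi1 : phi 1%:M = 1%:M.
Hypothesis phiM : forall A B, G A -> G B -> phi (A *m B) = phi A *m phi B.

Lemma repr_mulVmx A : G A -> phi (invmx A) *m phi A = 1%:M.
Proof. by move=> GA; rewrite -phiM ?mulVmx ?phi1 //; [exact: uG | exact: GV]. Qed.

Lemma repr_mulmxV A : G A -> phi A *m phi (invmx A) = 1%:M.
Proof. by move=> GA; rewrite -phiM ?mulmxV ?phi1 //; [exact: uG | exact: GV]. Qed.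

Lemma repr_unit A : G A -> phi A \in unitmx.
Proof. by move=> GA; case: (mulmx1_unit (repr_mulmxV GA)). Qed.

Lemma repr_commutator A B : G A -> G B -> phi A *m phi B = phi B *m phi A *m phi (commutator A B).
Proof.
move=> GA GB; have GVA := GV GA; have GVB := GV GB.
rewrite /commutator; do ![rewrite phiM; [|by repeat apply: GM|by []]].
rewrite !mulmxA -(mulmxA (phi B) (phi A)) repr_mulmxV // mulmx1 repr_mulmxV //.
by rewrite mul1mx.
Qed.

Definition repr_stable m (W : 'M[F]_(m, M)) : Prop :=
  forall A, G A -> stablemx W (phi A).

(** * Irreducible representations of connected solvable groups are scalar *)

Section Irreducible.
Hypothesis M0 : (0 < M)%N.
Hypothesis irr : forall W : 'M[F]_M, repr_stable W -> W != 0 -> (1%:M <= W)%MS.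

Lemma irr_schur (X : 'M[F]_M) :
  (forall A, G A -> phi A *m X = X *m phi A) -> exists c, X = c%:M.
Proof.
move=> cX; have [c [v [v0 vX]]] := eigenvectorP X M0; exists c.
have : (1%:M <= eigenspace X c)%MS.
  apply: irr => [A GA|].
    apply/eigenspaceP; rewrite -mulmxA cX // mulmxA.
    have /eigenspaceP -> : (eigenspace X c <= eigenspace X c)%MS by [].
    by rewrite -scalemxAl.
  apply: contraNneq v0 => E; rewrite -submx0 -E; exact/eigenspaceP.
by move/eigenspaceP; rewrite mul1mx => ->; rewrite scalemx1.
Qed.

(** The conjugates of [a] have a common eigenvector [v]. Hence each translate of [v] by the group is
    an eigenvector of [phi a]; the eigenvalue is a root of the characteristic polynomial, so it is
    constant on the connected group, and irreducibility spreads it to the whole space. *)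
Lemma irr_comm_conj_scalar (a : 'M[F]_N) : G a ->
  (forall g h, G g -> G h ->
    phi (g *m a *m invmx g) *m phi (h *m a *m invmx h) =
    phi (h *m a *m invmx h) *m phi (g *m a *m invmx g)) ->
  exists c, phi a = c%:M.
Proof.
move=> Ga cga.
pose S X := exists2 g, G g & X = phi (g *m a *m invmx g).
have [|v v0 vS] := @common_eigenvector_comm M S M0.
  by move=> _ _ [g Gg ->] [h Gh ->]; apply: cga.
have [s Hs] := root_list (monic_neq0 (char_poly_monic (phi a))).
pose Z c A := v *m phi A *m phi a = c *: (v *m phi A).
have nz g : G g -> v *m phi g != 0.
  move=> Gg; apply: contraNneq v0 => E.
  by rewrite -[v]mulmx1 -(repr_mulmxV Gg) mulmxA E mul0mx.
have eig g : G g -> exists c, Z c g.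
  move=> Gg; have [c vc] := vS _ (ex_intro2 _ _ g Gg erefl); exists c.
  rewrite /Z scalemxAl -vc -!mulmxA -!phiM //; last by do 2?[apply: GM => //]; apply: GV.
  by rewrite -!mulmxA mulVmx ?uG // mulmx1.
have [c0 Zc0] := eig _ G1.
have ZG g : G g -> Z c0 g.
  apply: (@zconnected_partition _ N G F s Z 1%:M c0) => //.
  - move=> c; apply: zclosed_mxeq.
      apply: polymapM; last exact: polymap_const.
      by apply: polymapM => //; exact: polymap_const.
    have P : polymap (fun A => (c *: v) *m phi A).
      by apply: polymapM => //; exact: polymap_const.
    by move=> i j; apply: (eq_polyfun _ (P i j)) => A; rewrite -scalemxAl.
  - move=> A GA; have [c ZA] := eig _ GA; exists c => //; apply: Hs.
    rewrite -eigenvalue_root_char; apply/eigenvalueP; exists (v *m phi A) => //.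
    exact: nz.
  - move=> A c d GA Zc Zd; apply/eqP; rewrite -subr_eq0.
    have : (c - d) *: (v *m phi A) == 0 by rewrite scalerBl -Zc -Zd subrr.
    by rewrite scalemx_eq0 (negPf (nz _ GA)) orbF.
(* The vectors all of whose translates lie in the [c0]-eigenspace: a stable subspace by
   construction, containing [v]. *)
pose P (x : 'rV_M) := forall g, G g -> x *m phi g *m phi a = c0 *: (x *m phi g).
have [|k x y Px Py g Gg|U HU] := @subspace_mx M P.
- by move=> g _; rewrite !mul0mx scaler0.
- by rewrite !mulmxDl -!scalemxAl Px // Py // scalerDr !scalerA mulrC.
have /irr : repr_stable U.
  move=> h Gh; apply/row_subP => i; rewrite row_mul; apply/HU => g Gg.
  rewrite -(mulmxA (row i U)) -phiM //; move/HU: (row_sub i U); apply.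
  exact: GM.
have vU : (v <= U)%MS by apply/HU.
have U0 : U != 0 by apply: contraNneq v0 => E; rewrite E submx0 in vU.
move=> /(_ U0) U1; exists c0; apply/row_matrixP => i.
have /HU/(_ _ G1) : (row i 1%:M <= U)%MS by apply: submx_trans U1; apply: row_sub.
rewrite phi1 mulmx1 -row_mul mul1mx => ->.
by rewrite -linearZ scalemx1.
Qed.

Section NormalSubgroup.
Variable D : mxset F N.
Hypothesis gD : is_group D.
Hypothesis DG : forall A, D A -> G A.
Hypothesis nD : forall g A, G g -> D A -> D (g *m A *m invmx g).
Hypothesis cD : forall A B, D A -> D B -> exists c, phi (commutator A B) = c%:M.

Let conjG g A : G g -> G A -> G (g *m A *m invmx g).
Proof. by move=> Gg GA; do 2?[apply: GM => //]; apply: GV. Qed.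

Let conj_phi g A : G g -> G A ->
  phi (g *m A *m invmx g) = phi g *m phi A *m phi (invmx g).
Proof. by move=> Gg GA; rewrite (phiM (GM Gg GA) (GV Gg)) phiM. Qed.

Let polymap_conj_adj d : polymap (fun A => phi (A *m d *m \adj A)).
Proof.
apply: polymap_comp => //; apply: polymapM; last exact: polymap_adj.
by apply: polymapM; [exact: polymap_id | exact: polymap_const].
Qed.

Let roots_of_unity : exists s : seq F, forall c : F, c ^+ M = 1 -> c \in s.
Proof.
have [|s Hs] := @root_list ('X^M - 1).
  by rewrite -size_poly_eq0 size_XnsubC.
by exists s => c cM; apply: Hs; rewrite /root !hornerE cM subrr.
Qed.

(** Confines the scalars below to finitely many values, as [zconnected_partition] requires. *)
Let det_root c (X Y : 'M[F]_M) : X \in unitmx -> \det X = \det Y -> Y = c *: X -> c ^+ M = 1.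
Proof.
rewrite unitmxE unitfE => uX dXY E; move: dXY; rewrite E detZ.
by rewrite -{1}[\det X]mul1r => /(mulIf uX).
Qed.

(* [d' (g d g^-1) = z (g d g^-1) d'] for a root of unity [z] that depends
   algebraically on [g] in the connected group [G], hence is constant. *)
Let commutator_const d d' z : D d -> D d' ->
  phi d' *m phi d = z *: (phi d *m phi d') ->
  forall g, G g -> phi d' *m phi (g *m d *m invmx g) = z *: (phi (g *m d *m invmx g) *m phi d').
Proof.
move=> Dd Dd' Ez; have [s Hs] := roots_of_unity.
(* The adjugate replaces the inverse because it is polynomial in the entries; they agree on [G],
   where the determinant is 1. *)
pose Z c A := phi d' *m phi (A *m d *m \adj A) = c *: (phi (A *m d *m \adj A) *m phi d').
have adjE A : G A -> \adj A = invmx A by move=> GA; rewrite det1_invE //; apply: GSL.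
suff H : forall g, G g -> Z z g by move=> g Gg; have := H g Gg; rewrite /Z adjE.
have uc g : G g -> phi (g *m d *m invmx g) *m phi d' \in unitmx.
  by move=> Gg; rewrite unitmx_mul !repr_unit //; [exact: DG | apply: conjG => //; exact: DG].
apply: (@zconnected_partition _ N G F s Z 1%:M z) => //.
- move=> c; apply: zclosed_mxeq.
    by apply: polymapM; [exact: polymap_const | exact: polymap_conj_adj].
  have P : polymap (fun A => phi (A *m d *m \adj A) *m (c *: phi d')).
    by apply: polymapM; [exact: polymap_conj_adj | exact: polymap_const].
  by move=> i j; apply: (eq_polyfun _ (P i j)) => A; rewrite -scalemxAr.
- move=> A GA; have [c Ec] := cD Dd' (nD GA Dd).
  have E : phi d' *m phi (A *m d *m invmx A) = c *: (phi (A *m d *m invmx A) *m phi d').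
    by rewrite repr_commutator ?Ec ?mul_mx_scalar; [|exact: DG|apply: conjG => //; exact: DG].
  exists c; last by rewrite /Z adjE.
  apply: Hs; apply: (det_root (uc _ GA)) E.
  by rewrite !det_mulmx mulrC.
- move=> A b c GA; rewrite /Z adjE // => -> /eqP.
  rewrite -subr_eq0 -scalerBl scalemx_eq0 subr_eq0 => /orP[/eqP //|].
  by rewrite (negPf (unitmx_neq0 M0 (uc _ GA))).
- by rewrite /Z adjE // invmx1 mul1mx mulmx1.
Qed.

(** Both [d] and g d g^-1 commute with an element of [D] up to the same root of unity, so e = g d
    g^-1 d^-1 commutes with [D] under [phi]. The conjugates of [e] then commute and [phi e] is a
    scalar, again a root of unity, equal to 1 at g = 1 and hence everywhere. So [phi d] commutes
    with the group, and Schur's lemma applies. *)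
Lemma irr_normal_scalar d : D d -> exists c, phi d = c%:M.
Proof.
move=> Dd; have Gd := DG Dd; have [s Hs] := roots_of_unity.
have [_ DM DV] := gD.
have adjE A : G A -> \adj A = invmx A by move=> GA; rewrite det1_invE //; apply: GSL.
have prop g : G g -> exists c, phi (g *m d *m invmx g) = c *: phi d.
  move=> Gg; pose e := g *m d *m invmx g *m invmx d.
  have De : D e by apply: DM; [exact: nD | exact: DV].
  have ce x : D x -> phi x *m phi e = phi e *m phi x.
    move=> Dx; have Gx := DG Dx; have [z Ez] := cD Dx Dd.
    have E1 : phi x *m phi d = z *: (phi d *m phi x).
      by rewrite repr_commutator // Ez mul_mx_scalar.
    have E2 := commutator_const Dd Dx E1 Gg.
    rewrite /e phiM; [|exact: conjG|exact: GV].
    rewrite mulmxA E2 -scalemxAl -!mulmxA scalemxAr; congr (_ *m _).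
    have := congr1 (fun X => phi (invmx d) *m X *m phi (invmx d)) E1.
    rewrite /= -!mulmxA repr_mulmxV // mulmx1 => ->.
    by rewrite -!scalemxAl -scalemxAr !mulmxA repr_mulVmx // mul1mx.
  have [g1 h Gg1 Gh|c Ec] := irr_comm_conj_scalar (DG De).
    have Dx := nD Gg1 De; have := ce _ (nD (GV Gh) Dx).
    move: (g1 *m e *m invmx g1) Dx => x Dx; have Gx := DG Dx.
    have Ge := DG De; have GVh := GV Gh.
    rewrite !conj_phi // invmxK => E.
    transitivity (phi h *m (phi (invmx h) *m phi x *m phi h *m phi e) *m phi (invmx h)).
      by rewrite !mulmxA repr_mulmxV // mul1mx.
    by rewrite E !mulmxA -[LHS]mulmxA repr_mulmxV // mulmx1.
  exists c; rewrite -mul_scalar_mx -Ec -phiM //; last exact: DG.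
  by rewrite /e mulmxKV ?uG.
pose Z c A := phi (A *m d *m \adj A) = c *: phi d.
apply: irr_schur => g Gg.
have : Z 1 g.
  apply: (@zconnected_partition _ N G F s Z 1%:M 1) Gg => //.
  - move=> c; apply: zclosed_mxeq; [exact: polymap_conj_adj | exact: polymap_const].
  - move=> A GA; have [c Ec] := prop _ GA; exists c; last by rewrite /Z adjE.
    apply: Hs; apply: det_root (repr_unit Gd) _ Ec.
    rewrite conj_phi // !det_mulmx mulrAC -det_mulmx repr_mulmxV //.
    by rewrite det1 mul1r.
  - move=> A b c GA; rewrite /Z adjE // => -> /eqP.
    rewrite -subr_eq0 -scalerBl scalemx_eq0 subr_eq0 => /orP[/eqP //|].
    by rewrite (negPf (unitmx_neq0 M0 (repr_unit Gd))).
  - by rewrite /Z adjE // invmx1 mul1mx mulmx1 scale1r.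
rewrite /Z adjE // scale1r conj_phi // => E.
by rewrite -{2}E -mulmxA repr_mulVmx // mulmx1.
Qed.

End NormalSubgroup.

(** Climbs the derived series from its trivial end: commutators of elements of one term lie in the
    next term, where [phi] is already scalar. *)
Lemma irr_solvable_scalar : solvable_set G -> forall A, G A -> exists c, phi A = c%:M.
Proof.
move=> [k Hk].
suff H j : (j <= k)%N -> forall A, dseries (k - j) G A -> exists c, phi A = c%:M.
  by move=> A GA; apply: (H k) => //; rewrite subnn.
elim: j => [_ A|j IH jk].
  by rewrite subn0 => /Hk ->; exists 1.
apply: irr_normal_scalar => [|A|g A|A B DA DB].
- exact: dseries_group.
- exact: dseries_sub.
- exact: dseries_normal.
- apply: (IH (ltnW jk)); rewrite -subSS subSn //=.
  by move=> K _; apply; exists A, B.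
Qed.

End Irreducible.
End Representation.

Lemma repr_irreducible M (phi : 'M[F]_N -> 'M[F]_M) : (0 < M)%N ->
  exists U : 'M_M, [/\ U != 0, repr_stable phi U &
    forall W : 'M_M, repr_stable phi W -> W != 0 -> (W <= U)%MS -> (U <= W)%MS].
Proof.
move=> M0.
suff H k (U : 'M_M) : (\rank U <= k)%N -> U != 0 -> repr_stable phi U ->
    exists U : 'M_M, [/\ U != 0, repr_stable phi U &
    forall W : 'M_M, repr_stable phi W -> W != 0 -> (W <= U)%MS -> (U <= W)%MS].
  apply: (H M 1%:M); first by rewrite mxrank1.
    by rewrite -mxrank_eq0 mxrank1 -lt0n.
  by move=> A _; rewrite submx1.
elim: k U => [|k IH] U rU U0 sU.
  by rewrite -mxrank_eq0 -leqn0 rU in U0.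
case: (classic (exists W : 'M_M, [/\ repr_stable phi W, W != 0, (W <= U)%MS & ~~ (U <= W)%MS])).
  move=> [W [sW W0 WU nUW]]; apply: (IH W) => //.
  rewrite -ltnS (leq_trans _ rU) // ltn_neqAle mxrankS // andbT.
  by apply: contra nUW => /eqP rW; have := mxrank_leqif_sup WU => [[_ <-]]; rewrite rW.
move=> nW; exists U; split=> // W sW W0 WU; apply/negP => /negP nUW.
by apply: nW; exists W.
Qed.

Lemma lie_kolchin_eigenvector M (phi : 'M[F]_N -> 'M[F]_M) : (0 < M)%N ->
  zconnected G -> solvable_set G -> polymap phi -> phi 1%:M = 1%:M ->
  (forall A B, G A -> G B -> phi (A *m B) = phi A *m phi B) ->
  exists2 v : 'rV_M, v != 0 & forall A, G A -> exists c, v *m phi A = c *: v.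
Proof.
move=> M0 cG sG pphi phi1 phiM; have [U [U0 sU mU]] := repr_irreducible phi M0.
set V := row_base U.
have rV : row_free V by apply: row_base_free.
have sV A : G A -> stablemx V (phi A) by move=> GA; rewrite stablemx_row_base; apply: sU.
(* The action on a minimal stable subspace, in the basis [V]; minimality makes it irreducible. *)
pose psi A := conjmx V (phi A).
have r0 : (0 < \rank U)%N by rewrite lt0n mxrank_eq0.
have rV' A : G A -> V *m phi A = psi A *m V.
  by move=> GA; rewrite /psi /conjmx mulmxKpV ?sV.
have psiS : forall A, G A -> exists c, psi A = c%:M.
  apply: irr_solvable_scalar => //.
  - apply: polymap_comp pphi.
    exact: (polymap_linear [the {linear _ -> _} of mulmxr (pinvmx V) \o mulmx V]).
  - by rewrite /psi phi1 conjmx_scalar.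
  - by move=> A B GA GB; rewrite /psi phiM // conjmxM // inE; apply: sV.
  - move=> W sW W0.
    have WV : (W *m V <= U)%MS by rewrite -(eq_row_base U) submxMl.
    pose X := (<<W *m V>>)%MS.
    have sX : repr_stable phi X.
      move=> A GA; rewrite (eqmxMr _ (genmxE _)) !genmxE -mulmxA rV' // mulmxA submxMr //.
      exact: sW.
    have X0 : X != 0.
      rewrite -mxrank_eq0 genmxE mxrankMfree // mxrank_eq0 //.
    have := mU _ sX X0; rewrite !genmxE => /(_ WV).
    by rewrite -(eq_row_base U) -{1}[row_base U]mul1mx submxMfree.
exists (row (Ordinal r0) V).
  apply/negP => /eqP E; have := row_free_inj rV; move/(_ 1%N (delta_mx 0 (Ordinal r0)) 0).
  rewrite /= -rowE E mul0mx => /(_ erefl) /rowP /(_ (Ordinal r0)).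
  by rewrite !mxE !eqxx => /eqP; rewrite oner_eq0.
move=> A GA; have [c Ec] := psiS A GA; exists c.
by rewrite -row_mul rV' // Ec mul_scalar_mx linearZ.
Qed.

Lemma complete_row (M : nat) (v : 'rV[F]_M.+1) : v != 0 ->
  exists2 g : 'M_M.+1, g \in unitmx & row 0 g = v.
Proof.
move=> v0; have [|g ug Eg] := @complete_unitmx F 1 M.+1 (delta_mx 0 0) (\matrix_(i < M.+1) v).
  by rewrite -rowE rowK rank_rV v0 mxrank_delta.
by exists g => //; move: Eg; rewrite -!rowE rowK.
Qed.

(** Stated for representations because the induction passes to the quotient by a common eigenvector:
    the size [M] drops while the group remains in size [N]. *)
Lemma lie_kolchin M (phi : 'M[F]_N -> 'M[F]_M) :
  zconnected G -> solvable_set G -> polymap phi -> phi 1%:M = 1%:M ->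
  (forall A B, G A -> G B -> phi (A *m B) = phi A *m phi B) ->
  exists2 g : 'M_M, g \in unitmx & forall A, G A -> low (g *m phi A *m invmx g).
Proof.
move=> cG sG; elim: M phi => [|M IH] phi pphi phi1 phiM.
  by exists 1%:M; [exact: unitmx1 | move=> A _ []].
have [v v0 vG] := lie_kolchin_eigenvector (ltn0Sn M) cG sG pphi phi1 phiM.
have [g ug rg] := complete_row v0.
pose psi A : 'M_(1 + M) := g *m phi A *m invmx g.
have ur A : G A -> ursubmx (psi A) = 0.
  move=> GA; have [c Ec] := vG _ GA.
  have E : row 0 (psi A) = c *: row 0 1%:M.
    by rewrite /psi -mulmxA row_mul rg mulmxA Ec -scalemxAl -rg -row_mul mulmxV.
  move: (psi A) E => X E; apply/matrixP => i j; rewrite ord1 !mxE.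
  have := congr1 (fun r : 'rV_M.+1 => r 0 (rshift 1 j)) E; rewrite !mxE mulr0 => <-.
  by congr (X _ _); apply/val_inj.
have psiM A B : G A -> G B -> psi (A *m B) = psi A *m psi B.
  by move=> GA GB; rewrite /psi phiM // conj_mul.
have [|||h uh Hh] := IH (fun A => drsubmx (psi A)).
- have P : polymap (fun X : 'M[F]_(1 + M) => drsubmx X).
    move=> i j; apply: (eq_polyfun _ (polyfun_entry F (rshift 1 i) (rshift 1 j))) => X.
    by rewrite !mxE.
  exact: (polymap_comp P (polymap_comp (polymap_conj g (invmx g)) pphi)).
- rewrite /psi phi1 conj1 //; apply/matrixP => i j.
  by rewrite !mxE -val_eqE /= eqn_add2l val_eqE.
- move=> A B GA GB; rewrite psiM //.
  rewrite -{1}(submxK (psi A)) -{1}(submxK (psi B)) mulmx_block block_mxKdr.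
  by rewrite (ur B) // mulmx0 add0r.
have uk : block_mx (1%:M : 'M_1) 0 0 h \in unitmx.
  by rewrite unitmxE det_ublock det1 mul1r -unitmxE.
pose k : 'M_M.+1 := block_mx (1%:M : 'M_1) 0 0 h.
have uk' : k \in unitmx by [].
exists (k *m g); first by rewrite unitmx_mul uk'.
move=> A GA; apply/lowP/is_trig_mxP.
have -> : k *m g *m phi A *m invmx (k *m g) = k *m (psi A : 'M_M.+1) *m invmx k.
  by rewrite invmxM // !mulmxA.
suff : is_trig_mx (block_mx (1%:M : 'M_1) 0 0 h *m psi A *m invmx (block_mx 1%:M 0 0 h)) by [].
rewrite -[psi A]submxK (ur A) // invmx_block_diag //.
rewrite !mulmx_block !(mul1mx, mul0mx, mulmx0, mulmx1, addr0, add0r).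
rewrite (@is_trig_block_mx _ 1 M 1 M) // eqxx mx11_is_trig /=.
exact/is_trig_mxP/lowP/Hh.
Qed.

End Group.

Theorem borel_conj_lowSL N (B : mxset F N) : borel B ->
  exists2 g : 'M_N, g \in unitmx & forall A, B A <-> conjset g (@lowSL F N) A.
Proof.
move=> [[BSL gB cB] zB sB mB].
have [g ug Hg] := lie_kolchin BSL gB zB sB (@polymap_id F N) erefl (fun A B _ _ => erefl).
exists g => // A.
have BT C : B C -> conjset g (@lowSL F N) C.
  by move=> BC; split; [exact: Hg | rewrite conj_det //; exact: BSL].
split=> [/BT //|]; apply: (mB (conjset g (@lowSL F N))) => //.
- exact/conjset_closed_subgroup/lowSL_closed_subgroup.
- exact: lowSL_zconnected.
- exact: lowSL_solvable.
Qed.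

(** A larger connected solvable group is triangularised by some [k]; then k g^-1 conjugates the
    triangular group into itself, so it is triangular and [g] already triangularises the larger
    group. *)
Theorem conj_lowSL_borel N (g : 'M[F]_N) : g \in unitmx -> borel (conjset g (@lowSL F N)).
Proof.
move=> ug; split.
- exact/conjset_closed_subgroup/lowSL_closed_subgroup.
- exact: lowSL_zconnected.
- exact: lowSL_solvable.
move=> B [BSL gB _] zB sB TB A BA.
have [k uk Hk] := lie_kolchin BSL gB zB sB (@polymap_id F N) erefl (fun A B _ _ => erefl).
pose x := k *m invmx g.
have ux : x \in unitmx by rewrite unitmx_mul uk unitmx_inv.
have Ex : invmx x = g *m invmx k by rewrite invmxM ?unitmx_inv // invmxK.
have lx : low x.
  apply: lowSL_normalizer => // t [lt dt].
  have Bt : B (invmx g *m t *m g) by apply: TB; rewrite /conjset conjK.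
  split; last by rewrite conj_det.
  by have := Hk _ Bt; rewrite Ex /x !mulmxA.
split; last by rewrite conj_det //; exact: BSL.
have -> : g *m A *m invmx g = invmx x *m (k *m A *m invmx k) *m x.
  by rewrite Ex /x !mulmxA mulmxKV // mulmxKV.
by apply: lowkM => //; apply: lowkM; [exact: lowk_inv | exact: Hk].
Qed.

End LieKolchin.

(** * Parabolic subgroups *)

Section Parabolic.
Variable F : closedFieldType.

Lemma ex_min_nat (P : nat -> Prop) n : P n ->
  exists2 m, P m & forall l, (l < m)%N -> ~ P l.
Proof.
elim/ltn_ind: n => n IH Pn; case: (classic (exists2 l, (l < n)%N & P l)).
  by move=> [l ln Pl]; apply: (IH l).
by move=> nP; exists n => // l ln Pl; apply: nP; exists l.
Qed.

(** * Triangularising an element inside a group that contains the triangular matrices *)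

Section Lowering.
Variables (N : nat) (P : mxset F N).
Hypothesis (PSL : forall A, P A -> SLset A) (gP : is_group P).
Hypothesis (TP : forall A, lowSL A -> P A).

Let Pk k A := P A /\ lowk k A.

Let Pk_group k : is_group (Pk k).
Proof.
case: gP => P1 PM PV; split.
- by split=> //; apply: lowk_scalar.
- by move=> A B [PA lA] [PB lB]; split; [exact: PM | exact: lowkM].
- by move=> A [PA lA]; split; [exact: PV | apply: lowk_inv => //; apply/det1_unit/PSL].
Qed.

(** Let Q be the subgroup [Pk k], which stabilises V_0, ..., V_k, and let V_d be the next subspace
    of the flag that it stabilises. Modulo V_k, [p] has an eigenvector [w] in V_d. Some [y] in Q
    moves the basis vector [ek] to a multiple of [w], so [ek] is an eigenvector of y p y^-1 modulo
    V_k: row [k] becomes triangular. *)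
Lemma lowering_step k p : (k < N)%N -> P p -> lowk k p ->
  exists2 y, P y & lowk k.+1 (y *m p *m invmx y).
Proof.
move=> kN Pp lp; have [Q1 QM QV] := Pk_group k.
have TQ t : lowSL t -> Pk k t by move=> Tt; split; [exact: TP | apply: low_lowk; case: Tt].
have uQ A : Pk k A -> A \in unitmx by move=> [/PSL/det1_unit].
pose fl d (w : 'rV[F]_N) := forall j : 'I_N, (d <= j)%N -> w 0 j = 0.
(* [fl d w] says that [w] is in V_d. For the least good [d], any vector outside V_k whose orbit
   stays in V_d has a translate with nonzero last coordinate [m = d - 1]. *)
pose good d := exists2 w : 'rV[F]_N, ~ fl k w & forall q, Pk k q -> fl d (w *m q).
pose ek : 'rV[F]_N := delta_mx 0 (Ordinal kN).
have ek_nfl : ~ fl k ek.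
  by move/(_ (Ordinal kN) (leqnn k)) => /eqP; rewrite mxE !eqxx oner_eq0.
have [|d [w0 w0k w0q] dmin] := @ex_min_nat good N.
  by exists ek => // q _ j; rewrite leqNgt ltn_ord.
have w0d : fl d w0 by have := w0q _ Q1; rewrite mulmx1.
have kd : (k < d)%N.
  by rewrite ltnNge; apply/negP => dk; apply: w0k => j kj; apply: w0d; apply: leq_trans kj.
have d0 : (0 < d)%N by apply: leq_ltn_trans kd.
have dN : (d <= N)%N.
  rewrite leqNgt; apply/negP => Nd; apply: (dmin N Nd).
  by exists ek => // q _ j; rewrite leqNgt ltn_ord.
have pdN : (d.-1 < N)%N by rewrite prednK.
pose m := Ordinal pdN.
have flm w : fl d w -> ~ w 0 m != 0 -> fl d.-1 w.
  move=> wd /negP; rewrite negbK => /eqP wm j; rewrite leq_eqVlt => /orP[/eqP jm|].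
    by rewrite (_ : j = m) //; apply/val_inj.
  by rewrite prednK // => /wd.
have reach w : ~ fl k w -> (forall q, Pk k q -> fl d (w *m q)) ->
    exists2 q, Pk k q & (w *m q) 0 m != 0.
  move=> wk wq; case: (classic (exists2 q, Pk k q & (w *m q) 0 m != 0)) => // nq.
  case: (dmin d.-1); first by rewrite prednK.
  exists w => // q Qq; apply: flm; first exact: wq.
  by move=> wm; apply: nq; exists q.
pose W (w : 'rV[F]_N) := forall q, Pk k q -> fl d (w *m q).
have [|c u v Wu Wv q Qq j dj|U HU] := @subspace_mx _ N W.
- by move=> q _ j _; rewrite mul0mx mxE.
- by rewrite mulmxDl -scalemxAl mxE [X in X + _]mxE (Wu q) // (Wv q) // mulr0 addr0.
have sU q : Pk k q -> stablemx U q.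
  move=> Qq; apply/row_subP => i; rewrite row_mul; apply/HU => r Qr.
  by rewrite -mulmxA; have /HU := row_sub i U; apply; apply: QM.
(* V_d is stable: the vectors with orbit in V_d form a stable subspace containing a vector whose
   last nonzero coordinate is [m], hence containing V_d. *)
have flW w : fl d w -> W w.
  move=> wd; apply/HU; have [q Qq wm] := reach _ w0k w0q.
  have wU : (w0 *m q <= U)%MS by apply: submx_trans (sU _ Qq); apply/submxMr/HU.
  have := @stable_contains_flag F _ N U (w0 *m q) m (fun t Tt => sU t (TQ t Tt)) wU wm.
  rewrite /= prednK // => H; apply: submx_trans (H _); first by apply/sub_pidP => i j dj; rewrite ord1 wd.
  by move=> l dl; apply: w0q.
(* Keeps the coordinates from [k] to [d - 1], so that an eigenvector of [p *m D] in its image is an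
   eigenvector of [p] on V_d modulo V_k. *)
pose D : 'M[F]_N := pid_mx d *m copid_mx k.
have DE n (X : 'M[F]_(n, N)) i j : (X *m D) i j = if (k <= j < d)%N then X i j else 0.
  rewrite /D /copid_mx mulmxBr mulmx1 mulmxBr mulmxA mxE [X in _ + X]mxE !mul_pidE.
  case: (leqP k j) => kj /=; first by rewrite subr0.
  by rewrite (ltn_trans kj kd) subrr.
have sD : stablemx D (p *m D) by rewrite mulmxA submxMl.
have D0 : D != 0.
  apply/negP => /eqP D0; have := DE N 1%:M (Ordinal kN) (Ordinal kN).
  by rewrite D0 mulmx0 !mxE leqnn kd eqxx => /eqP; rewrite eq_sym oner_eq0.
have [lam [w [wn0 wD wp]]] := stable_eigenvector sD D0.
have wD' : w *m D = w.
  have /submxP [X ->] := wD; apply/rowP => j; rewrite DE.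
  by case: ifP => // kj; rewrite DE kj.
have wd : fl d w by move=> j dj; rewrite -wD' DE ltnNge dj andbF.
have wk : ~ fl k w.
  move=> wk; case/eqP: wn0; apply/rowP => j; rewrite mxE.
  have [kj|jk] := leqP k j; first exact: wk.
  by rewrite -wD' DE leqNgt jk.
have Qp : Pk k p by [].
have wpk : fl k (w *m p - lam *: w).
  move=> j kj; rewrite -wp mulmxA mxE [X in _ + X]mxE DE kj /=.
  have [jd|dj] := ltnP j d; first by rewrite subrr.
  by rewrite subr0; apply: (flW w wd).
have [q Qq am] := reach _ wk (flW w wd).
have ekd : fl d ek.
  by move=> j dj; rewrite mxE eqxx -val_eqE /= gtn_eqF //; exact: leq_trans kd dj.
have [q0 Qq0 bm] := reach _ ek_nfl (flW _ ekd).
have ad := flW w wd q Qq; have bd := flW _ ekd q0 Qq0.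
move Ea : (w *m q) am ad => a am ad; move Eb : (ek *m q0) bm bd => b bm bd.
(* After this scaling, [a] and [c *: b] agree at [m]. Their difference lies strictly before [m], so
   adding it to [a] is the effect of a lower triangular transvection. *)
pose c := a 0 m / b 0 m.
have c0 : c != 0 by rewrite mulf_neq0 ?invr_eq0.
pose r := (a 0 m)^-1 *: (c *: b - a).
have rm : r 0 m = 0 by rewrite !mxE /c divfK // subrr mulr0.
have rd : fl d r by move=> j dj; rewrite !mxE (bd j dj) (ad j dj) mulr0 subrr mulr0.
pose t : 'M[F]_N := 1%:M + delta_mx m 0 *m r.
have Tt : lowSL t.
  split; last by rewrite det_rank1 mxE (bigD1 m) //= big1 ?addr0 => [|j jm];
    rewrite ?rm ?mul0r ?addr0 // !mxE (negPf jm) mulr0.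
  apply: lowkD; first exact: lowk_scalar.
  move=> i j _ ij; rewrite mxE big_ord1 [X in X * _]mxE andbT.
  case: eqP => [Ei|_]; last by rewrite mul0r.
  by rewrite rd ?mulr0 // -[d]prednK // -[d.-1]/(nat_of_ord m) -Ei.
have at_ : a *m t = c *: b.
  rewrite mulmxDr mulmx1 mulmxA.
  have -> : a *m delta_mx m (0 : 'I_1) = (a 0 m)%:M.
    apply/matrixP => i j; rewrite !ord1 mxE (bigD1 m) //= big1 ?addr0.
      by rewrite !mxE !eqxx mulr1 mulr1n.
    by move=> l lm; rewrite !mxE (negPf lm) mulr0.
  by rewrite mul_scalar_mx scalerA mulfV // scale1r addrC subrK.
pose y := q0 *m invmx t *m invmx q.
have Qy : Pk k y.
  by apply/QM/QV => //; apply/QM/QV/TQ.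
have uy := uQ _ Qy.
have wy : w = c *: (ek *m y).
  rewrite /y !mulmxA Eb !scalemxAl -at_ mulmxK; last by apply: uQ; apply: TQ.
  by rewrite -Ea mulmxK // uQ.
have eky : ek *m y = c^-1 *: w by rewrite wy scalerA mulVf // scale1r.
clearbody y; exists y; first by case: Qy.
have Qz : Pk k (y *m p *m invmx y) by apply/QM/QV => //; apply: QM.
move=> i j; rewrite ltnS leq_eqVlt => /orP[/eqP ik ij|]; last by case: Qz => _; apply.
have Ei : i = Ordinal kN by apply/val_inj.
have -> : (y *m p *m invmx y) i j = (ek *m (y *m p *m invmx y)) 0 j.
  by rewrite -rowE Ei [RHS]mxE.
have -> : ek *m (y *m p *m invmx y) = lam *: ek + (c^-1 *: (w *m p - lam *: w)) *m invmx y.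
  rewrite scalerBr mulmxBl !mulmxA eky -scalemxAl addrC.
  suff -> : c^-1 *: (lam *: w) *m invmx y = lam *: ek by rewrite subrK.
  by rewrite scalerA mulrC -scalerA -eky -scalemxAl mulmxK.
rewrite mxE [X in X + _]mxE [ek _ _]mxE eqxx -val_eqE /= gtn_eqF -?ik // mulr0 add0r.
rewrite mxE big1 // => l _; have [kl|lk] := leqP k l.
  by rewrite mxE wpk // mulr0 mul0r.
by have [_ /(_ l j)] := QV _ Qy => -> //; rewrite ?mulr0 // (ltn_trans lk) // -ik.
Qed.

Lemma conj_into_low p : P p -> exists2 x, P x & low (x *m p *m invmx x).
Proof.
have [P1 PM PV] := gP; have uP A : P A -> A \in unitmx by move/PSL/det1_unit.
move=> Pp; suff H k : (k <= N)%N -> exists2 x, P x & lowk k (x *m p *m invmx x).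
  exact: H.
elim: k => [_|k IH kN]; first by exists 1%:M => // i j.
have [x Px lx] := IH (ltnW kN).
have Pxp : P (x *m p *m invmx x) by apply/PM/PV => //; apply: PM.
have [y Py ly] := lowering_step kN Pxp lx.
exists (y *m x); first exact: PM.
by rewrite invmxM ?uP // !mulmxA in ly *.
Qed.

End Lowering.

(* A parabolic subgroup is the union of its Borel subgroups, all of which
   contain the identity: it is enough to connect within each of them. *)
Lemma parabolically_connected_lowSL N (H : mxset F N) :
  (forall (g u : 'M_N), g \in unitmx -> lowSL u -> H (invmx g *m u *m g) ->
     joined (fun u => lowSL u /\ H (invmx g *m u *m g)) 1%:M u) ->
  parabolically_connected H.
Proof.
move=> HJ P [[PSL gP cP] [B [bB BP]]].
have [g0 ug0 Hg0] := borel_conj_lowSL bB.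
have [P1 PM PV] := gP.
pose P' (u : 'M[F]_N) := P (invmx g0 *m u *m g0).
have uV := unitmx_inv g0; rewrite ug0 in uV.
apply: (@zconnected_joined _ _ _ 1%:M) => h [Ph Hh].
pose u := g0 *m h *m invmx g0.
have [||||x Px lx] := @conj_into_low N P' _ _ _ u; last 1 first.
- have dx : \det x = 1 by have := PSL _ Px; rewrite /SLset conjV_det.
  have ux := det1_unit dx.
  pose g := x *m g0; have ug : g \in unitmx by rewrite unitmx_mul ux.
  pose v := x *m u *m invmx x.
  have Ev : invmx g *m v *m g = h.
    rewrite /v /u /g invmxM // -!mulmxA (mulmxA (invmx x)) mulVmx // mul1mx.
    by rewrite (mulmxA (invmx x)) mulVmx // mul1mx mulVmx // mulmx1 mulKmx.
  have Tv : lowSL v by split=> //; rewrite !conj_det //; exact: PSL.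
  have Hv : H (invmx g *m v *m g) by rewrite Ev.
  have J := HJ g v ug Tv Hv.
  have := joined_polymap (polymap_conj (invmx g) g) _ J.
  rewrite mulmx1 mulVmx // Ev; apply=> w [Tw Hw]; split=> //.
  have -> : invmx g *m w *m g =
      (invmx g0 *m invmx x *m g0) *m (invmx g0 *m w *m g0) *m (invmx g0 *m x *m g0).
    by rewrite /g invmxM // !mulmxA !mulmxK.
  apply/PM => //; apply/PM.
    have -> : invmx g0 *m invmx x *m g0 = invmx (invmx g0 *m x *m g0).
      by rewrite !invmxM ?unitmx_mul ?uV // invmxK mulmxA.
    exact: PV.
  by apply/BP/Hg0; rewrite /conjset conjK.
- by move=> A /PSL; rewrite /SLset conjV_det.
- split; first by rewrite /P' mulmx1 mulVmx.
    move=> A C PA PC; rewrite /P' -{2}(invmxK g0) conj_mul // invmxK.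
    exact: PM.
  by move=> A PA; rewrite /P' -{2}(invmxK g0) conj_inv // invmxK; apply: PV.
- by move=> A TA; apply/BP/Hg0; rewrite /conjset conjK.
- by rewrite /P' /u conjVK.
Qed.

Definition flag_stabilizer N k : mxset F N :=
  fun A => (forall i j : 'I_N, (i < k)%N -> (k <= j)%N -> A i j = 0) /\ \det A = 1.

Lemma flag_stabilizer_closed_subgroup N k : closed_subgroup (@flag_stabilizer N k).
Proof.
have E (A : 'M[F]_N) : (forall i j : 'I_N, (i < k)%N -> (k <= j)%N -> A i j = 0) <->
    stablemx (pid_mx k : 'M_N) A.
  split=> [H|/sub_pidP H i j ik kj].
    apply/sub_pidP => i j kj; rewrite pid_mulE.
    by case: ltnP => // ik; apply: H.
  by have := H i j kj; rewrite pid_mulE ik.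
split; [by move=> A [] | split |].
- by split; rewrite ?det1 //; apply/E; rewrite mulmx1.
- move=> A B [/E sA dA] [/E sB dB]; split; last by rewrite det_mulmx dA dB mulr1.
  by apply/E; rewrite mulmxA; apply: submx_trans sB; apply: submxMr.
- move=> A [/E sA dA]; have uA := det1_unit dA.
  split; last by rewrite det_inv dA invr1.
  apply/E; rewrite -(submxMfree _ _ (_ : row_free A)) ?row_free_unit // mulmxKV //.
  have := mxrank_leqif_sup sA => [[_ <-]].
  by rewrite mxrankMfree ?row_free_unit.
- apply: zclosedI; last exact: zclosed_SL.
  apply: zclosed_forall => i; apply: zclosed_forall => j.
  by do 2?[apply: zclosed_forall => ?]; apply/zclosed_zero/polyfun_entry.
Qed.

Lemma flag_stabilizer_parabolic N k (g : 'M[F]_N) : g \in unitmx ->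
  parabolic (conjset g (@flag_stabilizer N k)).
Proof.
move=> ug; split; first exact/conjset_closed_subgroup/flag_stabilizer_closed_subgroup.
exists (conjset g (@lowSL F N)); split; first exact: conj_lowSL_borel.
move=> A [/lowP lA dA]; split=> // i j ik kj; apply: lA; exact: leq_trans kj.
Qed.

End Parabolic.

(** * Triangular idempotents commuting with an involution *)

Section InvolutionPeel.
Variables (F : fieldType) (N : nat).
Implicit Types (E p q : 'M[F]_N) (v w : 'cV[F]_N) (x y : 'rV[F]_N).

Lemma low_outer (a : nat) v x : (forall i : 'I_N, (i < a)%N -> v i 0 = 0) ->
  (forall j : 'I_N, (a < j)%N -> x 0 j = 0) -> low (v *m x).
Proof.
move=> Hv Hx; apply/lowP => i j ij; rewrite mxE big_ord1.
have [ia|ai] := ltnP i a; first by rewrite Hv ?mul0r.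
by rewrite Hx ?mulr0 // (leq_ltn_trans ai).
Qed.

Lemma outer_mul v x w y c : x *m w = c%:M -> (v *m x) *m (w *m y) = c *: (v *m y).
Proof. by move=> E; rewrite mulmxA -(mulmxA v) E mul_mx_scalar -scalemxAl. Qed.

Definition zero_from a E : Prop := forall i j : 'I_N, (a <= j)%N -> E i j = 0.

Lemma row_zero_from a E x : zero_from a E -> x *m E = x ->
  forall j : 'I_N, (a <= j)%N -> x 0 j = 0.
Proof.
by move=> zE <- j aj; rewrite mxE big1 // => l _; rewrite zE ?mulr0.
Qed.

Lemma low_col_zero E (a : 'I_N) : low E -> forall i : 'I_N, (i < a)%N -> (col a E) i 0 = 0.
Proof. by move=> /lowP lE i ia; rewrite mxE lE. Qed.

(** Columns of [E] before [a] meet zero coordinates of [w], and those after [a] are zero. *)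
Lemma idem_last_col E (a : 'I_N) w : low E -> zero_from a.+1 E -> E *m w = w ->
  (forall i : 'I_N, (i < a)%N -> w i 0 = 0) -> w = w a 0 *: col a E.
Proof.
move=> /lowP lE zE Ew wa; apply/colP => i; rewrite -{1}Ew !mxE (bigD1 a) //=.
rewrite big1 ?addr0 1?mulrC // => l la.
have [lta|alt|/val_inj Ea] := ltngtP l a; last by rewrite Ea eqxx in la.
  by rewrite wa ?mulr0.
by rewrite zE ?mul0r.
Qed.

Lemma idem_col E (a : 'I_N) : E *m E = E -> E *m col a E = col a E.
Proof. by move=> EE; rewrite !colE mulmxA EE. Qed.

Lemma idem_row E (a : 'I_N) : E *m E = E -> row a E *m E = row a E.
Proof. by move=> EE; rewrite -row_mul EE. Qed.

Lemma row_mul_entry E (a : 'I_N) v : E *m v = v -> row a E *m v = (v a 0)%:M.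
Proof.
by move=> Ev; rewrite -row_mul Ev; apply/matrixP => i j; rewrite !ord1 !mxE eqxx mulr1n.
Qed.

Lemma mul_col_entry E (a : 'I_N) x c : x *m E = x -> x *m col a E = c%:M -> x 0 a = c.
Proof.
move=> xE xa; have := congr1 (fun X : 'M_1 => X 0 0) xa.
by rewrite colE mulmxA xE -colE !mxE eqxx mulr1n.
Qed.

Lemma idem_diag E (a : 'I_N) : low E -> E *m E = E -> zero_from a.+1 E -> col a E != 0 ->
  (col a E) a 0 = 1.
Proof.
move=> lE EE zE v0; have := idem_last_col lE zE (idem_col a EE) (low_col_zero lE).
move=> E1; apply/eqP; rewrite -subr_eq0.
have : ((col a E) a 0 - 1) *: col a E == 0 by rewrite scalerBl scale1r -E1 subrr.
by rewrite scalemx_eq0 (negPf v0) orbF.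
Qed.

Lemma first_nz w : w != 0 ->
  exists2 b : 'I_N, w b 0 != 0 & forall i : 'I_N, (i < b)%N -> w i 0 = 0.
Proof.
move=> w0; have [b0 wb0] : exists b, w b 0 != 0.
  apply/existsP; apply: contraNT w0 => /existsPn H; apply/eqP/colP => i.
  by rewrite mxE; apply/eqP/negbNE/H.
case: (@arg_minnP _ b0 (fun b => w b 0 != 0) (@nat_of_ord N) wb0) => b wb bmin.
exists b => // i ib; apply/eqP/negP => /negP /bmin bi.
by move: (leq_ltn_trans bi ib); rewrite ltnn.
Qed.

Variable th : 'M[F]_N.
Hypothesis (th2 : th *m th = 1%:M) (char2 : (2 : F) != 0).

(* The idempotent [v *m x] projects onto a line on which the involution [th] is [s]. *)
Definition line_piece (s : F) : Prop :=
  exists v x, [/\ low (v *m x), x *m v = 1%:M, th *m v = s *: v & x *m th = s *: x].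

(* [v *m (x *m th)] and [th *m v *m x] are orthogonal idempotents of rank 1
   exchanged by [th]. *)
Definition pair_piece : Prop :=
  exists v x, [/\ low (v *m (x *m th)), low (th *m v *m x), x *m v = 0 &
    x *m th *m v = 1%:M].

Definition anticommuting E : Prop :=
  exists h : 'M[F]_N, [/\ low h, h *m h = E, h *m E = h, E *m h = h & h *m th = - (th *m h)].

Lemma sub_idem E p : E *m E = E -> p *m p = p -> E *m p = p -> p *m E = p ->
  (E - p) *m (E - p) = E - p.
Proof.
by move=> EE pp Ep pE; rewrite mulmxBl !mulmxBr EE Ep pE pp subrr subr0.
Qed.

(** Let [v] be the last nonzero column of [E]. If [th *m v] does not start above row [a], it is [v]
    or [- v] and a line piece splits off; otherwise [v] and [th *m v] span a pair piece. The
    conclusions record what is left when certain kinds of pieces never occur: only lines of one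
    sign, or only pairs. *)
Lemma involution_peel a E : low E -> E *m E = E -> E *m th = th *m E -> zero_from a E ->
  [/\ ~ line_piece 1 -> ~ pair_piece -> E *m th = - E,
      ~ line_piece (-1) -> ~ pair_piece -> E *m th = E &
      ~ line_piece 1 -> ~ line_piece (-1) -> anticommuting E].
Proof.
elim: a E => [|a IH] E lE EE Eth zE.
  have -> : E = 0 by apply/matrixP => i j; rewrite zE ?mxE.
  rewrite mul0mx oppr0; split=> // _ _; exists 0.
  by rewrite !mul0mx !mulmx0 oppr0; split=> // i j _ _; rewrite mxE.
have [Na|aN] := leqP N a.
  by apply: IH => // i j aj; move: (leq_trans Na aj); rewrite leqNgt ltn_ord.
pose ia := Ordinal aN; have [v0|v0] := eqVneq (col ia E) 0.
  apply: IH => // i j; rewrite leq_eqVlt => /orP[/eqP aj|]; last exact: zE.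
  have -> : j = ia by apply/val_inj.
  by have /colP/(_ i) := v0; rewrite !mxE.
have zE' : zero_from ia.+1 E by [].
have va1 := idem_diag lE EE zE' v0.
have Ev := idem_col ia EE; have vlow := low_col_zero (a := ia) lE.
have vcol i (j : 'I_N) : (a <= j)%N -> E i j = (j == ia)%:R * (col ia E) i 0.
  rewrite leq_eqVlt => /orP[/eqP aj|aj].
    have -> : j = ia by apply/val_inj.
    by rewrite eqxx mul1r mxE.
  by rewrite zE // -val_eqE /= gtn_eqF // mul0r.
have xE0 (x : 'rV_N) : x *m E = x -> forall j : 'I_N, (a < j)%N -> x 0 j = 0.
  by move=> xE; apply: row_zero_from xE.
move vE : (col ia E) v0 va1 Ev vlow vcol => v v0 va1 Ev vlow vcol.
have thE x : x *m E = x -> x *m th *m E = x *m th by move=> xE; rewrite -mulmxA -Eth mulmxA xE.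
pose w := th *m v.
have Ew : E *m w = w by rewrite /w mulmxA Eth -mulmxA Ev.
have thw : th *m w = v by rewrite /w mulmxA th2 mul1mx.
case: (classic (forall i : 'I_N, (i < a)%N -> w i 0 = 0)) => [wa|nwa].
  have Ewv : w = w ia 0 *: v by rewrite -vE; apply: idem_last_col.
  move: (w ia 0) Ewv => s ws.
  have s2 : s * s = 1.
    have := thw; rewrite ws -scalemxAr -/w ws scalerA => /colP/(_ ia).
    by rewrite mxE va1 mulr1.
  have [x [xE xv xth]] : exists x, [/\ x *m E = x, x *m v = 1%:M & x *m th = s *: x].
    (* Projection of row [ia] of [E] onto the [s]-eigenspace of right multiplication by [th]. *)
    exists (2^-1 *: (row ia E + s *: (row ia E *m th))); split.
    - by rewrite -scalemxAl mulmxDl -scalemxAl thE idem_row.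
    - have r1 : row ia E *m v = 1%:M by rewrite row_mul_entry // va1.
      rewrite -scalemxAl mulmxDl r1 -scalemxAl -mulmxA -/w ws -scalemxAr r1 (scalerA s) s2.
      by rewrite -{1}[1%:M]scale1r -scalerDl -[1 + 1]/(2 : F) scalerA mulVf // scale1r.
    - rewrite -scalemxAl mulmxDl -scalemxAl -mulmxA th2 mulmx1 [RHS]scalerA (mulrC s) -scalerA.
      by rewrite [in RHS]scalerDr (scalerA s s) s2 scale1r addrC.
  pose e := v *m x.
  have le : low e by apply: (low_outer (a := a)) => //; apply: xE0.
  have ee : e *m e = e by rewrite /e (outer_mul _ _ xv) scale1r.
  have Ee : E *m e = e by rewrite /e mulmxA Ev.
  have eE : e *m E = e by rewrite /e -mulmxA xE.
  have eth : e *m th = s *: e by rewrite /e -mulmxA xth -scalemxAr.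
  have the : th *m e = s *: e by rewrite /e mulmxA -/w ws -scalemxAl.
  have xa : x 0 ia = 1 by apply: mul_col_entry xE _; rewrite vE.
  have zE1 : zero_from a (E - e).
    move=> i j aj; rewrite !mxE big_ord1 vcol //.
    move: aj; rewrite leq_eqVlt => /orP[/eqP aj|aj].
      have -> : j = ia by apply/val_inj.
      by rewrite xa eqxx mul1r mulr1 subrr.
    by rewrite (xE0 _ xE) // mulr0 subr0 -val_eqE /= gtn_eqF // mul0r.
  have [||||I1 I2 _] := IH (E - e); [exact: lowkB | exact: sub_idem | | by [] |].
    by rewrite mulmxBl mulmxBr Eth eth the.
  have L : line_piece s by exists v, x.
  have Es : (E - e) *m th = s *: (E - e) -> E *m th = s *: E.
    by rewrite mulmxBl scalerBr eth => /addIr.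
  have : (s - 1) * (s + 1) == 0.
    have -> : (s - 1) * (s + 1) = s * s - 1 by ring.
    by rewrite s2 subrr.
  rewrite mulf_eq0 => /orP[].
    rewrite subr_eq0 => /eqP s1; rewrite s1 scale1r in L Es *; rewrite scale1r in Es.
    by split=> // nm nr; apply/Es/I2.
  rewrite addr_eq0 => /eqP s1; rewrite s1 !scaleN1r in L Es *.
  by split=> // np nr; apply/Es; rewrite I1 // opprB.
have w0 : w != 0.
  by apply: contra_notN nwa => /eqP -> i _; rewrite mxE.
have [b wb bw] := first_nz w0.
have ba : (b < a)%N.
  by rewrite ltnNge; apply/negP => ab; apply: nwa => i ia'; apply/bw/(leq_trans ia').
(* Row [b] is chosen because [w] starts there: [x] ends at column [b], so [w *m x] is triangular,
   and [x *m v = 0] since [v] starts later. *)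
pose x : 'rV_N := (w b 0)^-1 *: row b E.
have xE : x *m E = x by rewrite /x -scalemxAl idem_row.
have xb (j : 'I_N) : (b < j)%N -> x 0 j = 0.
  by move=> bj; rewrite !mxE (low_lowk lE (k := N)) ?mulr0.
have xw : x *m w = 1%:M.
  by rewrite /x -scalemxAl row_mul_entry // scale_scalar_mx mulVf.
have xv : x *m v = 0.
  by rewrite /x -scalemxAl row_mul_entry // (vlow b ba) scale_scalar_mx mulr0 raddf0.
pose y := x *m th.
have yE : y *m E = y by apply: thE.
have yth : y *m th = x by rewrite /y -mulmxA th2 mulmx1.
have yv : y *m v = 1%:M by rewrite /y -mulmxA.
have yw : y *m w = 0 by rewrite /y -mulmxA thw.
pose p := v *m y; pose q := w *m x.
have lp : low p by apply: (low_outer (a := a)) => //; apply: xE0.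
have lq : low q by apply: (low_outer (a := b)).
have [pp qq pq qp] : [/\ p *m p = p, q *m q = q, p *m q = 0 & q *m p = 0].
  split; rewrite /p /q.
  - by rewrite (outer_mul _ _ yv) scale1r.
  - by rewrite (outer_mul _ _ xw) scale1r.
  - by rewrite mulmxA -(mulmxA v) yw mulmx0 mul0mx.
  - by rewrite mulmxA -(mulmxA w) xv mulmx0 mul0mx.
have [Ep Eq pE qE] : [/\ E *m p = p, E *m q = q, p *m E = p & q *m E = q].
  rewrite /p /q; split; [by rewrite mulmxA Ev|by rewrite mulmxA Ew| |].
  - by rewrite -(mulmxA v) yE.
  - by rewrite -(mulmxA w) xE.
have pth : p *m th = v *m x by rewrite /p -mulmxA yth.
have qth : q *m th = w *m y by rewrite /q -mulmxA.
have thp : th *m p = w *m y by rewrite /p mulmxA.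
have thq : th *m q = v *m x by rewrite /q mulmxA thw.
pose rho := p + q.
have rr : rho *m rho = rho by rewrite mulmxDl !mulmxDr pp qq pq qp addr0 add0r.
have Er : E *m rho = rho by rewrite mulmxDr Ep Eq.
have rE : rho *m E = rho by rewrite mulmxDl pE qE.
have ya : y 0 ia = 1 by apply: mul_col_entry yE _; rewrite vE.
have zE1 : zero_from a (E - rho).
  move=> i j aj; rewrite !mxE !big_ord1 vcol // (xb j) ?mulr0 ?addr0; last exact: leq_trans ba aj.
  move: aj; rewrite leq_eqVlt => /orP[/eqP aj|aj].
    have -> : j = ia by apply/val_inj.
    by rewrite ya eqxx mul1r mulr1 subrr.
  by rewrite (xE0 _ yE) // mulr0 subr0 -val_eqE /= gtn_eqF // mul0r.
have [||||_ _ I3] := IH (E - rho); [|exact: sub_idem| | by [] |].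
- by apply: lowkB => //; apply: lowkD.
- by rewrite mulmxBl mulmxBr Eth mulmxDl mulmxDr pth qth thp thq [v *m x + _]addrC.
have L : pair_piece by exists v, x.
split=> // np nm; have [h [lh hh hE Eh hth]] := I3 np nm.
have Erp : (E - rho) *m p = 0.
  by rewrite mulmxBl Ep mulmxDl pp qp addr0 subrr.
have Erq : (E - rho) *m q = 0.
  by rewrite mulmxBl Eq mulmxDl qq pq add0r subrr.
have pEr : p *m (E - rho) = 0.
  by rewrite mulmxBr pE mulmxDr pp pq addr0 subrr.
have qEr : q *m (E - rho) = 0.
  by rewrite mulmxBr qE mulmxDr qq qp add0r subrr.
have hp : h *m p = 0 by rewrite -hE -mulmxA Erp mulmx0.
have hq : h *m q = 0 by rewrite -hE -mulmxA Erq mulmx0.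
have ph : p *m h = 0 by rewrite -Eh mulmxA pEr mul0mx.
have qh : q *m h = 0 by rewrite -Eh mulmxA qEr mul0mx.
have hE' : h *m E = h.
  by rewrite -[E](subrK rho) mulmxDr hE mulmxDr hp hq !addr0.
have Eh' : E *m h = h.
  by rewrite -[E](subrK rho) mulmxDl Eh mulmxDl ph qh !addr0.
(* [p - q] squares to [p + q] and anticommutes with [th], which exchanges [p] and [q]. *)
exists (h + (p - q)); split.
- by apply: lowkD => //; apply: lowkB.
- rewrite !mulmxDl !mulmxDr !(mulmxN, mulNmx) hh hp hq ph qh pp qq pq qp.
  by rewrite !oppr0 !opprK !addr0 !add0r subrK.
- by rewrite mulmxDl mulmxBl hE' pE qE.
- by rewrite mulmxDr mulmxBr Eh' Ep Eq.
- rewrite mulmxDl mulmxDr mulmxBl mulmxBr hth pth qth thp thq opprD opprB.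
  by [].
Qed.

End InvolutionPeel.

(** * The subgroups SL(m) x SL(n) and S(GL(m) x GL(n)) *)

Section TwoBlocks.
Variable F : closedFieldType.
Hypothesis hF : [pchar F] =i pred0.

Let natr_eq0 n : ((n%:R : F) == 0) = (n == 0)%N.
Proof. exact: (pcharf0P F).1 hF n. Qed.

Lemma char0_two : (2 : F) != 0.
Proof. by rewrite natr_eq0. Qed.

Lemma eq_opp0 a b (A : 'M[F]_(a, b)) : A = - A -> A = 0.
Proof.
move=> E; apply/eqP; have : (2 : F) *: A == 0 by rewrite scaler_nat mulr2n {2}E subrr.
by rewrite scalemx_eq0 (negPf char0_two).
Qed.

(** The equality of [m] and [n] is only propositional when this is used, so the off-diagonal blocks
    keep a rectangular type. *)
Lemma det_conj_rect m n (X : 'M[F]_(m, n)) (B : 'M_n) (Y : 'M_(n, m)) :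
  m = n -> Y *m X = 1%:M -> \det (X *m B *m Y) = \det B.
Proof.
move=> E; move: E X Y => -> X Y YX; rewrite !det_mulmx mulrC mulrA -det_mulmx YX.
by rewrite det1 mul1r.
Qed.

Variables (m n : nat) (g : 'M[F]_(m + n)).
Hypothesis ug : g \in unitmx.

Definition block_sign : 'M[F]_(m + n) := block_mx 1%:M 0 0 (- 1%:M).
Variable th : 'M[F]_(m + n).
Hypothesis thE : th = g *m block_sign *m invmx g.
Let cj (u : 'M[F]_(m + n)) := invmx g *m u *m g.
Let dp u := \det (ulsubmx (cj u)).
Let dm u := \det (drsubmx (cj u)).
Let comm u := u *m th = th *m u.

Let cjM u v : cj (u *m v) = cj u *m cj v.
Proof. by rewrite /cj !mulmxA mulmxK. Qed.
Let cj1 : cj 1%:M = 1%:M. Proof. by rewrite /cj mulmx1 mulVmx. Qed.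
Let cjD u v : cj (u + v) = cj u + cj v. Proof. by rewrite /cj mulmxDr mulmxDl. Qed.
Let cjZ c u : cj (c *: u) = c *: cj u. Proof. by rewrite /cj -scalemxAr -scalemxAl. Qed.
Let cj_det u : \det (cj u) = \det u.
Proof. exact: conjV_det. Qed.
Let cj_th : cj th = block_sign. Proof. by rewrite /cj thE conjVK. Qed.

Lemma block_sign_sqr : block_sign *m block_sign = 1%:M.
Proof.
rewrite mulmx_block !(mul1mx, mul0mx, mulmx0, mulmx1, addr0, add0r) mulNmx mul1mx opprK.
by rewrite -scalar_mx_block.
Qed.

Lemma comm_block_sign X : X *m block_sign = block_sign *m X ->
  X = block_mx (ulsubmx X) 0 0 (drsubmx X).
Proof.
rewrite -{1 2}[X]submxK !mulmx_block.
rewrite !(mul1mx, mul0mx, mulmx0, mulmx1, addr0, add0r) !mulmxN !mulNmx !(mul1mx, mulmx1).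
move/eq_block_mx => [_ E1 E2 _]; rewrite -{1}[X]submxK.
by rewrite (eq_opp0 E2) (eq_opp0 (esym E1)).
Qed.

Lemma block_sign_comm (A : 'M_m) (B : 'M_n) :
  block_mx A 0 0 B *m block_sign = block_sign *m block_mx A 0 0 B.
Proof.
rewrite !mulmx_block !(mul1mx, mul0mx, mulmx0, mulmx1, addr0, add0r) mulmxN mulNmx.
by rewrite mulmx1 mul1mx.
Qed.

Let th2 : th *m th = 1%:M.
Proof. by rewrite thE -conj_mul // block_sign_sqr conj1. Qed.

Let comm_cj u : comm u <-> cj u *m block_sign = block_sign *m cj u.
Proof.
rewrite -cj_th -!cjM; split=> [-> //|].
by move/(congr1 (fun X => g *m X *m invmx g)); rewrite /cj !conjK.
Qed.

Let comm_blk u : comm u -> cj u = block_mx (ulsubmx (cj u)) 0 0 (drsubmx (cj u)).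
Proof. by move/comm_cj/comm_block_sign. Qed.

Let comm1 : comm 1%:M. Proof. by rewrite /comm mul1mx mulmx1. Qed.
Let commM u v : comm u -> comm v -> comm (u *m v).
Proof. by rewrite /comm => Hu Hv; rewrite -mulmxA Hv !mulmxA Hu. Qed.
Let commD u v : comm u -> comm v -> comm (u + v).
Proof. by rewrite /comm => Hu Hv; rewrite mulmxDl Hu Hv mulmxDr. Qed.
Let commZ c u : comm u -> comm (c *: u).
Proof. by rewrite /comm => Hu; rewrite -scalemxAl Hu scalemxAr. Qed.

Let dpM u v : comm u -> comm v -> dp (u *m v) = dp u * dp v.
Proof.
move=> /comm_blk Hu /comm_blk Hv; rewrite /dp cjM Hu Hv mulmx_block !block_mxKul.
by rewrite mulmx0 addr0 det_mulmx.
Qed.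

Let dmM u v : comm u -> comm v -> dm (u *m v) = dm u * dm v.
Proof.
move=> /comm_blk Hu /comm_blk Hv; rewrite /dm cjM Hu Hv mulmx_block !block_mxKdr.
by rewrite mulmx0 add0r det_mulmx.
Qed.

Let det_dpdm u : comm u -> \det u = dp u * dm u.
Proof. by move/comm_blk => Hu; rewrite -cj_det Hu det_ublock. Qed.

Let dp1 : dp 1%:M = 1.
Proof. by rewrite /dp cj1 scalar_mx_block block_mxKul det1. Qed.
Let dm1 : dm 1%:M = 1.
Proof. by rewrite /dm cj1 scalar_mx_block block_mxKdr det1. Qed.

Let SLxSLE u : SLxSL (cj u) <-> [/\ comm u, dp u = 1 & dm u = 1].
Proof.
rewrite /dp /dm; split=> [[A [B [E dA dB]]]|[/comm_blk E dA dB]].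
  by rewrite E block_mxKul block_mxKdr; split=> //; apply/comm_cj; rewrite E block_sign_comm.
by exists (ulsubmx (cj u)), (drsubmx (cj u)).
Qed.

Let SGLxGLE u : SGLxGL (cj u) <-> comm u /\ dp u * dm u = 1.
Proof.
rewrite /dp /dm; split=> [[A [B [E dAB]]]|[/comm_blk E dAB]].
  by rewrite E block_mxKul block_mxKdr; split=> //; apply/comm_cj; rewrite E block_sign_comm.
by exists (ulsubmx (cj u)), (drsubmx (cj u)).
Qed.

Let dp_block A B u : cj u = block_mx A 0 0 B -> dp u = \det A /\ dm u = \det B.
Proof. by rewrite /dp /dm => ->; rewrite block_mxKul block_mxKdr. Qed.

Let cj_outer (v : 'cV[F]_(m + n)) (x : 'rV_(m + n)) : cj (v *m x) = (invmx g *m v) *m (x *m g).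
Proof. by rewrite /cj !mulmxA. Qed.

Let det_rank1Z k (v : 'cV[F]_k) (x : 'rV_k) c : \det (1%:M + c *: (v *m x)) = 1 + c * (x *m v) 0 0.
Proof. by rewrite scalemxAl det_rank1 -scalemxAr mxE. Qed.

Let line_piece_dp s (v : 'cV[F]_(m + n)) (x : 'rV_(m + n)) c : x *m v = 1%:M -> th *m v = s *: v -> x *m th = s *: x ->
  s = 1 \/ s = -1 ->
  dp (1%:M + c *: (v *m x)) = (if s == 1 then 1 + c else 1) /\
  dm (1%:M + c *: (v *m x)) = (if s == 1 then 1 else 1 + c).
Proof.
move=> xv thv xth hs.
pose v0 := invmx g *m v; pose x0 := x *m g.
have x0v0 : x0 *m v0 = 1%:M by rewrite /x0 /v0 mulmxA mulmxK.
have tv0 : block_sign *m v0 = s *: v0.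
  by rewrite -cj_th /cj /v0 !mulmxA mulmxK // -mulmxA thv -scalemxAr.
have xt0 : x0 *m block_sign = s *: x0.
  by rewrite -cj_th /cj /x0 !mulmxA mulmxK // xth -scalemxAl.
have Ec : cj (1%:M + c *: (v *m x)) = 1%:M + c *: (v0 *m x0).
  by rewrite cjD cj1 cjZ cj_outer.
have m11 : (-1 == 1 :> F) = false.
  by apply/negbTE; rewrite eq_sym -subr_eq0 opprK char0_two.
move: v0 x0 x0v0 tv0 xt0 Ec => v0 x0.
rewrite -[v0]vsubmxK -[x0]hsubmxK mul_row_col mul_block_col mul_row_block mul_col_row.
rewrite !(mul1mx, mul0mx, mulmx0, mulmx1, addr0, add0r) mulNmx mul1mx mulmxN mulmx1.
rewrite scale_col_mx scale_row_mx (scalar_mx_block m n) scale_block_mx add_block_mx !add0r.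
move=> E1 /eq_col_mx [Ea Eb] /eq_row_mx [Ec Ed] Eu.
case: hs => hs; rewrite {}hs ?eqxx ?m11 in Ea Eb Ec Ed *.
  have d0 : dsubmx v0 = 0 by apply: eq_opp0; rewrite Eb scale1r.
  rewrite d0 !(mul0mx, mulmx0, scaler0, addr0) in E1 Eu.
  have r0 : rsubmx x0 = 0 by apply: eq_opp0; rewrite Ed scale1r.
  rewrite r0 !(mul0mx, mulmx0, scaler0, addr0) in E1 Eu.
  have [-> ->] := dp_block Eu; rewrite det1 det_rank1Z E1 !mxE eqxx mulr1n mulr1.
  by [].
have d0 : usubmx v0 = 0 by apply: eq_opp0; rewrite {1}Ea scaleN1r.
rewrite d0 !(mul0mx, mulmx0, scaler0, addr0, add0r) in E1 Eu.
have r0 : lsubmx x0 = 0 by apply: eq_opp0; rewrite {1}Ec scaleN1r.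
rewrite r0 !(mul0mx, mulmx0, scaler0, addr0, add0r) in E1 Eu.
have [-> ->] := dp_block Eu; rewrite det1 det_rank1Z E1 !mxE eqxx mulr1n mulr1.
by [].
Qed.

(** The plane spanned by [v] and [th *m v] contains one line from each eigenspace of [th], so [r]
    becomes an idempotent of rank 1 in each diagonal block. *)
Let pair_piece_dp (v : 'cV[F]_(m + n)) (x : 'rV_(m + n)) c : x *m v = 0 -> x *m th *m v = 1%:M ->
  let r := v *m (x *m th) + th *m v *m x in
  dp (1%:M + c *: r) = 1 + c /\ dm (1%:M + c *: r) = 1 + c.
Proof.
move=> xv xtv r.
pose v0 := invmx g *m v; pose x0 := x *m g.
have x0v0 : x0 *m v0 = 0 by rewrite /x0 /v0 mulmxA mulmxK.
have x0tv0 : x0 *m block_sign *m v0 = 1%:M.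
  by rewrite -cj_th /cj /x0 /v0 !mulmxA !mulmxK.
have Ec : cj (1%:M + c *: r) = 1%:M + c *: (v0 *m (x0 *m block_sign) + block_sign *m v0 *m x0).
  by rewrite cjD cj1 cjZ cjD -cj_th /cj /x0 /v0 !mulmxA !mulmxK.
move: v0 x0 x0v0 x0tv0 Ec => v0 x0.
rewrite -[v0]vsubmxK -[x0]hsubmxK mul_block_col mul_row_block !mul_row_col !mul_col_row.
rewrite !(mul1mx, mul0mx, mulmx0, mulmx1, addr0, add0r) !mulNmx !mul1mx !mulmxN !mulmx1.
rewrite mulNmx add_block_mx addrN addNr (scalar_mx_block m n) scale_block_mx add_block_mx.
rewrite !scaler0 !addr0.
set a := lsubmx x0 *m usubmx v0; set b := rsubmx x0 *m dsubmx v0 => E0 E1 Eu.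
have [-> ->] := dp_block Eu.
have two k (A : 'M[F]_k) : A + A = 2 *: A by rewrite scaler_nat mulr2n.
rewrite -opprD !two -scalerN -mulNmx !scalerA !det_rank1Z mulmxN -/a -/b.
have ab : a = - b by apply/eqP; rewrite -addr_eq0 E0.
have Ha : 2 * a 0 0 = 1.
  have := congr1 (fun X : 'M_1 => X 0 0) E1; rewrite -ab two !mxE eqxx mulr1n.
  by [].
by rewrite -ab -mulrA Ha mulr1.
Qed.

(* [K s] multiplies the determinants [(dp, dm)] by [(s ^+ a, s ^+ b)]. *)
Definition corrector (a b : nat) (K : F -> 'M[F]_(m + n)) : Prop :=
  [/\ forall s, s != 0 -> [/\ low (K s), comm (K s), dp (K s) = s ^+ a & dm (K s) = s ^+ b],
      K 1 = 1%:M &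
      forall (h q : {poly F}), q %| h ->
        mxratl h (fun t => K q.[t]) /\ mxratl h (fun t => K q.[t]^-1)].

Let affine_rational (r : 'M[F]_(m + n)) (h q : {poly F}) : q %| h ->
  mxratl h (fun t => 1%:M + (q.[t] - 1) *: r) /\
  mxratl h (fun t => 1%:M + (q.[t]^-1 - 1) *: r).
Proof.
move=> qh; split; (apply: mxratlD; first exact: mxratl_const);
  (apply: mxratlZ; last exact: mxratl_const);
  (apply: ratlD; last exact: ratl_const).
  exact: ratl_horner.
exact: ratl_inv.
Qed.

Let line_comm s (v : 'cV[F]_(m + n)) (x : 'rV_(m + n)) :
  th *m v = s *: v -> x *m th = s *: x -> comm (v *m x).
Proof. by move=> thv xth; rewrite /comm -mulmxA xth mulmxA thv -scalemxAl -scalemxAr. Qed.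

Lemma line_corrector s : line_piece th s -> s = 1 \/ s = -1 ->
  exists K, corrector (s == 1) (s != 1) K.
Proof.
move=> [v [x [lvx xv thv xth]]] hs.
exists (fun c => 1%:M + (c - 1) *: (v *m x)); split.
- move=> c c0; have [-> ->] := line_piece_dp (c - 1) xv thv xth hs.
  have -> : 1 + (c - 1) = c by rewrite addrC subrK.
  split; try by case: (s == 1).
    by apply: lowkD; [exact: lowk_scalar | exact: lowkZ].
  by apply: commD => //; apply: commZ; apply: line_comm xth.
- by rewrite subrr scale0r addr0.
- by move=> h q; apply: affine_rational.
Qed.

Lemma pair_corrector : pair_piece th -> exists K, corrector 1 1 K.
Proof.
move=> [v [x [l1 l2 xv xtv]]]; pose r := v *m (x *m th) + th *m v *m x.
exists (fun c => 1%:M + (c - 1) *: r); split.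
- move=> c c0; have [-> ->] := pair_piece_dp (c - 1) xv xtv.
  have -> : 1 + (c - 1) = c by rewrite addrC subrK.
  split=> //.
    by apply: lowkD; [exact: lowk_scalar | apply: lowkZ; exact: lowkD].
  apply: commD => //; apply: commZ; rewrite /comm /r mulmxDl mulmxDr addrC.
  by rewrite !mulmxA th2 mul1mx -!mulmxA th2 !mulmx1 addrC.
- by rewrite subrr scale0r addr0.
- by move=> h q; apply: affine_rational.
Qed.

(** Divides the corrector of type (1, 1) by the one of type (a, b): the exponents left are 1 - a = b
    and 1 - b = a. *)
Let corrector_swap a b : (a + b = 1)%N -> (exists K, corrector a b K) ->
  (exists K, corrector 1 1 K) -> exists K, corrector b a K.
Proof.
move=> ab [K [HK K1 KR]] [L [HL L1 LR]]; exists (fun s => L s *m K s^-1); split.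
- move=> s s0; have [lK cK pK mK] := HK _ (invr_neq0 s0); have [lL cL pL mL] := HL _ s0.
  split; [exact: lowkM | exact: commM | |].
    rewrite dpM // pK pL expr1; case: a b ab {HK KR pK mK} => [|[|a]] [|[|b]] //= _.
      by rewrite expr0 mulr1.
    by rewrite expr1 expr0 mulfV.
  rewrite dmM // mK mL expr1; case: a b ab {HK KR pK mK} => [|[|a]] [|[|b]] //= _.
    by rewrite expr1 expr0 mulfV.
  by rewrite expr0 mulr1.
- by rewrite invr1 K1 L1 mulmx1.
- move=> h q /[dup] /LR [R1 R2] /KR [R3 R4]; split; first exact: mxratlM.
  apply: mxratlM => // i j; apply: (eq_ratl _ (R3 i j)) => t.
  by rewrite invrK.
Qed.

Let path_comm u t : comm u -> comm (1%:M + t *: (u - 1%:M)).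
Proof.
move=> cu; apply: commD => //; apply: commZ; apply: commD => //.
by rewrite -scaleN1r; apply: commZ.
Qed.

Let path_low (u : 'M[F]_(m + n)) t : low u -> low (1%:M + t *: (u - 1%:M)).
Proof.
by move=> lu; apply: lowkD; [|apply: lowkZ; apply: lowkB => //]; exact: lowk_scalar.
Qed.

Let path_ratl h (u : 'M[F]_(m + n)) : mxratl h (fun t => 1%:M + t *: (u - 1%:M) : 'M_(m + n)).
Proof.
by apply: mxratlD; [|apply: mxratlZ; [exact: ratl_var|]]; exact: mxratl_const.
Qed.

Let dp_poly : polyfun dp.
Proof.
apply: (polyfun_comp (@polyfun_det F m)).
have P : polymap (fun X : 'M[F]_(m + n) => ulsubmx X).
  move=> i j; apply: (eq_polyfun _ (polyfun_entry F (lshift n i) (lshift n j))) => X.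
  by rewrite !mxE.
exact: (polymap_comp P (polymap_conj (invmx g) g)).
Qed.

Let dm_poly : polyfun dm.
Proof.
apply: (polyfun_comp (@polyfun_det F n)).
have P : polymap (fun X : 'M[F]_(m + n) => drsubmx X).
  move=> i j; apply: (eq_polyfun _ (polyfun_entry F (rshift m i) (rshift m j))) => X.
  by rewrite !mxE.
exact: (polymap_comp P (polymap_conj (invmx g) g)).
Qed.

Let path_dets (u : 'M[F]_(m + n)) : exists P Q : {poly F}, forall t,
  dp (1%:M + t *: (u - 1%:M)) = P.[t] /\ dm (1%:M + t *: (u - 1%:M)) = Q.[t].
Proof.
have [P HP] := ratl1_poly (ratl_polyfun dp_poly (path_ratl 1 u)).
have [Q HQ] := ratl1_poly (ratl_polyfun dm_poly (path_ratl 1 u)).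
by exists P, Q => t; rewrite HP HQ.
Qed.

(** Conjugation by [h] sends [th] to its opposite, so its trace m - n is 0; characteristic 0 gives
    the equality of integers. *)
Lemma anticommuting_eq_dim : anticommuting th 1%:M -> m = n.
Proof.
move=> [h [_ hh _ _ hth]].
have tth : \tr th = m%:R - n%:R.
  rewrite thE mxtrace_mulC mulmxA mulVmx // mul1mx mxtrace_block raddfN /=.
  by rewrite !mxtrace1.
have : \tr th = - \tr th.
  rewrite -{1}[th]mul1mx -hh -mulmxA mxtrace_mulC hth mulNmx -mulmxA hh mulmx1.
  by rewrite raddfN.
rewrite tth => E; have : (m%:R - n%:R : F) * 2 == 0 by rewrite mulr_natr mulr2n {2}E subrr.
rewrite mulf_eq0 (negPf char0_two) orbF subr_eq0.
have [mn|nm|//] := ltngtP m n.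
  rewrite eq_sym -subr_eq0 -natrB ?(ltnW mn) // natr_eq0 subn_eq0 => nm.
  by move: (leq_trans mn nm); rewrite ltnn.
rewrite -subr_eq0 -natrB ?(ltnW nm) // natr_eq0 subn_eq0 => mn.
by move: (leq_trans nm mn); rewrite ltnn.
Qed.

(* Along the line from [1] to [w], [dp] and [dm] are polynomials whose product
   is the determinant, i.e. [1]; hence they are constant. *)
Let unipotent_dp w : low w -> comm w -> (forall i, w i i = 1) -> dp w = 1.
Proof.
move=> lw cw dw; have [P [Q PQ]] := path_dets w.
have E : P * Q = 1.
  apply/eqP; rewrite -subr_eq0; apply/eqP/horner_eq0 => t.
  have [EP EQ] := PQ t; rewrite !hornerE.
  rewrite -EP -EQ -det_dpdm; last exact: path_comm.
  rewrite low_det; last exact: path_low.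
  by rewrite big1 ?subrr // => i _; rewrite !mxE eqxx dw mulr1n subrr mulr0 addr0.
have : size P == 1.
  have : P \is a GRing.unit by apply/unitrPr; exists Q.
  by rewrite poly_unitE => /andP[].
move=> /size_poly1P [c _ Pc].
have [P1 _] := PQ 1; have [P0 _] := PQ 0.
rewrite scale1r addrC subrK in P1; rewrite scale0r addr0 dp1 in P0.
by rewrite P1 Pc hornerC P0 Pc hornerC.
Qed.

(** [h] exchanges the two eigenspaces, so [dp] of h u h is [dm u]. As [h] is triangular of square 1,
    h u h u^-1 has unit diagonal, and its [dp] is 1. *)
Let anticommuting_dp u : anticommuting th 1%:M -> low u -> comm u -> u \in unitmx ->
  dp u = dm u.
Proof.
move=> ah lu cu uu; have mn := anticommuting_eq_dim ah; move: ah => [h [lh hh _ _ hth]].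
have h0s : cj h *m block_sign = - (block_sign *m cj h).
  by rewrite -cj_th -!cjM hth /cj mulmxN mulNmx.
have h00 : cj h *m cj h = 1%:M by rewrite -cjM hh cj1.
have cw : comm (h *m u *m h).
  have cu' : u *m th = th *m u := cu.
  by rewrite /comm -!mulmxA hth !mulmxN !mulmxA -(mulmxA h u th) cu' mulmxA hth !mulNmx opprK.
have dh : dp (h *m u *m h) = dm u.
  have Eu := comm_blk cu; rewrite /dp !cjM Eu.
  move: (cj h) h0s h00 => X; rewrite -[X]submxK !mulmx_block.
  rewrite !(mul1mx, mul0mx, mulmx0, mulmx1, addr0, add0r) !(mulmxN, mulNmx) !(mul1mx, mulmx1).
  rewrite opp_block_mx !opprK => /eq_block_mx [P0 _ _ Q0]; rewrite (eq_opp0 P0) (eq_opp0 (esym Q0)).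
  rewrite !(mul0mx, mulmx0, addr0, add0r) scalar_mx_block => /eq_block_mx [_ _ _ YX].
  by rewrite block_mxKul det_conj_rect.
have cV : comm (invmx u).
  have cu' : u *m th = th *m u := cu.
  by rewrite /comm; apply: (can_inj (mulKmx uu)); rewrite mulKVmx // mulmxA cu' mulmxK.
pose w := h *m u *m h *m invmx u.
have lV := lowk_inv uu lu.
have lhu : low (h *m u *m h) by apply: lowkM => //; apply: lowkM.
have w1 : dp w = 1.
  apply: unipotent_dp => [||i]; [exact: lowkM | exact: commM |].
  rewrite !low_mul_diag //; last exact: lowkM.
  have hi : h i i * h i i = 1 by rewrite -low_mul_diag // hh mxE eqxx.
  have ui : u i i * (invmx u) i i = 1 by rewrite -low_mul_diag // mulmxV // mxE eqxx.
  by rewrite -[RHS]ui -[RHS]mul1r -hi; ring.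
by rewrite -dh -[h *m u *m h](mulmxKV uu) dpM ?w1 ?mul1r //; apply: commM.
Qed.

Let corr_joined (X : mxset F (m + n)) (h : {poly F}) (c : F -> 'M[F]_(m + n)) u :
  lowSL u -> h.[0] = 1 -> h.[1] = 1 -> c 0 = 1%:M -> c 1 = u -> mxratl h c ->
  (forall t, h.[t] != 0 -> X (c t)) -> joined X 1%:M u.
Proof.
move=> Tu h0 h1 <- <- Rc Xc.
by apply: (joined_curve Rc Xc); rewrite ?h0 ?h1 oner_eq0.
Qed.

Let pieces : [/\ (0 < m)%N -> (exists K, corrector 1 0 K) \/ (exists K, corrector 1 1 K),
   (0 < n)%N -> (exists K, corrector 0 1 K) \/ (exists K, corrector 1 1 K) &
   [\/ exists K, corrector 1 0 K, exists K, corrector 0 1 K | anticommuting th 1%:M]].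
Proof.
have [||||I1 I2 I3] := @involution_peel _ _ th th2 char0_two (m + n) 1%:M.
- exact: lowk_scalar.
- by rewrite mulmx1.
- by rewrite mul1mx mulmx1.
- by move=> i j; rewrite leqNgt ltn_ord.
have m11 : (-1 == 1 :> F) = false.
  by apply/negbTE; rewrite eq_sym -subr_eq0 opprK char0_two.
have Lp : line_piece th 1 -> exists K, corrector 1 0 K.
  by move/line_corrector => /(_ (or_introl erefl)); rewrite eqxx.
have Lm : line_piece th (-1) -> exists K, corrector 0 1 K.
  by move/line_corrector => /(_ (or_intror erefl)); rewrite m11.
have sc (s : F) : th = s%:M -> block_sign = s%:M.
  by rewrite -cj_th => ->; rewrite /cj mul_mx_scalar -scalemxAl mulVmx // scalemx1.
split=> [m0|n0|].
- case: (classic (line_piece th 1)) => [/Lp|np]; first by left.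
  case: (classic (pair_piece th)) => [/pair_corrector|nr]; first by right.
  have := I1 np nr; rewrite mul1mx => E.
  have /sc : th = (-1)%:M by rewrite E -scaleN1r scalemx1.
  rewrite (scalar_mx_block m n) => /eq_block_mx [].
  move/(congr1 (fun X : 'M_m => X (Ordinal m0) (Ordinal m0))).
  by rewrite !mxE !eqxx => /eqP; rewrite eq_sym m11.
- case: (classic (line_piece th (-1))) => [/Lm|nm]; first by left.
  case: (classic (pair_piece th)) => [/pair_corrector|nr]; first by right.
  have := I2 nm nr; rewrite mul1mx => /sc.
  rewrite (scalar_mx_block m n) => /eq_block_mx [_ _ _].
  move/(congr1 (fun X : 'M_n => X (Ordinal n0) (Ordinal n0))).
  by rewrite !mxE !eqxx => /eqP; rewrite m11.
- case: (classic (line_piece th 1)) => [/Lp|np]; first by constructor 1.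
  case: (classic (line_piece th (-1))) => [/Lm|nm]; first by constructor 2.
  by constructor 3; apply: I3.
Qed.

Lemma SLxSL_joined u : (0 < m)%N -> (0 < n)%N -> lowSL u -> SLxSL (invmx g *m u *m g) ->
  joined (fun u => lowSL u /\ SLxSL (invmx g *m u *m g)) 1%:M u.
Proof.
move=> m0 n0 Tu /SLxSLE [cu du mu]; have [lu _] := Tu.
have [P [Q PQ]] := path_dets u.
pose c t := 1%:M + t *: (u - 1%:M).
have c0 : c 0 = 1%:M by rewrite /c scale0r addr0.
have c1 : c 1 = u by rewrite /c scale1r addrC subrK.
have P0 : P.[0] = 1 by have [<- _] := PQ 0; rewrite -/(c 0) c0 dp1.
have Q0 : Q.[0] = 1 by have [_ <-] := PQ 0; rewrite -/(c 0) c0 dm1.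
have P1 : P.[1] = 1 by have [<- _] := PQ 1; rewrite -/(c 1) c1.
have Q1 : Q.[1] = 1 by have [_ <-] := PQ 1; rewrite -/(c 1) c1.
have X_of v : low v -> comm v -> dp v = 1 -> dm v = 1 ->
    lowSL v /\ SLxSL (invmx g *m v *m g).
  move=> lv cv pv mv; split; first by split; rewrite ?det_dpdm // pv mv mulr1.
  exact/SLxSLE.
have H2 : (exists K, corrector 1 0 K) -> (exists K, corrector 0 1 K) ->
    joined (fun u => lowSL u /\ SLxSL (invmx g *m u *m g)) 1%:M u.
  move=> [K [HK K1 KR]] [L [HL L1 LR]].
  apply: (@corr_joined _ (P * Q) (fun t => c t *m K P.[t]^-1 *m L Q.[t]^-1)) => //.
  - by rewrite hornerE P0 Q0 mulr1.
  - by rewrite hornerE P1 Q1 mulr1.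
  - by rewrite P0 Q0 invr1 c0 K1 L1 !mulmx1.
  - by rewrite P1 Q1 invr1 c1 K1 L1 !mulmx1.
  - apply: mxratlM; last by have [] := LR (P * Q) Q (dvdp_mulIr _ _).
    by apply: mxratlM; [exact: path_ratl | have [] := KR (P * Q) P (dvdp_mulIl _ _)].
  - move=> t; rewrite hornerM mulf_eq0 negb_or => /andP[Pt Qt].
    have [lK cK pK mK] := HK _ (invr_neq0 Pt); have [lL cL pL mL] := HL _ (invr_neq0 Qt).
    have [EP EQ] := PQ t; have ct := path_comm t cu; have lt := path_low t lu.
    have cc := commM ct cK.
    apply: X_of; [by apply: lowkM => //; apply: lowkM|exact: commM| |].
      by rewrite !dpM // pK pL EP expr1 expr0 mulr1 mulfV.
    by rewrite !dmM // mK mL EQ expr1 expr0 mulr1 mulfV.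
have [Hm Hn Hmn] := pieces.
(* With a line piece of one sign, the corrector for the other determinant comes from [pieces]
   directly or by swapping with a pair. *)
case: Hmn => [E|E|ah].
- apply: H2 => //; case: (Hn n0) => // R; exact: (corrector_swap _ E R).
- apply: H2 => //; case: (Hm m0) => // R; exact: (corrector_swap _ E R).
case: (Hm m0) => [E|R]; first by apply: H2 => //; case: (Hn n0) => // R; exact: (corrector_swap _ E R).
case: R => [K [HK K1 KR]].
apply: (@corr_joined _ (P * Q) (fun t => c t *m K P.[t]^-1)) => //.
- by rewrite hornerE P0 Q0 mulr1.
- by rewrite hornerE P1 Q1 mulr1.
- by rewrite P0 invr1 c0 K1 !mulmx1.
- by rewrite P1 invr1 c1 K1 !mulmx1.
- by apply: mxratlM; [exact: path_ratl | have [] := KR (P * Q) P (dvdp_mulIl _ _)].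
- move=> t; rewrite hornerM mulf_eq0 negb_or => /andP[Pt Qt].
  have [lK cK pK mK] := HK _ (invr_neq0 Pt).
  have [EP EQ] := PQ t; have ct := path_comm t cu; have lt := path_low t lu.
  have EPQ : P.[t] = Q.[t].
    rewrite -EP -EQ; apply: anticommuting_dp => //.
    by rewrite unitmxE det_dpdm // EP EQ unitfE mulf_neq0.
  apply: X_of; [exact: lowkM|exact: commM| |].
    by rewrite !dpM // pK EP expr1 mulfV.
  by rewrite !dmM // mK EQ EPQ expr1 mulfV.
Qed.

(** Only the product of the determinants has to be corrected, so one line piece of either sign
    suffices. A pair would multiply the product by a square; [m != n] ensures that some line piece
    exists. *)
Lemma SGLxGL_joined u : m != n -> lowSL u -> SGLxGL (invmx g *m u *m g) ->
  joined (fun u => lowSL u /\ SGLxGL (invmx g *m u *m g)) 1%:M u.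
Proof.
move=> mn Tu /SGLxGLE [cu du]; have [lu _] := Tu.
have [P [Q PQ]] := path_dets u.
pose c t := 1%:M + t *: (u - 1%:M).
have c0 : c 0 = 1%:M by rewrite /c scale0r addr0.
have c1 : c 1 = u by rewrite /c scale1r addrC subrK.
have R0 : (P * Q).[0] = 1 by have [E1 E2] := PQ 0; rewrite hornerM -E1 -E2 -/(c 0) c0 dp1 dm1 mulr1.
have R1 : (P * Q).[1] = 1 by have [E1 E2] := PQ 1; rewrite hornerM -E1 -E2 -/(c 1) c1.
have [a [b [ab [K [HK K1 KR]]]]] : exists a b, (a + b = 1)%N /\ exists K, corrector a b K.
  have [_ _ [E|E|/anticommuting_eq_dim E]] := pieces; [by exists 1%N, 0 | by exists 0, 1%N |].
  by rewrite E eqxx in mn.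
apply: (@corr_joined _ (P * Q) (fun t => c t *m K (P * Q).[t]^-1)) => //.
- by rewrite R0 invr1 c0 K1 !mulmx1.
- by rewrite R1 invr1 c1 K1 !mulmx1.
- by apply: mxratlM; [exact: path_ratl | have [] := KR (P * Q) (P * Q) (dvdpp _)].
- move=> t Rt; have [lK cK pK mK] := HK _ (invr_neq0 Rt).
  have [EP EQ] := PQ t; have ct := path_comm t cu; have lt := path_low t lu.
  have cc := commM ct cK.
  have D : dp (c t *m K (P * Q).[t]^-1) * dm (c t *m K (P * Q).[t]^-1) = 1.
    rewrite dpM // dmM // pK mK EP EQ mulrACA -exprD ab expr1 -hornerM.
    by rewrite mulfV.
  split; first by split; [exact: lowkM | rewrite det_dpdm].
  exact/SGLxGLE.
Qed.

End TwoBlocks.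

(** * Triangular idempotents and skew forms *)

Section SkewPeel.
Variables (F : fieldType) (N : nat).
Hypothesis char2 : (2 : F) != 0.
Variables (J : 'M[F]_N) (eps : 'rV[F]_N).
Hypothesis skewJ : J^T = - J.
Implicit Types (E P p q : 'M[F]_N) (v w : 'cV[F]_N).

(* If [E] is self-adjoint for the form [J], [P] and [E - P] are adjoint to each
   other, so they project onto totally isotropic complements in the image of [E]. *)
Definition lagrangian_half E P : Prop :=
  [/\ low P, P *m P = P, P *m E = P, E *m P = P &
      P^T *m J = J *m (E - P) /\ eps *m (E - P) = 0].

Lemma skew_form_swap v w : v^T *m J *m w = - (w^T *m J *m v).
Proof.
have sym (X : 'M[F]_1) : X^T = X by apply/matrixP => i j; rewrite !ord1 mxE.
by rewrite -[LHS]sym !trmx_mul trmxK skewJ mulNmx mulmxN mulmxA.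
Qed.

Lemma skew_form0 v : v^T *m J *m v = 0.
Proof.
apply/eqP; have : (2 : F) *: (v^T *m J *m v) == 0.
  by rewrite scaler_nat mulr2n {2}skew_form_swap subrr.
by rewrite scalemx_eq0 (negPf char2).
Qed.

(** Of two adjoint pieces one joins [P] and the other its complement; [q = 0] covers a vector of the
    radical. *)
Lemma lagrangian_half_add E P p q : lagrangian_half (E - (p + q)) P ->
  E *m E = E -> low p -> p *m p = p -> p *m q = 0 -> q *m p = 0 ->
  E *m p = p -> p *m E = p -> E *m q = q -> q *m E = q ->
  p^T *m J = J *m q -> eps *m q = 0 -> lagrangian_half E (P + p).
Proof.
move=> [lP PP PE' E'P [PJ eP]] EE lp pp pq qp Ep pE Eq qE pJ eq.
have E'p : (E - (p + q)) *m p = 0 by rewrite mulmxBl Ep mulmxDl pp qp addr0 subrr.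
have pE' : p *m (E - (p + q)) = 0 by rewrite mulmxBr pE mulmxDr pp pq addr0 subrr.
have Pp : P *m p = 0 by rewrite -PE' -mulmxA E'p mulmx0.
have pP : p *m P = 0 by rewrite -E'P mulmxA pE' mul0mx.
have EE' : (E - (p + q)) *m E = E - (p + q) by rewrite mulmxBl EE mulmxDl pE qE.
have E'E : E *m (E - (p + q)) = E - (p + q) by rewrite mulmxBr EE mulmxDr Ep Eq.
have PE : P *m E = P by rewrite -PE' -mulmxA EE'.
have EP : E *m P = P by rewrite -E'P mulmxA E'E.
have D : E - (P + p) = E - (p + q) - P + q by mxabel.
split; [exact: lowkD | | | | split].
- by rewrite mulmxDl !mulmxDr PP Pp pP pp addr0 add0r.
- by rewrite mulmxDl PE pE.
- by rewrite mulmxDr EP Ep.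
- by rewrite D [RHS]mulmxDr linearD /= mulmxDl PJ pJ.
- by rewrite D mulmxDr eP eq addr0.
Qed.

(** Peeling with the form in place of the involution. The last nonzero column [v] of [E] is in the
    radical and joins [P] alone, or it pairs to 1 with some [w] in the image of [E], and the
    projections [p] and [q] onto the lines of [w] and [v] are adjoint. *)
Lemma lagrangian_peel a E : low E -> E *m E = E -> E^T *m J = J *m E ->
  zero_from a E -> exists P, lagrangian_half E P.
Proof.
elim: a E => [|a IH] E lE EE EJ zE.
  have E0 : E = 0 by apply/matrixP => i j; rewrite zE ?mxE.
  exists 0; rewrite /lagrangian_half E0 trmx0 subrr !mul0mx !mulmx0; split=> //.
  by move=> i j _ _; rewrite mxE.
have [Na|aN] := leqP N a.
  by apply: IH => // i j aj; move: (leq_trans Na aj); rewrite leqNgt ltn_ord.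
pose ia := Ordinal aN; have [v0|v0] := eqVneq (col ia E) 0.
  apply: IH => // i j; rewrite leq_eqVlt => /orP[/eqP aj|]; last exact: zE.
  have -> : j = ia by apply/val_inj.
  by have /colP/(_ i) := v0; rewrite !mxE.
have zE' : zero_from ia.+1 E by [].
have va1 := idem_diag lE EE zE' v0.
have Ev := idem_col ia EE; have vlow := low_col_zero (a := ia) lE.
have vcol i (j : 'I_N) : (a <= j)%N -> E i j = (j == ia)%:R * (col ia E) i 0.
  rewrite leq_eqVlt => /orP[/eqP aj|aj].
    have -> : j = ia by apply/val_inj.
    by rewrite eqxx mul1r mxE.
  by rewrite zE // -val_eqE /= gtn_eqF // mul0r.
have xE0 (x : 'rV_N) : x *m E = x -> forall j : 'I_N, (a < j)%N -> x 0 j = 0.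
  by move=> xE; apply: row_zero_from xE.
move vE : (col ia E) v0 va1 Ev vlow vcol => v v0 va1 Ev vlow vcol.
have zsub (x : 'rV_N) (r : 'M_N) : x *m E = x -> x *m v = 1%:M ->
    (forall i (j : 'I_N), (a <= j)%N -> r i j = v i 0 * x 0 j) -> zero_from a (E - r).
  move=> xE xv Hr i j aj; rewrite !mxE Hr // vcol //.
  move: aj; rewrite leq_eqVlt => /orP[/eqP aj|aj].
    have -> : j = ia by apply/val_inj.
    by rewrite (mul_col_entry (c := 1) xE) ?vE // eqxx mul1r mulr1 subrr.
  by rewrite (xE0 _ xE) // mulr0 subr0 -val_eqE /= gtn_eqF // mul0r.
have formE (w : 'cV_N) : E *m w = w -> w^T *m J *m E = w^T *m J.
  by move=> Ew; rewrite -mulmxA -EJ mulmxA -trmx_mul Ew.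
have Jtr (w : 'cV_N) : (w^T *m J)^T = - (J *m w).
  by rewrite trmx_mul trmxK skewJ mulNmx.
pose x := v^T *m J.
have xE : x *m E = x by apply: formE.
have xv : x *m v = 0 by apply: skew_form0.
have [x0|x0] := eqVneq x 0.
  have Jv : J *m v = 0 by rewrite -[_ *m _]opprK -Jtr -/x x0 trmx0 oppr0.
  pose y := row ia E; pose e := v *m y.
  have yE : y *m E = y by apply: idem_row.
  have yv : y *m v = 1%:M by rewrite row_mul_entry // va1.
  have le : low e by apply: (low_outer (a := a)) => //; apply: xE0.
  have ee : e *m e = e by rewrite /e (outer_mul _ _ yv) scale1r.
  have Ee : E *m e = e by rewrite /e mulmxA Ev.
  have eE : e *m E = e by rewrite /e -mulmxA yE.
  have eJ : e^T *m J = 0 by rewrite /e trmx_mul -mulmxA -/x x0 mulmx0.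
  have Je : J *m e = 0 by rewrite /e mulmxA Jv mul0mx.
  have [||||P HP] := IH (E - (e + 0)); rewrite ?addr0.
  - exact: lowkB.
  - exact: sub_idem.
  - by rewrite linearB /= mulmxBl eJ EJ mulmxBr Je.
  - by apply: (zsub y) => // i j _; rewrite mxE big_ord1.
  exists (P + e); apply: (lagrangian_half_add HP) => //; rewrite ?mulmx0 ?mul0mx //.
have [b xb xbl] := last_nz x0.
(* The coordinate of [x] at [a] is [x *m v], which is 0 because the form is alternating. *)
have ba : (b < a)%N.
  rewrite ltnNge; apply/negP; rewrite leq_eqVlt => /orP[/eqP ab|ab].
    have Eb : b = ia by apply/val_inj.
    by move/eqP: xb; apply; rewrite Eb; apply: mul_col_entry xE _; rewrite vE xv raddf0.
  by move/eqP: xb; apply; exact: xE0.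
pose w0 := (x 0 b)^-1 *: col b E.
have Ew0 : E *m w0 = w0 by rewrite /w0 -scalemxAr idem_col.
have xw0 : x *m w0 = 1%:M.
  rewrite /w0 -scalemxAr colE mulmxA xE -colE.
  have -> : col b x = (x 0 b)%:M by apply/matrixP => i j; rewrite !ord1 mxE [RHS]mxE eqxx.
  by rewrite scale_scalar_mx mulVf.
have w0low (i : 'I_N) : (i < b)%N -> w0 i 0 = 0.
  by move=> ib; rewrite mxE (low_col_zero lE) ?mulr0.
(* Subtracting a multiple of [v] makes [eps] vanish on [v] or on [w]; the projection onto that line
   is the one left out of [P]. *)
clearbody w0; have [w [Ew xw wlow we]] : exists w, [/\ E *m w = w, x *m w = 1%:M,
    forall i : 'I_N, (i < b)%N -> w i 0 = 0 & eps *m v = 0 \/ eps *m w = 0].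
  have [ev|ev] := eqVneq (eps *m v) 0; first by exists w0; split=> //; left.
  pose c := (eps *m w0) 0 0 / (eps *m v) 0 0.
  have ev0 : (eps *m v) 0 0 != 0.
    by apply: contraNneq ev => E0; rewrite [_ *m _]mx11_scalar E0 raddf0.
  exists (w0 - c *: v); split.
  - by rewrite mulmxBr Ew0 -scalemxAr Ev.
  - by rewrite mulmxBr xw0 -scalemxAr xv scaler0 subr0.
  - by move=> i ib; rewrite mxE [X in _ + X]mxE [X in _ - X]mxE w0low // vlow ?(ltn_trans ib) // mulr0 subrr.
  - right; rewrite mulmxBr -scalemxAr [eps *m w0]mx11_scalar [eps *m v]mx11_scalar.
    by rewrite scale_scalar_mx divfK // subrr.
pose y := - (w^T *m J).
have yE : y *m E = y by rewrite mulNmx formE.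
have yv : y *m v = 1%:M by rewrite mulNmx -skew_form_swap.
have yw : y *m w = 0 by rewrite mulNmx skew_form0 oppr0.
pose p := w *m x; pose q := v *m y.
have lp : low p by apply: (low_outer (a := b)).
have lq : low q by apply: (low_outer (a := a)) => //; apply: xE0.
have pp : p *m p = p by rewrite /p (outer_mul _ _ xw) scale1r.
have qq : q *m q = q by rewrite /q (outer_mul _ _ yv) scale1r.
have pq : p *m q = 0 by rewrite /p /q mulmxA -(mulmxA w) xv mulmx0 mul0mx.
have qp : q *m p = 0 by rewrite /p /q mulmxA -(mulmxA v) yw mulmx0 mul0mx.
have Ep : E *m p = p by rewrite /p mulmxA Ew.
have pE : p *m E = p by rewrite /p -mulmxA xE.
have Eq : E *m q = q by rewrite /q mulmxA Ev.
have qE : q *m E = q by rewrite /q -mulmxA yE.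
have pJ : p^T *m J = J *m q.
  by rewrite /p /q trmx_mul Jtr !mulNmx -!mulmxA /y !mulmxN.
have qJ : q^T *m J = J *m p.
  by rewrite /p /q trmx_mul linearN /= Jtr opprK -mulmxA -/x mulmxA.
have [||||P HP] := IH (E - (p + q)).
- by apply: lowkB => //; apply: lowkD.
- apply: sub_idem => //; first by rewrite mulmxDl !mulmxDr pp pq qp qq addr0 add0r.
    by rewrite mulmxDr Ep Eq.
  by rewrite mulmxDl pE qE.
- by rewrite linearB linearD /= mulmxBl mulmxDl EJ pJ qJ mulmxBr mulmxDr [J *m q + _]addrC.
- apply: (zsub y) => // i j aj; rewrite mxE [X in X + _]mxE [X in _ + X]mxE !big_ord1.
  by rewrite (xbl j (leq_trans ba aj)) mulr0 add0r.
case: we => [ev|ew].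
  exists (P + p); apply: (lagrangian_half_add HP) => //.
  by rewrite /q mulmxA ev mul0mx.
rewrite [p + q]addrC in HP; exists (P + q); apply: (lagrangian_half_add HP) => //.
by rewrite /p mulmxA ew mul0mx.
Qed.

End SkewPeel.

(** * Isometries of skew forms *)

Section Isometry.
Variable F : closedFieldType.
Hypothesis char2 : (2 : F) != 0.

(** The determinant takes the values 1 and -1 only, hence is constant along the curve. Thus only the
    square of the determinant of an isometry is ever computed, and Pfaffians are avoided. *)
Lemma joined_curve_det N (Y : mxset F N) (g : {poly F}) (c : F -> 'M[F]_N) s t :
  (forall A, Y A -> \det A * \det A = 1) -> mxratl g c ->
  (forall u, g.[u] != 0 -> Y (c u)) -> g.[s] != 0 -> g.[t] != 0 -> \det (c s) = 1 ->
  joined (fun A => Y A /\ \det A = 1) (c s) (c t).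
Proof.
move=> Yd Rc Yc gs gt ds.
have g0 : g != 0 by apply: contraNneq gs => ->; rewrite horner0.
have Rd := ratl_polyfun (@polyfun_det F N) Rc.
have [|||H|H] := @ratl_mul_eq0 F g (fun u => \det (c u) + - 1) (fun u => \det (c u) + 1) g0.
- by apply: ratlD => //; exact: ratl_const.
- by apply: ratlD => //; exact: ratl_const.
- move=> u gu; have -> : (\det (c u) + - 1) * (\det (c u) + 1) = \det (c u) * \det (c u) - 1 by ring.
  by rewrite Yd ?subrr //; apply: Yc.
- apply: (joined_curve Rc) => // u gu; split; first exact: Yc.
  by apply/eqP; rewrite -subr_eq0 H.
- by have /eqP := H s gs; rewrite ds -[1 + 1]/(2 : F) (negPf char2).
Qed.

(* [horner_mx y e] is the Fitting idempotent of [y] for the eigenvalue 0. *)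
Lemma fitting_idempotent N (y : 'M[F]_N.+1) : exists k (e z : {poly F}),
  e + z * 'X^(k.+1) = 1 /\ horner_mx y (e * 'X^(k.+1)) = 0.
Proof.
pose p := 'X * char_poly y.
have p0 : p != 0 by rewrite mulf_neq0 ?polyX_eq0 // monic_neq0 ?char_poly_monic.
have [k [r r0 Er]] := multiplicity_XsubC p 0; rewrite p0 /= subr0 in r0 Er.
have k0 : (0 < k)%N.
  rewrite lt0n; apply: contraNneq r0 => k0; rewrite k0 expr0 mulr1 in Er.
  by rewrite -Er /p rootE hornerM hornerX mul0r.
have cop : coprimep r 'X^k.
  by rewrite coprimep_expr // coprimepX.
have /Bezout_eq1_coprimepP [[u w] /= uw] := cop.
exists k.-1, (u * r), w; rewrite prednK //; split=> //.
by rewrite -mulrA -Er /p !rmorphM /= (Cayley_Hamilton y) !mulr0.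
Qed.

Section Form.
Variables (N : nat) (J : 'M[F]_N) (eps : 'rV[F]_N) (kap : 'cV[F]_N).
Hypothesis skewJ : J^T = - J.

(** Covers both embeddings of Sp(2n): [eps] and [kap] are 0 in SL(2n); in SL(2n+1) the form is
    degenerate with radical spanned by [kap], and [eps] is the last coordinate. *)
Definition isometry (h : 'M[F]_N) : Prop :=
  [/\ h^T *m J *m h = J, eps *m h = eps & h *m kap = kap].

Hypothesis isometry_det : forall h, isometry h -> \det h * \det h = 1.

Lemma isometryM h k : isometry h -> isometry k -> isometry (h *m k).
Proof.
move=> [hJ eh hk] [kJ ek kk]; split.
- have -> : (h *m k)^T *m J *m (h *m k) = k^T *m (h^T *m J *m h) *m k.
    by rewrite trmx_mul !mulmxA.
  by rewrite hJ.
- by rewrite mulmxA eh.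
- by rewrite -mulmxA kk.
Qed.

(* The path [A t / B t] is a Cayley transform of [t (f - 1) / (f + 1)]. *)
Lemma cayley_joined f : isometry f -> low f -> \det f = 1 -> f + 1%:M \in unitmx ->
  joined (fun h => (low h /\ isometry h) /\ \det h = 1) 1%:M f.
Proof.
move=> [fJ ef fk] lf df uf.
have ufm := det1_unit df.
pose A t := (1 + t) *: f + (1 - t)%:M; pose B t := (1 - t) *: f + (1 + t)%:M.
have BE t : B t = (f + 1%:M) + t *: (1%:M - f).
  by rewrite /B; apply/matrixP => i j; rewrite !mxE; case: (i == j); rewrite ?mulr1n ?mulr0n; ring.
have [q Hq] := affine_det (f + 1%:M) (1%:M - f).
have qB t : q.[t] = \det (B t) by rewrite BE Hq.
pose c t := A t *m invmx (B t).
have uB t : q.[t] != 0 -> B t \in unitmx by rewrite qB unitmxE unitfE.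
have A0 : A 0 = B 0 by rewrite /A /B addr0 subr0.
have q0 : q.[0] != 0 by rewrite qB BE scale0r addr0 -unitfE -unitmxE.
have B1 : B 1 = 2%:M by rewrite /B subrr scale0r add0r.
have A1 : A 1 = 2 *: f by rewrite /A subrr raddf0 addr0.
have q1 : q.[1] != 0 by rewrite qB B1 det_scalar expf_neq0.
have c0 : c 0 = 1%:M by rewrite /c A0 mulmxV // uB.
have c1 : c 1 = f.
  by rewrite /c A1 B1 invmx_scalar mul_mx_scalar scalerA mulVf // scale1r.
rewrite -c0 -[X in joined _ _ X]c1.
apply: (@joined_curve_det _ (fun h => low h /\ isometry h) q) => //; last by rewrite c0 det1.
- by move=> h [_ /isometry_det].
- have RA (a b : F -> F) : ratl q a -> ratl q b -> mxratl q (fun t => a t *: f + (b t)%:M).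
    move=> Ra Rb; apply: mxratlD; first by apply: mxratlZ => //; exact: mxratl_const.
    have R := mxratlZ Rb (mxratl_const q (1%:M : 'M_N)).
    by move=> i j; apply: (eq_ratl _ (R i j)) => t; rewrite scalemx1.
  have R1 : ratl q (fun t => 1 + t) by apply: ratlD; [exact: ratl_const | exact: ratl_var].
  have R2 : ratl q (fun t => 1 - t).
    apply: (eq_ratl _ (ratlD (ratl_const q 1) (ratlM (ratl_const q (-1)) (ratl_var q)))) => t.
    by rewrite mulN1r.
  have RB := mxratlZ (ratl_inv (dvdpp q)) (mxratl_polymap (@polymap_adj F N) (RA _ _ R2 R1)).
  have R := mxratlM (RA _ _ R1 R2) RB.
  move=> i j; have [k [p Hp]] := R i j; exists k, p => t qt; rewrite -Hp // /c /invmx uB //.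
  by rewrite qB.
- move=> t qt; have uBt := uB t qt.
  have lA : low (A t) by apply: lowkD; [exact: lowkZ | exact: lowk_scalar].
  have lB : low (B t) by apply: lowkD; [exact: lowkZ | exact: lowk_scalar].
  split; first by apply: lowkM => //; exact: lowk_inv.
  (* Symmetric in [a] and [b], which are exchanged between [A t] and [B t]: both transform [J] in
     the same way, so the quotient is an isometry. *)
  have form a b : (a *: f + b%:M)^T *m J *m (a *: f + b%:M) =
      (a * a + b * b) *: J + (a * b) *: (f^T *m J + J *m f).
    have -> : (a *: f + b%:M)^T = a *: f^T + b%:M.
      by apply/matrixP => i j; rewrite !mxE eq_sym.
    rewrite !mulmxDl !mulmxDr !mul_scalar_mx !mul_mx_scalar.
    do ![rewrite -scalemxAl | rewrite -scalemxAr]; rewrite fJ; mxabel.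
  split.
  - have E : (A t)^T *m J *m A t = (B t)^T *m J *m B t.
      rewrite /A /B !form; congr (_ + _); congr (_ *: _); ring.
    rewrite /c trmx_mul trmx_inv !mulmxA -(mulmxA _ _ J) -(mulmxA _ _ (A t)) E.
    by rewrite !mulmxA mulVmx ?unitmx_tr // mul1mx mulmxK.
  - have [eA eB] : eps *m A t = 2 *: eps /\ eps *m B t = 2 *: eps.
      rewrite /A /B !mulmxDr -!scalemxAr ef !mul_mx_scalar -!scalerDl.
      by split; congr (_ *: _); ring.
    by rewrite /c mulmxA eA -eB mulmxK.
  - have [kA kB] : A t *m kap = 2 *: kap /\ B t *m kap = 2 *: kap.
      rewrite /A /B !mulmxDl -!scalemxAl fk !mul_scalar_mx -!scalerDl.
      by split; congr (_ *: _); ring.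
    have BV : invmx (B t) *m kap = 2^-1 *: kap.
      apply: (can_inj (mulKmx uBt)); rewrite mulKVmx // -scalemxAr kB scalerA mulVf //.
      by rewrite scale1r.
    by rewrite /c -mulmxA BV -scalemxAr kA scalerA mulVf // scale1r.
Qed.

(** Taking adjoints exchanges [P] and [E - P], that is [t] and its inverse: the adjoint of this
    matrix is its inverse. *)
Lemma lagrangian_half_isometry E P t : E *m E = E -> lagrangian_half J eps E P ->
  E^T *m J = J *m E -> eps *m E = 0 -> E *m kap = 0 -> t != 0 ->
  isometry (1%:M - E + t *: P + t^-1 *: (E - P)).
Proof.
move=> EE [_ PP PE EP [PJ _]] EJ eE Ek t0; pose Q := E - P.
have PQ : P *m Q = 0 by rewrite mulmxBr PE PP subrr.
have QP : Q *m P = 0 by rewrite mulmxBl EP PP subrr.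
have QE : Q *m E = Q by rewrite mulmxBl EE PE.
have EQ : E *m Q = Q by rewrite mulmxBr EE EP.
have QQ : Q *m Q = Q by rewrite {1}/Q mulmxBl EQ PQ subr0.
have QJ : Q^T *m J = J *m P.
  by rewrite linearB /= mulmxBl EJ PJ -mulmxBr /Q opprB addrC subrK.
have eP : eps *m P = 0 by rewrite -EP mulmxA eE mul0mx.
have Pk : P *m kap = 0 by rewrite -PE -mulmxA Ek mulmx0.
have eQ : eps *m Q = 0 by rewrite mulmxBr eE eP subr0.
have Qk : Q *m kap = 0 by rewrite mulmxBl Ek Pk subr0.
have sum1 : 1%:M - E + Q + P = 1%:M by rewrite /Q; mxabel.
have PJ' : P^T *m J = J *m Q := PJ.
rewrite -/Q; clearbody Q.
have DJ : (1%:M - E + t *: P + t^-1 *: Q)^T *m J = J *m (1%:M - E + t *: Q + t^-1 *: P).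
  have -> : (1%:M - E + t *: P + t^-1 *: Q)^T = 1%:M - E^T + t *: P^T + t^-1 *: Q^T.
    by apply/matrixP => i j; rewrite !mxE eq_sym.
  rewrite !mulmxDl mulNmx -!scalemxAl mul1mx EJ PJ' QJ.
  by rewrite !mulmxDr mulmxN -!scalemxAr mulmx1.
split.
- rewrite DJ -mulmxA; suff -> : (1%:M - E + t *: Q + t^-1 *: P) *m
      (1%:M - E + t *: P + t^-1 *: Q) = 1%:M by rewrite mulmx1.
  rewrite !mulmxDl !mulmxDr !mul1mx !(mulmxN, mulNmx) !mulmx1.
  do ![rewrite -scalemxAl | rewrite -scalemxAr].
  rewrite EE EP PE EQ QE QQ PP PQ QP !scaler0 !scalerA mulfV // mulVf // !scale1r.
  by rewrite -[RHS]sum1; mxabel.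
- by rewrite !mulmxDr mulmxN -!scalemxAr eE eP eQ !scaler0 subr0 !addr0 mulmx1.
- by rewrite !mulmxDl mulNmx -!scalemxAl Ek Pk Qk !scaler0 subr0 !addr0 mul1mx.
Qed.

End Form.

Section Algebra.
Variables (N : nat).
Local Notation M := N.+1.
Variables (y : 'M[F]_M).

Lemma low_horner p : low y -> low (horner_mx y p).
Proof.
move=> ly; elim/poly_ind: p => [|p c IH]; first by rewrite rmorph0 => i j _ _; rewrite mxE.
rewrite rmorphD rmorphM /= horner_mx_X horner_mx_C.
by apply: lowkD; [exact: lowkM | exact: lowk_scalar].
Qed.

Lemma horner_mx_row p (x : 'rV[F]_M) a : x *m y = a *: x -> x *m horner_mx y p = p.[a] *: x.
Proof.
move=> xy; elim/poly_ind: p => [|p c IH]; first by rewrite rmorph0 mulmx0 horner0 scale0r.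
rewrite rmorphD rmorphM /= horner_mx_X horner_mx_C mulmxDr mulmxA IH -scalemxAl xy.
by rewrite scalerA mul_mx_scalar -scalerDl hornerMXaddC.
Qed.

Lemma horner_mx_col p (x : 'cV[F]_M) a : y *m x = a *: x -> horner_mx y p *m x = p.[a] *: x.
Proof.
move=> yx; elim/poly_ind: p => [|p c IH]; first by rewrite rmorph0 mul0mx horner0 scale0r.
rewrite rmorphD rmorphM /= horner_mx_X horner_mx_C mulmxDl -mulmxA yx -scalemxAr IH.
by rewrite scalerA mul_scalar_mx -scalerDl hornerMXaddC mulrC.
Qed.

Lemma horner_mx_commute p (h : 'M[F]_M) : h *m y = y *m h ->
  h *m horner_mx y p = horner_mx y p *m h.
Proof.
move=> hy; elim/poly_ind: p => [|p c IH].
  by rewrite rmorph0 mul0mx mulmx0.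
rewrite rmorphD rmorphM /= horner_mx_X horner_mx_C mulmxDr mulmxDl scalar_mxC mulmxA IH.
by rewrite -!mulmxA hy.
Qed.

Lemma horner_mx_adj p (J : 'M[F]_M) : y^T *m J = J *m y ->
  (horner_mx y p)^T *m J = J *m horner_mx y p.
Proof.
move=> yJ; elim/poly_ind: p => [|p c IH].
  by rewrite rmorph0 trmx0 mul0mx mulmx0.
rewrite rmorphD rmorphM /= horner_mx_X horner_mx_C linearD /= trmx_mul tr_scalar_mx.
rewrite mulmxDl mulmxDr mul_scalar_mx mul_mx_scalar -mulmxA IH mulmxA yJ -mulmxA; congr (J *m _ + _).
by rewrite (horner_mx_commute p (erefl (y *m y))).
Qed.

End Algebra.

Theorem isometry_joined N (J : 'M[F]_N) (eps : 'rV[F]_N) (kap : 'cV[F]_N) h :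
  J^T = - J -> (forall h, isometry J eps kap h -> \det h * \det h = 1) ->
  low h -> isometry J eps kap h -> \det h = 1 ->
  joined (fun h => (low h /\ isometry J eps kap h) /\ \det h = 1) 1%:M h.
Proof.
case: N J eps kap h => [|N] J eps kap h skewJ dJ lh ih dh.
  have E : h = 1%:M by rewrite [LHS]flatmx0 [RHS]flatmx0.
  by rewrite E in lh ih dh *; split.
have uh := det1_unit dh; have [hJ eh hk] := ih.
have lV := lowk_inv uh lh.
have hTJ : h^T *m J = J *m invmx h by rewrite -[in RHS]hJ mulmxK.
have hVJ : (invmx h)^T *m J = J *m h.
  have uT : h^T \in unitmx by rewrite unitmx_tr.
  by apply: (can_inj (mulKmx uT)); rewrite trmx_inv mulKVmx // mulmxA.
have eV : eps *m invmx h = eps by rewrite -{1}eh mulmxK.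
have Vk : invmx h *m kap = kap by rewrite -{1}hk mulKmx.
(* This is h^-1 (h + 1)^2. Unlike [h + 1] it is self-adjoint, so its Fitting idempotent at 0, a
   polynomial in [y], is triangular, self-adjoint and commutes with [h]. *)
pose y := h + invmx h + 2%:M.
have ly : low y by apply: lowkD; [exact: lowkD | exact: lowk_scalar].
have yJ : y^T *m J = J *m y.
  have -> : y^T = h^T + (invmx h)^T + 2%:M by rewrite /y !linearD /= tr_scalar_mx.
  by rewrite !mulmxDl !mulmxDr hTJ hVJ [J *m invmx h + _]addrC scalar_mxC.
have hy : h *m y = y *m h.
  by rewrite !mulmxDl !mulmxDr mulmxV // mulVmx // scalar_mxC.
have four : (4 : F) != 0 by rewrite -[4]/((2 * 2)%N%:R) natrM mulf_neq0.
(* [h] fixes [eps] and [kap], so [y] acts on them by 1 + 1 + 2, which is nonzero; hence [E] kills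
   them. *)
have ey : eps *m y = 4 *: eps.
  by rewrite !mulmxDr eh eV mul_mx_scalar -{1 2}[eps]scale1r -!scalerDl; congr (_ *: _); ring.
have yk : y *m kap = 4 *: kap.
  by rewrite !mulmxDl hk Vk mul_scalar_mx -{1 2}[kap]scale1r -!scalerDl; congr (_ *: _); ring.
have [k [e [z [ez E0]]]] := fitting_idempotent y.
pose E := horner_mx y e.
have Ey0 : E *m horner_mx y 'X^(k.+1) = 0 by rewrite /E -[LHS]/(horner_mx y e * _) -rmorphM.
have Xk : horner_mx y 'X^(k.+1) = y ^+ k.+1 by rewrite rmorphXn /= horner_mx_X.
have hE := horner_mx_commute e hy : h *m E = E *m h.
have lE : low E by apply: low_horner.
have EJ : E^T *m J = J *m E by apply: horner_mx_adj.
have four' : ('X^(k.+1) : {poly F}).[4] != 0 by rewrite hornerXn expf_neq0.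
have eE : eps *m E = 0.
  have e4 : e.[4] *: eps = 0.
    have : ('X^(k.+1)).[4] *: (e.[4] *: eps) = 0.
      by rewrite scalerA mulrC -hornerM -(horner_mx_row _ ey) E0 mulmx0.
    by move/eqP; rewrite scalemx_eq0 (negPf four') => /eqP.
  by rewrite (horner_mx_row _ ey).
have Ek : E *m kap = 0.
  have e4 : e.[4] *: kap = 0.
    have : ('X^(k.+1)).[4] *: (e.[4] *: kap) = 0.
      by rewrite scalerA mulrC -hornerM -(horner_mx_col _ yk) E0 mul0mx.
    by move/eqP; rewrite scalemx_eq0 (negPf four') => /eqP.
  by rewrite (horner_mx_col _ yk).
have E1 : 1%:M - E = horner_mx y (z * 'X^(k.+1)).
  have -> : z * 'X^(k.+1) = 1 - e by rewrite -ez addrAC subrr add0r.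
  by rewrite rmorphB [X in _ = X - _]rmorph1.
have EE : E *m E = E.
  have : E *m (1%:M - E) = 0.
    by rewrite E1 -[LHS]/(horner_mx y e * _) -rmorphM mulrCA rmorphM /= E0 mulr0.
  by rewrite mulmxBr mulmx1 => /eqP; rewrite subr_eq0 => /eqP <-.
pose f := (1%:M - 2 *: E) *m h.
have [P HP] : exists P, lagrangian_half J eps E P.
  apply: (lagrangian_peel char2 eps skewJ (a := N.+1) lE EE EJ) => i j.
  by rewrite leqNgt ltn_ord.
have iD (t : F) : t != 0 -> isometry J eps kap (1%:M - E + t *: P + t^-1 *: (E - P)).
  exact: lagrangian_half_isometry.
have lP : low P by case: HP.
pose d t := 1%:M - E + t *: P + t^-1 *: (E - P).
have d1 : d 1 = 1%:M by rewrite /d invr1 !scale1r; mxabel.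
have dm1 : d (-1) = 1%:M - 2 *: E.
  by rewrite /d invrN1 !scaleN1r; mxabel.
have id_ t : t != 0 -> isometry J eps kap (d t *m h) by move=> t0; apply: isometryM => //; exact: iD.
have Jf : joined (fun h => (low h /\ isometry J eps kap h) /\ \det h = 1) h f.
  rewrite /f -dm1 -{1}[h]mul1mx -d1.
  apply: (@joined_curve_det _ (fun h => low h /\ isometry J eps kap h) 'X (fun t => d t *m h)).
  - by move=> A [_ /dJ].
  - apply: mxratlM; last exact: mxratl_const.
    apply: mxratlD; first apply: mxratlD; first exact: mxratl_const.
      by apply: mxratlZ; [exact: ratl_var | exact: mxratl_const].
    apply: mxratlZ; last exact: mxratl_const.
    by apply: (eq_ratl _ (ratl_inv (dvdpp 'X))) => t; rewrite hornerX.
  - move=> t; rewrite hornerX => t0; split; last exact: id_.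
    apply: lowkM => //; apply: lowkD; first apply: lowkD.
    + by apply: lowkB => //; exact: lowk_scalar.
    + exact: lowkZ.
    + by apply: lowkZ; exact: lowkB.
  - by rewrite hornerX oner_eq0.
  - by rewrite hornerX oppr_eq0 oner_eq0.
  - by rewrite d1 mul1mx.
have [_ [[lf jf] df] _] := Jf.
(* Let x f = - x. Then x E is fixed by [h], so [y] multiplies it by 4, yet a power of [y] kills it:
   x E = 0. Hence x h = - x and x y = 0, so [1 - E], a multiple of a power of [y], kills [x] as
   well. *)
suff uf : f + 1%:M \in unitmx by apply: joined_trans (joined_sym Jf); exact: cayley_joined.
rewrite -row_free_unit -kermx_eq0; apply/eqP/row_matrixP => i; rewrite row0.
have : row i (kermx (f + 1%:M)) *m (f + 1%:M) = 0 by rewrite -row_mul mulmx_ker row0.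
move: (row _ _) => x; rewrite mulmxDr mulmx1 => xf.
have xE : x *m E = 0.
  have xEh : x *m E *m h = x *m E.
    have := congr1 (mulmx^~ E) xf; rewrite /= mul0mx mulmxDl /f -!mulmxA hE.
    rewrite (mulmxA _ E h) mulmxBl mul1mx -scalemxAl EE => /eqP.
    rewrite addr_eq0 => /eqP; rewrite mulmxA.
    have -> : E - 2 *: E = - E by mxabel.
    by rewrite mulmxN mulNmx -mulmxA => /oppr_inj.
  have xEV : x *m E *m invmx h = x *m E by rewrite -{1}xEh mulmxK.
  have xEy : x *m E *m y = 4 *: (x *m E).
    rewrite !mulmxDr xEh xEV mul_mx_scalar -{1 2}[x *m E]scale1r -!scalerDl.
    by congr (_ *: _); ring.
  apply/eqP; have : ('X^(k.+1)).[4] *: (x *m E) == 0.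
    by rewrite -(horner_mx_row _ xEy) -mulmxA Ey0 mulmx0.
  by rewrite scalemx_eq0 (negPf four').
have xh : x *m h = - x.
  apply/eqP; rewrite -addr_eq0 -xf /f mulmxA mulmxBr mulmx1 -scalemxAr xE scaler0 subr0.
  by [].
have xV : x *m invmx h = - x by rewrite -[LHS]opprK -mulNmx -xh mulmxK.
have xy : x *m y = 0 *: x.
  by rewrite !mulmxDr xh xV mul_mx_scalar scale0r; mxabel.
have := congr1 (mulmx x) E1; rewrite mulmxBr mulmx1 xE subr0 (horner_mx_row _ xy).
by rewrite hornerM hornerXn exprS mul0r mulr0 scale0r.
Qed.

End Isometry.

(** * The subgroups Sp(2n) and Sp(2n) x T^1 *)

Section SymplecticCases.
Variable F : closedFieldType.
Hypothesis char2 : (2 : F) != 0.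

Lemma trmx_scale a b c (A : 'M[F]_(a, b)) : (c *: A)^T = c *: A^T.
Proof. by rewrite linearZ. Qed.

Lemma form_conj N (g J u : 'M[F]_N) c : g \in unitmx ->
  (invmx g *m u *m g)^T *m J *m (invmx g *m u *m g) = c *: J <->
  u^T *m ((invmx g)^T *m J *m invmx g) *m u = c *: ((invmx g)^T *m J *m invmx g).
Proof.
move=> ug.
have -> : (invmx g *m u *m g)^T *m J *m (invmx g *m u *m g) =
    g^T *m (u^T *m ((invmx g)^T *m J *m invmx g) *m u) *m g by rewrite !trmx_mul !mulmxA.
have TV : (invmx g)^T *m g^T = 1%:M by rewrite -trmx_mul mulmxV // trmx1.
have VT : g^T *m (invmx g)^T = 1%:M by rewrite -trmx_mul mulVmx // trmx1.
move: (_ *m u) => X; split=> [E|->].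
  have <- : (invmx g)^T *m (g^T *m X *m g) *m invmx g = X by rewrite !mulmxA TV mul1mx mulmxK.
  by rewrite E -scalemxAr -scalemxAl.
by rewrite -scalemxAr -scalemxAl !mulmxA VT mul1mx mulmxKV.
Qed.

Lemma row_conj N (g u : 'M[F]_N) (eps : 'rV_N) c : g \in unitmx ->
  eps *m (invmx g *m u *m g) = c *: eps <-> (eps *m invmx g) *m u = c *: (eps *m invmx g).
Proof.
move=> ug; split=> [E|E]; last by rewrite !mulmxA E -scalemxAl mulmxKV.
by rewrite scalemxAl -E !mulmxA mulmxK.
Qed.

Lemma col_conj N (g u : 'M[F]_N) (kap : 'cV_N) c : g \in unitmx ->
  (invmx g *m u *m g) *m kap = c *: kap <-> u *m (g *m kap) = c *: (g *m kap).
Proof.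
move=> ug; split=> [E|E]; last by rewrite -!mulmxA E -scalemxAr mulKmx.
by rewrite scalemxAr -E !mulmxA mulmxV // mul1mx.
Qed.

Lemma isometry_conj N (J g u : 'M[F]_N) eps kap : g \in unitmx ->
  isometry J eps kap (invmx g *m u *m g) <->
  isometry ((invmx g)^T *m J *m invmx g) (eps *m invmx g) (g *m kap) u.
Proof.
move=> ug; have := form_conj J u 1 ug; have := row_conj u eps 1 ug.
by have := col_conj u kap 1 ug; rewrite !scale1r => K E B; split=> [[/B ? /E ? /K ?]|[/B ? /E ? /K ?]].
Qed.

Lemma skew_conj N (J g : 'M[F]_N) : J^T = - J ->
  ((invmx g)^T *m J *m invmx g)^T = - ((invmx g)^T *m J *m invmx g).
Proof. by move=> sJ; rewrite !trmx_mul trmxK sJ mulNmx mulmxN mulmxA. Qed.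

Lemma isometry_parabolically_connected N (J : 'M[F]_N) eps kap (H : mxset F N) :
  J^T = - J -> (forall h, isometry J eps kap h -> \det h * \det h = 1) ->
  (forall h, H h <-> isometry J eps kap h) -> parabolically_connected H.
Proof.
move=> sJ dJ HE; apply: parabolically_connected_lowSL => g u ug [lu du] /HE/isometry_conj-/(_ ug) iu.
have := @isometry_joined F char2 N _ _ _ u (skew_conj g sJ) _ lu iu du.
move=> /(_ _)-J1; apply: joined_sub (J1 _) => [v [[lv iv] dv]|v iv].
  by split; [split | apply/HE/isometry_conj].
have /dJ : isometry J eps kap (invmx g *m v *m g) by apply/isometry_conj.
by rewrite !conjV_det.
Qed.

Section Symplectic.
Variables (n : nat) (J : 'M[F]_(2 * n)).
Hypothesis (skewJ : J^T = - J) (uJ : J \in unitmx).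

Lemma symplectic_det S : Sp_set J S -> \det S * \det S = 1.
Proof.
have dJ : \det J != 0 by rewrite -unitfE -unitmxE.
move=> /(congr1 determinant); rewrite !det_mulmx det_tr mulrAC -[RHS]mul1r.
exact: mulIf.
Qed.

Lemma Sp_set_parabolically_connected : parabolically_connected (Sp_set J).
Proof.
apply: (@isometry_parabolically_connected _ J 0 0) => //.
  by move=> h [/symplectic_det].
by move=> h; split=> [HJ|[]//]; split=> //; rewrite ?mul0mx ?mulmx0.
Qed.

Let J1 : 'M[F]_(2 * n + 1) := block_mx J 0 0 0.
Let eps : 'rV[F]_(2 * n + 1) := row_mx 0 1%:M.
Let kap : 'cV[F]_(2 * n + 1) := col_mx 0 1%:M.

Let J1_skew : J1^T = - J1.
Proof. by rewrite /J1 tr_block_mx !trmx0 opp_block_mx skewJ !oppr0. Qed.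

Let J1_similitude (X : 'M[F]_(2 * n + 1)) a b :
  [/\ X^T *m J1 *m X = a *: J1, eps *m X = b *: eps & X *m kap = b *: kap] <->
  exists2 A : 'M_(2 * n), A^T *m J *m A = a *: J & X = block_mx A 0 0 b%:M.
Proof.
split=> [|[A AJ ->]].
  rewrite -[X]submxK /eps /kap mul_row_block mul_block_col.
  rewrite !(mul1mx, mul0mx, mulmx0, mulmx1, addr0, add0r) scale_row_mx (scale_col_mx b).
  rewrite !scaler0 !scalemx1 => [[E1 /eq_row_mx [-> Edr] /eq_col_mx [Eur _]]].
  move: E1; rewrite Edr Eur tr_block_mx !trmx0 /J1 !mulmx_block.
  rewrite !(mul0mx, mulmx0, addr0, add0r) scale_block_mx => /eq_block_mx [E _ _ _].
  by exists (ulsubmx X).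
rewrite /eps /kap mul_row_block mul_block_col /J1 tr_block_mx !mulmx_block !trmx0.
rewrite !(mul1mx, mul0mx, mulmx0, mulmx1, addr0, add0r) scale_row_mx (scale_col_mx b).
by rewrite scale_block_mx !scaler0 AJ scalemx1.
Qed.

Let Sp_set1E X : Sp_set1 J X <-> isometry J1 eps kap X.
Proof.
have := J1_similitude X 1 1; rewrite !scale1r => H; split.
  by move=> [S [SJ EX]]; apply/H; exists S.
by move/H => [A AJ EX]; exists A.
Qed.

Lemma isometry1_det X : isometry J1 eps kap X -> \det X * \det X = 1.
Proof.
move=> /Sp_set1E [S [SJ ->]]; rewrite det_ublock det1 mulr1.
exact: symplectic_det.
Qed.

Lemma Sp_set1_parabolically_connected : parabolically_connected (Sp_set1 J).
Proof. exact: isometry_parabolically_connected J1_skew isometry1_det Sp_set1E. Qed.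

(** Membership in Sp(2n) x T^1 with T^1-component [l], written as equations that can be transported
    by [g]. *)
Let similitude l (X J' : 'M[F]_(2 * n + 1)) (e : 'rV[F]_(2 * n + 1))
    (k : 'cV[F]_(2 * n + 1)) :=
  [/\ X^T *m J' *m X = (l * l) *: J', e *m X = l ^- (2 * n) *: e & X *m k = l ^- (2 * n) *: k].

Let SpT_setE X : SpT_set J X <-> exists2 l, l != 0 & similitude l X J1 eps kap.
Proof.
split=> [[S [l [SJ l0 ->]]]|[l l0 /J1_similitude [A AJ ->]]].
  exists l => //; apply/J1_similitude; exists (l *: S) => //.
  by rewrite trmx_scale -!scalemxAl -scalemxAr scalerA SJ.
exists (l^-1 *: A), l; split=> //; last by rewrite scalerA mulfV // scale1r.
rewrite /Sp_set trmx_scale -!scalemxAl -scalemxAr AJ !scalerA.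
by rewrite mulrACA !mulVf // mulr1 scale1r.
Qed.

Let SpT_det X : SpT_set J X -> \det X * \det X = 1.
Proof.
move=> [S [l [SJ l0 ->]]]; rewrite det_ublock detZ det_scalar1.
have -> : l ^+ (2 * n) * \det S * l ^- (2 * n) = \det S.
  by rewrite mulrAC mulfV ?mul1r // expf_neq0.
exact: symplectic_det.
Qed.

Let J1_radical (x : 'cV[F]_(2 * n + 1)) : J1 *m x = 0 -> exists c, x = c *: kap.
Proof.
rewrite -[x]vsubmxK mul_block_col !mul0mx !addr0 => /(congr1 usubmx).
rewrite col_mxKu linear0 => Jx; exists (dsubmx x 0 0).
have -> : usubmx x = 0 by rewrite -[LHS](mulKmx uJ) Jx mulmx0.
by rewrite /kap scale_col_mx scaler0 scalemx1 -mx11_scalar.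
Qed.

(* [t^(-2n) P + t^(2n+2) (1 - P)] is [t] times an element of [Sp(2n)] having
   the eigenvalues [t^(2n+1)] and [t^(-2n-1)], times [t^(-2n)] on the line:
   moving along it changes the multiplier of an element of [Sp(2n) x T^1]. *)
Lemma SpT_set_parabolically_connected : parabolically_connected (SpT_set J).
Proof.
apply: parabolically_connected_lowSL => g u ug [lu du] Hu.
pose J' := (invmx g)^T *m J1 *m invmx g; pose e := eps *m invmx g; pose k := g *m kap.
have SimE v : SpT_set J (invmx g *m v *m g) <-> exists2 l, l != 0 & similitude l v J' e k.
  split=> [/SpT_setE [l l0 [/(form_conj _ _ _ ug) A /(row_conj _ _ _ ug) B /(col_conj _ _ _ ug) C]]|].
    by exists l.
  move=> [l l0 [A B C]]; apply/SpT_setE; exists l => //.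
  by split; [apply/(form_conj _ _ _ ug) | apply/(row_conj _ _ _ ug) | apply/(col_conj _ _ _ ug)].
have sJ' : J'^T = - J' by apply: skew_conj J1_skew.
have [||||P [lP PP _ _ [PJ eP]]] := @lagrangian_peel F _ char2 J' e sJ' (2 * n + 1) 1%:M.
- exact: lowk_scalar.
- by rewrite mulmx1.
- by rewrite trmx1 mul1mx mulmx1.
- by move=> i j; rewrite leqNgt ltn_ord.
pose Q := 1%:M - P.
have PQ : P *m Q = 0 by rewrite mulmxBr mulmx1 PP subrr.
have QP : Q *m P = 0 by rewrite mulmxBl mul1mx PP subrr.
have QQ : Q *m Q = Q by rewrite {1}/Q mulmxBl mul1mx PQ subr0.
have sumPQ : P + Q = 1%:M by rewrite addrC subrK.
have QJ : Q^T *m J' = J' *m P.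
  by rewrite linearB /= trmx1 mulmxBl mul1mx PJ mulmxBr mulmx1 opprB addrC subrK.
have ePe : e *m P = e.
  by apply/eqP; rewrite -subr_eq0 -opprB oppr_eq0 -{1}[e]mulmx1 -mulmxBr eP.
have ek : e *m k = 1%:M.
  by rewrite /e /k mulmxA mulmxKV // mul_row_col mul0mx add0r mulmx1.
have J'k : J' *m k = 0.
  rewrite /J' /k !mulmxA mulmxKV // -mulmxA /J1 /kap mul_block_col !mul0mx !mulmx0 !addr0.
  by rewrite col_mx0 mulmx0.
(* [k] spans the radical of [J'], and adjointness puts [P *m k] in the radical; the factor is 1
   because [e] is unchanged by [P]. *)
have Pk : P *m k = k.
  have J'P : J' *m (P *m k) = 0.
    by rewrite mulmxA -QJ -mulmxA J'k mulmx0.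
  have [|c Ec] := @J1_radical (invmx g *m (P *m k)).
    have := congr1 (mulmx g^T) J'P; rewrite mulmx0 /J' !mulmxA => <-.
    by rewrite -trmx_mul mulVmx // trmx1 mul1mx.
  have {}Ec : P *m k = c *: k by rewrite /k scalemxAr -Ec mulKVmx.
  have : e *m (P *m k) = c%:M by rewrite Ec -scalemxAr ek scalemx1.
  rewrite mulmxA ePe ek => /(congr1 (fun X : 'M_1 => X 0 0)).
  by rewrite !mxE eqxx !mulr1n Ec => <-; rewrite scale1r.
have eQ : e *m Q = 0 by [].
have Qk : Q *m k = 0 by rewrite mulmxBl mul1mx Pk subrr.
have PJ' : P^T *m J' = J' *m Q := PJ.
clearbody Q.
have [l l0 Su] := (SimE u).1 Hu.
(* The exponent on [P] is dictated by [k], which lies in its image; the one on [Q] makes the product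
   of the two coefficients t^2, the multiplier of the form. *)
pose d t := t ^- (2 * n) *: P + t ^+ (2 * n).+2 *: Q.
have ld t : low (d t).
  have -> : d t = t ^- (2 * n) *: P + t ^+ (2 * n).+2 *: (1%:M - P).
    by rewrite /d -sumPQ addrAC subrr add0r.
  by apply: lowkD; apply: lowkZ => //; apply: lowkB => //; exact: lowk_scalar.
have d1 : d 1 = 1%:M by rewrite /d !expr1n invr1 !scale1r.
have Sd t : t != 0 -> similitude t (d t) J' e k.
  move=> t0; split.
  - have -> : (d t)^T *m J' = J' *m (t ^- (2 * n) *: Q + t ^+ (2 * n).+2 *: P).
      have -> : (d t)^T = t ^- (2 * n) *: P^T + t ^+ (2 * n).+2 *: Q^T.
        by apply/matrixP => i j; rewrite !mxE.
      by rewrite mulmxDl -!scalemxAl PJ' QJ mulmxDr -!scalemxAr.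
    rewrite -mulmxA; suff -> : (t ^- (2 * n) *: Q + t ^+ (2 * n).+2 *: P) *m d t = (t * t)%:M.
      by rewrite mul_mx_scalar.
    rewrite mulmxDl !mulmxDr.
    do ![rewrite -scalemxAl | rewrite -scalemxAr]; rewrite QP QQ PQ PP !scaler0 add0r addr0 !scalerA.
    have -> : t ^- (2 * n) * t ^+ (2 * n).+2 = t * t.
      by rewrite !exprS mulrC -mulrA -mulrA mulfV ?mulr1 ?expf_neq0 .
    have -> : t ^+ (2 * n).+2 * t ^- (2 * n) = t * t.
      by rewrite !exprS -mulrA -mulrA mulfV ?mulr1 ?expf_neq0.
    by rewrite -scalerDr addrC sumPQ scalemx1.
  - by rewrite mulmxDr -!scalemxAr ePe eQ scaler0 addr0.
  - by rewrite mulmxDl -!scalemxAl Pk Qk scaler0 addr0.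
have SM t v s : similitude t (d t) J' e k -> similitude s v J' e k -> similitude (t * s) (d t *m v) J' e k.
  move=> [A1 B1 C1] [A2 B2 C2]; split.
  - have -> : (d t *m v)^T *m J' *m (d t *m v) = v^T *m ((d t)^T *m J' *m d t) *m v.
      by rewrite trmx_mul !mulmxA.
    by rewrite A1 -scalemxAr -scalemxAl A2 scalerA mulrACA.
  - by rewrite mulmxA B1 -scalemxAl B2 scalerA exprMn invfM.
  - by rewrite -mulmxA C2 -scalemxAr C1 scalerA exprMn invfM mulrC.
pose Y v := low v /\ SpT_set J (invmx g *m v *m g).
have Ydet v : Y v -> \det v * \det v = 1.
  by move=> [_ /SpT_det]; rewrite conjV_det.
(* The components in T^1 multiply, so that of [u'] is 1 and [u'] is an isometry. *)
pose u' := d l^-1 *m u.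
have lV0 : l^-1 != 0 by rewrite invr_eq0.
have Juu' : joined (fun v => Y v /\ \det v = 1) u u'.
  rewrite -[X in joined _ X _]mul1mx -d1.
  apply: (@joined_curve_det _ char2 _ Y 'X (fun t => d t *m u)) => //.
  - apply: mxratlM; last exact: mxratl_const.
    apply: mxratlD; apply: mxratlZ; try exact: mxratl_const.
      apply: (eq_ratl _ (ratlX (2 * n) (ratl_inv (dvdpp 'X)))) => t.
      by rewrite hornerX exprVn.
    exact/ratlX/ratl_var.
  - move=> t; rewrite hornerX => t0; split; first exact: lowkM (ld t) lu.
    by apply/SimE; exists (t * l); [rewrite mulf_neq0 | apply: SM => //; exact: Sd].
  - by rewrite hornerX oner_eq0.
  - by rewrite hornerX.
  - by rewrite d1 mul1mx.
have [_ [[lu' _] du'] _] := Juu'.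
have iu' : isometry J' e k u'.
  have := SM _ _ _ (Sd _ lV0) Su; rewrite mulVf // => [[A B C]].
  by rewrite mulr1 expr1n invr1 !scale1r in A B C.
have dI v : isometry J' e k v -> \det v * \det v = 1.
  move=> iv; rewrite -(conjV_det v ug); apply: isometry1_det.
  exact/isometry_conj.
have J1u' := isometry_joined char2 sJ' dI lu' iu' du'.
have J2 : joined (fun v => Y v /\ \det v = 1) 1%:M u.
  apply: joined_trans (joined_sym Juu'); apply: joined_sub J1u' => v [[lv [A B C]] dv].
  split=> //; split=> //; apply/SimE; exists 1; first exact: oner_neq0.
  by split; rewrite ?mulr1 ?expr1n ?invr1 ?scale1r.
by apply: joined_sub J2 => v [[lv Hv] dv].
Qed.

End Symplectic.
End SymplecticCases.

(** * The subgroups that are not parabolically connected *)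

Section NotConnected.
Variable F : closedFieldType.
Hypothesis char2 : (2 : F) != 0.

Lemma one_neq_opp1 : (1 : F) != -1.
Proof. by rewrite -subr_eq0 opprK. Qed.

Lemma sqr_eq1 (a : F) : a * a = 1 -> a = 1 \/ a = -1.
Proof.
move=> a2; have : (a - 1) * (a + 1) == 0.
  have -> : (a - 1) * (a + 1) = a * a - 1 by ring.
  by rewrite a2 subrr.
rewrite mulf_eq0 subr_eq0 addr_eq0 => /orP[/eqP ->|/eqP ->]; by [left|right].
Qed.

Lemma not_zconnected N (X Z1 Z2 : mxset F N) A B : zclosed Z1 -> zclosed Z2 ->
  (forall C, X C -> Z1 C \/ Z2 C) -> (forall C, X C -> Z1 C -> Z2 C -> False) ->
  X A -> Z1 A -> X B -> Z2 B -> ~ zconnected X.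
Proof.
move=> c1 c2 cov disj XA ZA XB ZB /(_ Z1 Z2 c1 c2 cov disj) [H|H].
  exact: (disj B XB (H B XB)).
exact: (disj A XA ZA (H A XA)).
Qed.

Lemma SGLxGL_not_parabolically_connected n : (0 < n)%N ->
  ~ parabolically_connected (@SGLxGL F n n).
Proof.
(* The first [n] rows of [g] span the diagonal subspace, so the conjugate by [g] of the flag
   stabiliser is the stabiliser of the diagonal. *)
move=> n0; pose g : 'M[F]_(n + n) := block_mx 1%:M 1%:M 0 1%:M.
pose gV : 'M[F]_(n + n) := block_mx 1%:M (- 1%:M) 0 1%:M.
have ggV : g *m gV = 1%:M.
  rewrite mulmx_block !(mul1mx, mul0mx, mulmx0, mulmx1, addr0, add0r) addNr.
  by rewrite -scalar_mx_block.
have ug : g \in unitmx by case: (mulmx1_unit ggV).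
have EV : invmx g = gV by rewrite -[LHS]mulmx1 -ggV mulKmx.
move=> /(_ _ (flag_stabilizer_parabolic n ug)).
have conjE (A B : 'M_n) : g *m block_mx A 0 0 B *m invmx g = block_mx A (B - A) 0 B.
  rewrite EV !mulmx_block !(mul1mx, mul0mx, mulmx0, mulmx1, addr0, add0r) mulmxN mulmx1.
  by rewrite addrC.
have XE X : conjset g (@flag_stabilizer F (n + n) n) X /\ SGLxGL X <->
    exists2 A : 'M_n, X = block_mx A 0 0 A & \det A * \det A = 1.
  split=> [[[H _] [A [B [EX dAB]]]]|[A -> dA]].
    rewrite EX conjE in H; have AB : B = A.
      apply/eqP; rewrite -subr_eq0; apply/eqP/matrixP => i j.
      have := H (lshift n i) (rshift n j) (ltn_ord i) (leq_addr _ _).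
      by rewrite block_mxEur => ->; rewrite mxE.
    by exists A; rewrite ?EX -{2}AB // AB.
  split; last by exists A, A.
  split; last by rewrite conj_det // det_ublock.
  rewrite conjE subrr => i j; case: (split_ordP i) => i' -> //.
  case: (split_ordP j) => j' -> _ jn.
    by move: (leq_trans (ltn_ord j') jn); rewrite ltnn.
  by rewrite block_mxEur mxE.
pose D c (X : 'M[F]_(n + n)) := \det (ulsubmx X) = c.
have zD c : zclosed (D c).
  have P : polymap (fun X : 'M[F]_(n + n) => ulsubmx X).
    move=> i j; apply: (eq_polyfun _ (polyfun_entry F (lshift n i) (lshift n j))) => X.
    by rewrite !mxE.
  have PD := polyfunB (polyfun_comp (@polyfun_det F n) P) (polyfun_const (n + n) c).
  apply: (eq_zclosed _ (zclosed_zero PD)) => X.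
  by split=> [/eqP|->]; rewrite ?subrr // subr_eq0 => /eqP.
pose i0 := Ordinal n0.
(* The matrix diag(-1, 1, ..., 1). *)
pose R : 'M[F]_n := 1%:M + (- 2 *: delta_mx i0 0) *m delta_mx (0 : 'I_1) i0.
have dR : \det R = -1.
  rewrite det_rank1 -scalemxAr mul_delta_mx !mxE !eqxx mulr1.
  by ring.
apply: (not_zconnected (zD 1) (zD (-1)) (A := 1%:M) (B := block_mx R 0 0 R)).
- move=> X /XE [A -> dA]; rewrite /D block_mxKul; exact: sqr_eq1.
- by move=> X _; rewrite /D => -> /eqP; rewrite (negPf one_neq_opp1).
- by apply/XE; exists 1%:M; rewrite ?det1 ?mulr1 // -scalar_mx_block.
- by rewrite /D (scalar_mx_block n n) block_mxKul det1.
- by apply/XE; exists R => //; rewrite dR mulrN mulr1 opprK.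
- by rewrite /D block_mxKul.
Qed.

Section Orthogonal.
Variables (n : nat) (Q : 'M[F]_n.+2).
Hypothesis (symQ : Q^T = Q) (uQ : Q \in unitmx).
(** The group preserves [Q] on column vectors; flags consist of row vectors, on which the preserved
    form is the inverse of [Q]. *)
Let S := invmx Q.
Let b (x y : 'rV[F]_n.+2) := (x *m S *m y^T) 0 0.

Let symS : S^T = S. Proof. by rewrite /S trmx_inv symQ. Qed.
Let uS : S \in unitmx. Proof. by rewrite unitmx_inv. Qed.

Let bE x y : x *m S *m y^T = (b x y)%:M.
Proof. exact: mx11_scalar. Qed.
Let bC x y : b x y = b y x.
Proof.
have sym (X : 'M[F]_1) : X^T = X by apply/matrixP => i j; rewrite !ord1 mxE.
by rewrite /b -[in LHS](sym (_ *m _)) !trmx_mul trmxK symS mulmxA.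
Qed.
Let bDl x y z : b (x + y) z = b x z + b y z.
Proof. by rewrite /b !mulmxDl mxE. Qed.
Let bZl c x z : b (c *: x) z = c * b x z.
Proof. by rewrite /b -!scalemxAl mxE. Qed.
Let bDr x y z : b x (y + z) = b x y + b x z.
Proof. by rewrite bC bDl !(bC x). Qed.
Let bZr c x z : b x (c *: z) = c * b x z.
Proof. by rewrite bC bZl (bC x). Qed.

Let nondeg x : x != 0 -> exists y, b x y = 1.
Proof.
move=> x0; have xS : x *m S != 0.
  by apply: contraNneq x0 => E; rewrite -[x](mulmxK uS) E mul0mx.
have [j xj _] := last_nz xS.
exists (((x *m S) 0 j)^-1 *: delta_mx 0 j); rewrite bZr /b.
have -> : (x *m S *m (delta_mx (0 : 'I_1) j)^T) 0 0 = (x *m S) 0 j.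
  by rewrite trmx_delta -colE mxE.
by rewrite mulVf.
Qed.

Let nonisotropic_of x y : b x x = 0 -> b x y = 1 -> b y y != 0 \/ b (y + x) (y + x) != 0.
Proof.
move=> xx xy; have [yy|] := eqVneq (b y y) 0; [right|by left].
by rewrite bDl !bDr yy xx (bC y) xy addr0 add0r.
Qed.

(** The reflection in [w] changes the sign of [w] but has determinant -1; the one in [w'] restores
    the determinant and fixes [w]. *)
Let orthogonal_pair : exists w w', [/\ b w w != 0, b w' w' != 0 & b w w' = 0].
Proof.
have [w ww] : exists w, b w w != 0.
  pose x : 'rV[F]_n.+2 := delta_mx 0 0.
  have [xx|] := eqVneq (b x x) 0; last by exists x.
  have x0 : x != 0.
    by apply/eqP => /rowP/(_ 0); rewrite !mxE !eqxx => /eqP; rewrite oner_eq0.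
  have [y xy] := nondeg x0.
  by case: (nonisotropic_of xx xy) => ?; [exists y | exists (y + x)].
exists w.
have [x x0 wx] : exists2 x, x != 0 & b w x = 0.
  have K0 : kermx (S *m w^T) != 0.
    rewrite kermx_eq0 /row_free; apply/eqP => rk.
    by have := rank_leq_col (S *m w^T); rewrite rk.
  have [i ri] : exists i, row i (kermx (S *m w^T)) != 0.
    apply/existsP; apply: contraNT K0 => /existsPn H0; apply/eqP/row_matrixP => i.
    by rewrite row0; apply/eqP/negbNE/H0.
  exists (row i (kermx (S *m w^T))) => //.
  by rewrite bC /b -mulmxA -row_mul mulmx_ker row0 mxE.
have [xx|xx] := eqVneq (b x x) 0; last by exists x.
have [y xy] := nondeg x0.
(* The component of [y] orthogonal to [w]; it still pairs to 1 with [x]. *)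
pose z := y - (b w y / b w w) *: w.
have wz : b w z = 0 by rewrite /z -scaleNr bDr bZr mulNr divfK // subrr.
have xz : b x z = 1 by rewrite /z -scaleNr bDr bZr (bC x w) wx mulr0 addr0.
case: (nonisotropic_of xx xz) => zz; first by exists z.
by exists (z + x); split=> //; rewrite bDr wz wx addr0.
Qed.

Let refl (w : 'rV[F]_n.+2) : 'M[F]_n.+2 := 1%:M + (- (2 / b w w) *: (S *m w^T)) *m w.

Let refl_det w : b w w != 0 -> \det (refl w) = -1.
Proof.
move=> ww; rewrite /refl det_rank1 -scalemxAr mulmxA bE !mxE eqxx mulr1n mulNr divfK //.
by ring.
Qed.

Let refl_mul w x : x *m refl w = x - (2 / b w w * b x w) *: w.
Proof.
rewrite /refl mulmxDr mulmx1 mulmxA -scalemxAr mulmxA bE -scalemxAl mul_scalar_mx.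
by rewrite scalerA mulNr scaleNr.
Qed.

Let refl_form w : b w w != 0 -> (refl w)^T *m Q *m refl w = Q.
Proof.
move=> ww; pose c := 2 / b w w.
have -> : (refl w)^T = 1%:M - c *: (w^T *m (w *m S)).
  rewrite /refl linearD /= trmx1 trmx_mul trmx_scale trmx_mul trmxK symS.
  by rewrite scaleNr mulmxN -scalemxAr.
have -> : refl w = 1%:M - c *: (S *m w^T *m w) by rewrite /refl scaleNr mulNmx -scalemxAl.
have E1 : w^T *m (w *m S) *m Q = w^T *m w by rewrite /S -!mulmxA mulVmx // mulmx1.
have E2 : Q *m (S *m w^T *m w) = w^T *m w by rewrite /S !mulmxA mulmxV // mul1mx.
have E3 : w^T *m w *m (S *m w^T *m w) = b w w *: (w^T *m w).
  by rewrite -mulmxA !(mulmxA w) bE mul_scalar_mx scalemxAr.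
rewrite mulmxBl mul1mx -scalemxAl E1 mulmxBr mulmx1 -scalemxAr mulmxBl E2 -scalemxAl E3.
rewrite scalerA [c * _]divfK //.
have -> : w^T *m w - 2 *: (w^T *m w) = - (w^T *m w) by mxabel.
by rewrite scalerN opprK subrK.
Qed.

(** An orthogonal matrix stabilising the line of a nonisotropic [w] multiplies [w] by 1 or -1, and
    both closed conditions occur: for the identity and for the product of the two reflections. *)
Lemma SO_set_not_parabolically_connected2 : ~ parabolically_connected (SO_set Q).
Proof.
have [w [w' [ww ww' w_w']]] := orthogonal_pair.
have w0 : w != 0 by apply: contraNneq ww => ->; rewrite /b !mul0mx mxE.
have [g ug gw] := complete_row w0.
move=> /(_ _ (flag_stabilizer_parabolic 1 ug)).
have formS A : A^T *m Q *m A = Q -> A *m S *m A^T = S.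
  move=> AQ; have uA : A \in unitmx.
    have : A^T *m Q *m A \in unitmx by rewrite AQ.
    by rewrite !unitmx_mul => /andP[].
  have E : Q *m A *m S = invmx A^T.
    have uAT : A^T \in unitmx by rewrite unitmx_tr.
    by apply: (can_inj (mulKmx uAT)); rewrite mulmxV // !mulmxA AQ mulmxV.
  apply: (can_inj (mulKmx uQ)); rewrite !mulmxA E mulVmx ?unitmx_tr //.
  by rewrite mulmxV.
pose X A := conjset g (@flag_stabilizer F n.+2 1) A /\ SO_set Q A.
have eig A : conjset g (@flag_stabilizer F n.+2 1) A <->
    (exists c, w *m A = c *: w) /\ \det A = 1.
  have E : row 0 (g *m A *m invmx g) = w *m A *m invmx g by rewrite !row_mul gw.
  have gV : w *m invmx g = delta_mx 0 0 by rewrite -gw -row_mul mulmxV // rowE mulmx1.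
  rewrite /conjset /flag_stabilizer conj_det //; split=> [[H dA]|[[c wA] dA]]; split=> //.
    exists ((g *m A *m invmx g) 0 0).
    have Ew : w = delta_mx 0 0 *m g by rewrite -gw rowE.
    move: (g *m A *m invmx g) H E => M H E.
    have Er : row 0 M = M 0 0 *: delta_mx 0 0.
      apply/rowP => j; rewrite [RHS]mxE [X in _ = _ * X]mxE [LHS]mxE eqxx.
      case: eqP => [->|/eqP j0]; rewrite ?mulr1 // mulr0 H // lt0n.
      by apply: contra j0 => /eqP j0; apply/eqP/val_inj.
    by rewrite -[LHS](mulmxKV ug) -E Er -scalemxAl -Ew.
  move=> i j; rewrite ltnS leqn0 => /eqP i0 j0.
  have -> : i = 0 by apply/val_inj.
  have := congr1 (fun r : 'rV[F]_n.+2 => r 0 j) E.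
  rewrite wA -scalemxAl gV [LHS]mxE => ->.
  by rewrite !mxE eqxx -val_eqE /= gtn_eqF // mulr0.
have XE A : X A -> w *m A = w \/ w *m A = - w.
  move=> [/eig [[c wA] _] [AQ _]].
  have : b (w *m A) (w *m A) = b w w.
    by rewrite /b trmx_mul !mulmxA -(mulmxA w) -(mulmxA w) (formS _ AQ).
  rewrite wA bZl bZr mulrA -[RHS]mul1r => /(mulIf ww) /sqr_eq1 [->|->].
    by left; rewrite scale1r.
  by right; rewrite scaleN1r.
pose Z v (A : 'M[F]_n.+2) := w *m A = v.
have zZ v : zclosed (Z v).
  apply: zclosed_mxeq; last exact: polymap_const.
  by apply: polymapM; [exact: polymap_const | exact: polymap_id].
have wR : w *m (refl w *m refl w') = - w.
  rewrite mulmxA (refl_mul w) divfK //; have -> : w - 2 *: w = - w by mxabel.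
  have bw : b (- w) w' = 0 by rewrite -scaleN1r bZl w_w' mulr0.
  by rewrite refl_mul bw mulr0 scale0r subr0.
apply: (not_zconnected (zZ w) (zZ (- w)) (A := 1%:M) (B := refl w *m refl w')).
- exact: XE.
- move=> A _; rewrite /Z => -> /eqP; rewrite -addr_eq0 -mulr2n -scaler_nat scaler_eq0.
  by rewrite (negPf char2) (negPf w0).
- split; first by apply/eig; rewrite det1; split=> //; exists 1; rewrite mulmx1 scale1r.
  by split; rewrite ?det1 // trmx1 mul1mx mulmx1.
- exact: mulmx1.
- have dR : \det (refl w *m refl w') = 1 by rewrite det_mulmx !refl_det // mulrN mulr1 opprK.
  split; first by apply/eig; split=> //; exists (-1); rewrite wR scaleN1r.
  split=> //; rewrite trmx_mul.
  have -> : (refl w')^T *m (refl w)^T *m Q *m (refl w *m refl w') =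
      (refl w')^T *m ((refl w)^T *m Q *m refl w) *m refl w' by rewrite !mulmxA.
  by rewrite !refl_form.
- exact: wR.
Qed.

End Orthogonal.

Lemma SO_set_not_parabolically_connected n (Q : 'M[F]_n) : (1 < n)%N ->
  Q^T = Q -> Q \in unitmx -> ~ parabolically_connected (SO_set Q).
Proof.
case: n Q => [|[|n]] // Q _; exact: SO_set_not_parabolically_connected2.
Qed.

End NotConnected.

Theorem theorem1 (F : closedFieldType) (hF : [pchar F] =i pred0) :
  (forall m n : nat, (0 < m)%N -> (0 < n)%N ->
         parabolically_connected (@SLxSL F m n)) /\
      (forall m n : nat, (0 < m)%N -> (0 < n)%N -> m != n ->
         parabolically_connected (@SGLxGL F m n)) /\
      (forall (n : nat) (J : 'M[F]_(2 * n)), (0 < n)%N ->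
         J^T = - J -> J \in unitmx -> parabolically_connected (Sp_set J)) /\
      (forall (n : nat) (J : 'M[F]_(2 * n)), (0 < n)%N ->
         J^T = - J -> J \in unitmx -> parabolically_connected (Sp_set1 J)) /\
      (forall (n : nat) (J : 'M[F]_(2 * n)), (0 < n)%N ->
         J^T = - J -> J \in unitmx -> parabolically_connected (SpT_set J)) /\
      (forall (n : nat) (Q : 'M[F]_n), (1 < n)%N ->
         Q^T = Q -> Q \in unitmx -> ~ parabolically_connected (SO_set Q)) /\
      (forall n : nat, (0 < n)%N -> ~ parabolically_connected (@SGLxGL F n n)).
Proof.
have char2 := char0_two hF.
split; first by move=> m n m0 n0; apply: parabolically_connected_lowSL => g u ug Tu;
  exact: (SLxSL_joined hF ug erefl).
split.
  move=> m n m0 n0 mn; apply: parabolically_connected_lowSL => g u ug Tu.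
  exact: (SGLxGL_joined hF ug erefl).
split; first by move=> n J _; exact: Sp_set_parabolically_connected.
split; first by move=> n J _; exact: Sp_set1_parabolically_connected.
split; first by move=> n J _; exact: SpT_set_parabolically_connected.
split; first exact: SO_set_not_parabolically_connected.
exact: SGLxGL_not_parabolically_connected.
Qed.
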